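(* Let $\epsilon\in(0,1]$ and let $P_0=\mathrm{Ber}(\epsilon)$ be the Bernoulli distribution with parameter $\epsilon$. Then for every $\lambda>0$, $$\lim_{n\to\infty}\frac1n I(\mathbf X,\mathbf Y)=\frac{\lambda\epsilon^2}{4}-\sup_{q\ge0}\left\{-\frac{\lambda q^2}{4}+\mathbb{E}\Big[\log\big(1-\epsilon+\epsilon e^{\sqrt{\lambda q}Z+\lambda qX_0-\lambda q/2}\big)\Big]\right\},$$ where $X_0\sim\mathrm{Ber}(\epsilon)$ and $Z\sim\mathcal N(0,1)$ are independent. For almost all $\lambda>0$, the maximizer $q^*(\lambda)$ of the expression in braces over $q\ge0$ is unique and $$\lim_{n\to\infty}\mathrm{MMSE}_n(\lambda)=\epsilon^2-q^*(\lambda)^2.$$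
   Context: For $\lambda>0$ and $n\ge 1$, consider $Y_{i,j}=\sqrt{\lambda/n}\,X_iX_j+Z_{i,j}$ for $1\le i<j\le n$, where $X_i\overset{i.i.d.}{\sim}P_0$ and $Z_{i,j}\overset{i.i.d.}{\sim}\mathcal N(0,1)$ are independent; $\mathbf X=(X_1,\dots,X_n)$, $\mathbf Y=(Y_{i,j})_{i<j}$. $I(\mathbf X,\mathbf Y)$ is the mutual information (natural logarithm) and $$\mathrm{MMSE}_n(\lambda)=\frac{2}{n(n-1)}\sum_{1\le i<j\le n}\mathbb{E}\big[(X_iX_j-\mathbb{E}[X_iX_j|\mathbf Y])^2\big].$$ *)

(* Defs.v *)
From HB Require Import structures.
From mathcomp Require Import all_boot all_order all_algebra.
From mathcomp Require Import all_classical all_reals all_analysis measurable_realfun.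

Set Implicit Arguments.
Unset Strict Implicit.
Unset Printing Implicit Defensive.
Import Order.TTheory GRing.Theory Num.Theory.
Import numFieldNormedType.Exports.

Local Open Scope classical_set_scope.
Local Open Scope ring_scope.

Section probability_notions.
Context {R : realType} {d : measure_display} {T : measurableType d}.
Variable P : probability T R.

Definition has_law {d'} {T' : measurableType d'} (X : {RV P >-> T'})
    (mu : set T' -> \bar R) : Prop :=
  forall A, measurable A -> distribution P X A = mu A.

Definition mutually_independent (I : finType) {d'} {T' : measurableType d'}
    (W : I -> {RV P >-> T'}) : Prop :=
  forall (J : {set I}) (A : I -> set T'), (forall i, measurable (A i)) ->
    P (\bigcap_(i in [set` J]) (W i @^-1` A i)) =
    (\prod_(i in J) P (W i @^-1` A i))%E.

(* [W] is a real-valued version of E[V | Y], i.e. of the conditional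
   expectation of V given the sigma-algebra generated by Y. *)
Definition is_condexp {d'} {T' : measurableType d'} (V : T -> R)
    (Y : {RV P >-> T'}) (W : T -> R) : Prop :=
  let sigmaY := preimage_set_system [set: T] Y measurable in
  [/\ P.-integrable [set: T] (EFin \o W),
      forall B : set R, measurable B -> sigmaY (W @^-1` B) &
      forall A : set T, sigmaY A ->
        (\int[P]_(w in A) (W w)%:E = \int[P]_(w in A) (V w)%:E)%E].

(* A version picked by choice (it exists, and is unique up to P-a.e. equality,
   when V is integrable). *)
Definition condexp {d'} {T' : measurableType d'} (V : T -> R)
    (Y : {RV P >-> T'}) : T -> R := xget (cst 0) [set W | is_condexp V Y W].

End probability_notions.

(* The Bernoulli law as a Borel probability on the reals, carried by {0, 1}. *)
Definition bernoulli_law {R : realType} (p : R) : set R -> \bar R :=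
  pushforward (bernoulli_prob p) (fun b : bool => b%:R : R).

Section information.
Context {R : realType}.
Local Open Scope ereal_scope.
Local Open Scope charge_scope.

(* E_mu[log (dmu/dnu)] when mu << nu, and +oo otherwise; [lne] is the natural
   logarithm extended by lne 0 = -oo, a value taken only on a mu-null set. *)
Definition kl_divergence {d} {T : measurableType d} (mu nu : probability T R)
    : \bar R :=
  if pselect (mu `<< nu) then
    \int[mu]_x lne (('d (charge_of_finite_measure mu) '/d nu) x)
  else +oo.

Section pair_RV.
Context {d d1 d2} {T : measurableType d} {T1 : measurableType d1}
  {T2 : measurableType d2}.
Variables (X : {mfun T >-> T1}) (Y : {mfun T >-> T2}).

Definition pair_RV : T -> T1 * T2 := fun w => (X w, Y w).

Lemma measurable_pair_RV : measurable_fun [set: T] pair_RV.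
Proof. by apply: measurable_fun_pair; exact: measurable_funPT. Qed.

HB.instance Definition _ :=
  isMeasurableFun.Build _ _ _ _ pair_RV measurable_pair_RV.

End pair_RV.

Definition mutual_information {d d1 d2} {T : measurableType d}
    {T1 : measurableType d1} {T2 : measurableType d2} {P : probability T R}
    (X : {RV P >-> T1}) (Y : {RV P >-> T2}) : \bar R :=
  kl_divergence (distribution P (pair_RV X Y))
    (distribution P X \x distribution P Y).

End information.

Section tuple_RV.
Context {d d'} {T : measurableType d} {T' : measurableType d'}.
Variables (n : nat) (W : 'I_n -> {mfun T >-> T'}).

Definition tuple_RV : T -> n.-tuple T' := fun w => [tuple W i w | i < n].

Lemma measurable_tuple_RV : measurable_fun [set: T] tuple_RV.
Proof.
apply/measurable_fun_tnthP => i.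
rewrite (_ : _ \o _ = W i); first exact: measurable_funPT.
by apply/funext => w /=; rewrite tnth_mktuple.
Qed.

HB.instance Definition _ :=
  isMeasurableFun.Build _ _ _ _ tuple_RV measurable_tuple_RV.

End tuple_RV.

(* Pairs of indices i < j. *)
Notation edge n := {p : 'I_n * 'I_n | (p.1 < p.2)%N}.

Section spiked_wigner.
Context {R : realType} {d : measure_display} {T : measurableType d}.
Context {P : probability T R} {n : nat}.
Variables (lambda : R) (X : 'I_n -> {RV P >-> R}) (Z : edge n -> {RV P >-> R}).

Definition XX (e : edge n) : T -> R := fun w => X (val e).1 w * X (val e).2 w.

Lemma measurable_XX e : measurable_fun [set: T] (XX e).
Proof. by apply: measurable_funM; exact: measurable_funPT. Qed.

Definition Yedge (e : edge n) : T -> R :=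
  fun w => Num.sqrt (lambda / n%:R) * XX e w + Z e w.

Lemma measurable_Yedge e : measurable_fun [set: T] (Yedge e).
Proof.
apply: measurable_funD; last exact: measurable_funPT.
by apply: measurable_funM => //; exact: measurable_XX.
Qed.

HB.instance Definition _ e :=
  isMeasurableFun.Build _ _ _ _ (Yedge e) (measurable_Yedge e).

Definition signal : {RV P >-> n.-tuple R} := tuple_RV X.

(* The vector (Y_ij)_{i<j}, listed along the enumeration of the pairs i < j. *)
Definition observation : {RV P >-> #|{: edge n}|.-tuple R} :=
  tuple_RV (fun k => Yedge (enum_val k)).

Definition MMSE : \bar R :=
  ((2 / (n%:R * (n%:R - 1)))%:E *
   \sum_(e : edge n)
     'E_P[fun w => ((XX e w - condexp (XX e) observation w) ^+ 2)%R])%E.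

Definition signal_and_noise (k : 'I_n + edge n) : {RV P >-> R} :=
  match k with inl i => X i | inr e => Z e end.

End spiked_wigner.

Section potential.
Context {R : realType} {d : measure_display} {T : measurableType d}.
Context {P : probability T R}.
Variables (eps : R) (X0 Z0 : {RV P >-> R}) (lambda q : R).

(* The expression maximised over q >= 0. *)
Definition potential : \bar R :=
  ((- (lambda * q ^+ 2 / 4))%:E +
   'E_P[fun w => (ln (1 - eps + eps *
       expR (Num.sqrt (lambda * q) * Z0 w + lambda * q * X0 w
             - lambda * q / 2)))%R])%E.

End potential.

Definition nonneg_maximizer {R : realType} (f : R -> \bar R) (q : R) : Prop :=
  0 <= q /\ forall q' : R, 0 <= q' -> (f q' <= f q)%E.

(* Main.v *)
(* Let F_n be the mean of Z ln Z under pure noise, Z being the likelihood ratio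
   of the observation, and D_n the derivative of F_n in lambda. Then
   I(X, Y) = lambda (n - 1) eps^2 / 4 - F_n and MMSE_n = eps^2 - 4 D_n / (n - 1),
   so everything reduces to the limit f of F_n / n.

   Both bounds on F_n are instances of Kahane's comparison inequality, in which the
   difference of the covariances is a perfect square up to O(1). For the lower bound
   the quadratic field is compared with n scalar channels of signal-to-noise ratio
   lambda q. For the upper bound the planted signal is fixed, an independent field
   linear in the magnetisation m(x) is added (which costs nothing, by Jensen), and the
   sum is compared with scalar channels of signal-to-noise ratio lambda m(x); as m
   takes only n + 1 values, a union bound over m concludes. Kahane's inequality itself
   is obtained without differentiating, by cutting the Gaussian fields into N small
   independent steps and expanding each of them with an error o(1 / N).

   F_n / n is convex with slope D_n / n, so D_n / n converges wherever f has a single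
   subgradient, that is, off a countable set. By the envelope theorem q^2 / 4 is a
   subgradient of f for every maximiser q, which gives uniqueness and the MMSE. *)
Require Import Defs.
From HB Require Import structures.
From mathcomp Require Import all_boot all_order all_algebra.
From mathcomp Require Import all_classical all_reals all_analysis measurable_realfun.
From mathcomp Require Import ring lra.
Import Order.TTheory GRing.Theory Num.Theory.
Import numFieldNormedType.Exports.

Local Open Scope classical_set_scope.
Local Open Scope ring_scope.

Set Implicit Arguments.
Unset Strict Implicit.
Unset Printing Implicit Defensive.

(** * Gaussian expectations *)

(** A small step multiplies the partition function by a ratio u of mean 1. In ln u and u ln u the
    first-order term therefore has mean 0, and the second-order one is half a Gibbs average of the
    covariance between two replicas: a pointwise comparison of covariances is enough. No polynomial
    bounds ln from below near 0, so the remainder contains (u - 1)^4 / u. This function and (u -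
    1)^4 are convex in u, and Jensen under the Gibbs measure reduces both to moments of one
    log-normal variable, uniformly in the number of configurations. If the covariances of a step are
    at most M / N, its error is of order N^(-3/2), and N steps leave N^(-1/2).

    The same expansion yields chord inequalities for the free energy, so that convexity stands in
    for differentiation everywhere. The derivative of the scalar free energy is avoided as well: a
    maximiser q at lambda is tested at t with the value lambda q / t, which leaves the scalar
    channel unchanged.

    The signal entries are bits, hence idempotent: the missing diagonal of the sum over i < j is
    linear in the overlap, and after division by n it is the O(1) slack of the comparisons. *)

Section density.
Context {d} {T : measurableType d} {R : realType}.
Local Open Scope ereal_scope.

(** A Radon-Nikodym derivative is unique almost everywhere, so the change of variables known for the
    abstract derivative holds with the explicit density [p]. *)
Lemma ge0_integral_density (nu : {finite_measure set T -> \bar R})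
    (mu : {sigma_finite_measure set T -> \bar R}) (p : T -> R) :
  (forall x, (0 <= p x)%R) -> measurable_fun [set: T] p ->
  (forall A, measurable A -> nu A = \int[mu]_(x in A) (p x)%:E) ->
  forall f : T -> \bar R, (forall x, 0 <= f x) -> measurable_fun [set: T] f ->
  \int[nu]_x f x = \int[mu]_x (f x * (p x)%:E).
Proof.
move=> p0 mp nuE f f0 mf.
have numu : nu `<< mu.
  apply/null_content_dominatesP => A mA muA0.
  rewrite nuE//; apply: null_set_integral => //.
  by apply/measurable_funTS/measurable_EFinP.
rewrite -(Radon_Nikodym_SigmaFinite.change_of_variables numu f0 measurableT mf).
apply: ge0_ae_eq_integral => //.
- apply: emeasurable_funM => //.
  exact: measurable_int (Radon_Nikodym_SigmaFinite.f_integrable numu).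
- by apply: emeasurable_funM => //; exact/measurable_EFinP.
- by move=> x _; rewrite mule_ge0// Radon_Nikodym_SigmaFinite.f_ge0.
- by move=> x _; rewrite mule_ge0// lee_fin.
apply: ae_eqe_mul2l; apply: integral_ae_eq => //.
- exact: Radon_Nikodym_SigmaFinite.f_integrable.
- exact/measurable_EFinP.
- by move=> E _ mE; rewrite -Radon_Nikodym_SigmaFinite.f_integral// nuE.
Qed.
End density.

Section lebesgue_affine.
Context {R : realType}.
Local Notation mu := (@lebesgue_measure R).

(** The pushforward rescaled by [a] gives every half-open interval its length, and uniqueness of
    Lebesgue measure identifies it. *)
Lemma lebesgue_measure_affine (a m : R) (a0 : 0 < a) (A : set R) : measurable A ->
  pushforward mu (fun z : R => a * z + m : measurableTypeR R) A = (a^-1%:E * mu A)%E.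
Proof.
move=> mA.
have maff : @measurable_fun _ _ (measurableTypeR R) (measurableTypeR R)
    setT (fun z : R => a * z + m).
  by apply: measurable_funD => //; apply: measurable_funM.
have a0' : 0 <= a by exact: ltW.
pose nu' := mscale (NngNum a0') (pushforward mu (fun z : R => a * z + m : measurableTypeR R)).
pose nu : {measure set (measurableTypeR R) -> \bar R} := nu' maff.
have := @lebesgue_measure_unique R nu.
suff H : forall X : set R, ocitv X -> mu X = nu X.
  move=> /(_ H A mA) ->; rewrite [nu A](_ : _ = (a%:E * mu ((fun z => (a * z + m)%R) @^-1` A))%E)// /pushforward muleA -EFinM mulVf ?mul1e//.
  by rewrite gt_eqF.
move=> _ [[x y]] _ <-; rewrite [nu _](_ : _ = (a%:E * mu ((fun z : R => (a * z + m)%R) @^-1` `]x, y]))%E)//.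
rewrite (_ : _ @^-1` _ = `](x - m) / a, (y - m) / a]%classic); last first.
  apply/seteqP; split => z /=; rewrite !in_itv/= ltr_pdivrMr// ler_pdivlMr//; lra.
rewrite !lebesgue_measure_itv/= !lte_fin ltr_pM2r ?invr_gt0// ltrD2r.
case: ifP => _; last by rewrite mule0.
by rewrite -!EFinD -EFinM; congr EFin; field; rewrite gt_eqF.
Qed.

Lemma ge0_integral_lebesgue_affine (a m : R) (a0 : 0 < a) (f : R -> \bar R) :
  (forall x, 0 <= f x)%E -> measurable_fun [set: R] f ->
  (\int[mu]_z f (a * z + m)%R = a^-1%:E * \int[mu]_u f u)%E.
Proof.
move=> f0 mf.
have maff : @measurable_fun _ _ (measurableTypeR R) (measurableTypeR R)
    setT (fun z : R => a * z + m).
  by apply: measurable_funD => //; apply: measurable_funM.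
have a0' : 0 <= a^-1 by rewrite invr_ge0 ltW.
have := @ge0_integral_pushforward _ _ (measurableTypeR R) (measurableTypeR R) R
  (fun z : R => a * z + m) maff mu setT f measurableT mf (fun y _ => f0 y).
rewrite preimage_setT => /= <-.
rewrite (_ : a^-1%:E = (NngNum a0')%:num%:E)//.
rewrite -(@ge0_integral_mscale _ (measurableTypeR R) R mu setT measurableT (NngNum a0') f mf)//.
apply: (@eq_measure_integral _ (measurableTypeR R) R setT
  (mscale (NngNum a0') mu)) => A mA _; exact: lebesgue_measure_affine.
Qed.

End lebesgue_affine.

Section gauss.
Context {R : realType}.
Local Notation mu := (@lebesgue_measure R).
Local Notation gamma := (normal_prob (0 : R) 1).
Local Open Scope ereal_scope.

Lemma ge0_integral_normal_prob (m s : R) (f : R -> \bar R) :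
  (forall x, 0 <= f x) -> measurable_fun [set: R] f ->
  \int[normal_prob m s]_x f x = \int[mu]_x (f x * (normal_pdf m s x)%:E).
Proof.
move=> f0 mf.
apply: (@ge0_integral_density _ (measurableTypeR R) R (normal_prob m s) mu) => //.
- by move=> x; exact: normal_pdf_ge0.
- exact: measurable_normal_pdf.
Qed.

Lemma normal_pdf_scale (m a u : R) : (0 < a)%R ->
  (a^-1 * normal_pdf 0 1 ((u - m) / a) = normal_pdf m a u)%R.
Proof.
move=> a0; rewrite !normal_pdfE ?gt_eqF//.
have -> : normal_peak a = (a^-1 * normal_peak 1)%R :> R.
  rewrite /normal_peak -invfM; congr (_^-1)%R.
  rewrite expr1n mul1r -mulrnAr sqrtrM ?sqr_ge0// sqrtr_sqr gtr0_norm//.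
rewrite mulrA; congr (_ * _)%R; rewrite /normal_fun; congr expR.
by rewrite expr1n; field; rewrite gt_eqF.
Qed.

Lemma ge0_integral_normal_affine (a m : R) (f : R -> \bar R) : (0 < a)%R ->
  (forall x, 0 <= f x) -> measurable_fun [set: R] f ->
  \int[gamma]_z f (a * z + m)%R = \int[mu]_u (f u * (normal_pdf m a u)%:E).
Proof.
move=> a0 f0 mf.
have maff : measurable_fun [set: R] (fun z : R => a * z + m)%R.
  by apply: measurable_funD => //; apply: measurable_funM.
have mfa : measurable_fun [set: R] (fun z => f (a * z + m)%R).
  exact: (measurableT_comp mf maff).
have fa0 z : 0 <= f (a * z + m)%R by [].
transitivity (\int[mu]_z (f (a * z + m)%R * (normal_pdf 0 1 z)%:E)).
  exact: (ge0_integral_normal_prob 0 1 fa0 mfa).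
pose g u := f u * (normal_pdf 0 1 ((u - m) / a))%:E.
have mpdf : measurable_fun [set: R] (fun u : R => normal_pdf 0 1 ((u - m) / a))%R.
  apply: (@measurableT_comp _ _ _ _ _ _ (normal_pdf 0 1)%R).
    exact: measurable_normal_pdf.
  by apply: measurable_funM => //; exact: measurable_funB.
have g0 u : 0 <= g u by rewrite mule_ge0// lee_fin normal_pdf_ge0.
have mg : measurable_fun [set: R] g.
  by apply: emeasurable_funM => //; exact/measurable_EFinP.
rewrite (_ : (fun x => _) = (fun z => g (a * z + m)%R)); last first.
  by apply/funext => z; rewrite /g addrK mulrAC divff ?mul1r// gt_eqF.
rewrite ge0_integral_lebesgue_affine// -ge0_integralZl_EFin//; last first.
  by rewrite invr_ge0 ltW.
apply: eq_integral => u _.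
by rewrite /g muleCA -EFinM normal_pdf_scale.
Qed.

Lemma normal_pdf_tilt (c u : R) :
  (normal_pdf c 1 u = expR (c * u - c ^+ 2 / 2) * normal_pdf 0 1 u)%R.
Proof.
rewrite !normal_pdfE ?oner_eq0// mulrCA; congr (_ * _)%R.
by rewrite /normal_fun -expRD; congr expR; field.
Qed.

(** Cameron-Martin in dimension one: a translation of the Gaussian is a change of density. *)
Lemma ge0_gauss_shift (c : R) (f : R -> \bar R) :
  (forall x, 0 <= f x) -> measurable_fun [set: R] f ->
  \int[gamma]_z f (z + c)%R = \int[gamma]_z (f z * (expR (c * z - c ^+ 2 / 2))%:E).
Proof.
move=> f0 mf.
rewrite [RHS]ge0_integral_normal_prob//; last 2 first.
- by move=> x; rewrite mule_ge0// lee_fin expR_ge0.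
- apply: emeasurable_funM => //; apply/measurable_EFinP.
  by apply: measurableT_comp => //; apply: measurable_funB => //; exact: measurable_funM.
have /= := @ge0_integral_normal_affine 1 c f ltr01 f0 mf.
under eq_integral do rewrite mul1r.
move=> ->; apply: eq_integral => u _.
by rewrite normal_pdf_tilt EFinM muleA.
Qed.

(** Completing the square: the joint density of z and u = a z' + b z is factored as the marginal of
    u times the conditional density of z given u, again Gaussian. *)
Lemma normal_pdf_conv (a b u z : R) : (0 < a)%R ->
  (normal_pdf (b * z) a u * normal_pdf 0 1 z =
   normal_pdf 0 (Num.sqrt (a ^+ 2 + b ^+ 2)) u *
   normal_pdf (u * b / (a ^+ 2 + b ^+ 2)) (a / Num.sqrt (a ^+ 2 + b ^+ 2)) z)%R.
Proof.
move=> a0; set q := (a ^+ 2 + b ^+ 2)%R.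
have q0 : (0 < q)%R by rewrite /q ltr_wpDr ?sqr_ge0// exprn_gt0.
have sq0 : (0 < Num.sqrt q)%R by rewrite sqrtr_gt0.
rewrite !normal_pdfE ?oner_eq0 ?gt_eqF ?divr_gt0//.
have pk s : (0 < s)%R -> normal_peak s = (s^-1 * normal_peak 1)%R :> R.
  move=> s0; rewrite /normal_peak -invfM; congr (_^-1)%R.
  rewrite expr1n mul1r -mulrnAr sqrtrM ?sqr_ge0// sqrtr_sqr gtr0_norm//.
rewrite (pk _ a0) (pk _ sq0) (pk (a / _)%R) ?divr_gt0//.
rewrite mulrACA [RHS]mulrACA; congr (_ * _)%R.
  by field; rewrite ?gt_eqF.
rewrite /normal_fun -!expRD; congr expR.
rewrite expr_div_n sqr_sqrtr ?ltW//.
have := q0; rewrite /q => /gt_eqF/negbT qn; field.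
by rewrite qn gt_eqF.
Qed.

(** Once the integrals are exchanged, the conditional density of z integrates to 1 and the marginal
    of the sum remains. *)
Lemma ge0_gauss_conv (a b : R) (f : R -> \bar R) : (0 < a)%R ->
  (forall x, 0 <= f x) -> measurable_fun [set: R] f ->
  \int[gamma]_z \int[gamma]_z' f (a * z' + b * z)%R =
  \int[gamma]_z f (Num.sqrt (a ^+ 2 + b ^+ 2) * z)%R.
Proof.
move=> a0 f0 mf; set q := (a ^+ 2 + b ^+ 2)%R.
have q0 : (0 < q)%R by rewrite /q ltr_wpDr ?sqr_ge0// exprn_gt0.
have sq0 : (0 < Num.sqrt q)%R by rewrite sqrtr_gt0.
under eq_integral do rewrite ge0_integral_normal_affine//.
have mpdf2 : measurable_fun [set: R * R] (fun p : R * R => normal_pdf (b * p.1) a p.2).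
  rewrite /normal_pdf gt_eqF//.
  apply: measurable_funM => //; apply: measurableT_comp => //.
  apply: measurable_funM => //; apply: measurableT_comp => //.
  apply: measurable_funX; apply: measurable_funB => //.
  by apply: measurable_funM.
have mF : measurable_fun [set: R * R] (fun p : R * R => f p.2 * (normal_pdf (b * p.1) a p.2)%:E).
  by apply: emeasurable_funM; [exact: measurableT_comp|exact/measurable_EFinP].
have F0 (p : R * R) : 0 <= f p.2 * (normal_pdf (b * p.1) a p.2)%:E.
  by rewrite mule_ge0// lee_fin normal_pdf_ge0.
have mFz := measurable_fun_fubini_tonelli_F (m2 := mu) _ mF F0.
have Fz0 z : 0 <= \int[mu]_u (f u * (normal_pdf (b * z) a u)%:E).
  by apply: integral_ge0 => u _; exact: (F0 (z, u)).
rewrite (ge0_integral_normal_prob 0 1 Fz0 mFz).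
pose F2 (p : R * R) := f p.2 * (normal_pdf (b * p.1) a p.2)%:E * (normal_pdf 0 1 p.1)%:E.
have F20 p : 0 <= F2 p by rewrite mule_ge0// lee_fin normal_pdf_ge0.
have mF2 : measurable_fun [set: R * R] F2.
  apply: emeasurable_funM => //; apply/measurable_EFinP.
  by apply: measurableT_comp => //; exact: measurable_normal_pdf.
transitivity (\int[mu]_z \int[mu]_u F2 (z, u)).
  apply: eq_integral => z _; rewrite /F2/= ge0_integralZr//.
  - exact: (measurableT_comp mF (measurable_pair1 z)).
  - by move=> u _; exact: (F0 (z, u)).
  - by rewrite lee_fin normal_pdf_ge0.
transitivity (\int[mu]_u \int[mu]_z F2 (z, u)).
  exact: (@fubini_tonelli _ _ (measurableTypeR R) (measurableTypeR R) R mu mu F2 mF2 F20).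
have -> : \int[gamma]_z f (Num.sqrt q * z)%R = \int[mu]_u (f u * (normal_pdf 0 (Num.sqrt q) u)%:E).
  rewrite -ge0_integral_normal_affine//.
  by apply: eq_integral => z _; rewrite addr0.
apply: eq_integral => u _.
rewrite /F2/=.
under eq_integral do rewrite -muleA -EFinM normal_pdf_conv// EFinM muleA.
rewrite ge0_integralZl//.
- by rewrite integral_normal_pdf mule1.
- by apply/measurable_EFinP; exact: measurable_normal_pdf.
- by move=> z _; rewrite lee_fin normal_pdf_ge0.
- by rewrite mule_ge0// lee_fin normal_pdf_ge0.
Qed.

End gauss.

Section std_normal.
Context {R : realType}.

Let idTR : measurableTypeR R -> R := idfun.

#[local] HB.instance Definition _ :=
  @isMeasurableFun.Build _ _ _ _ idTR (@measurable_id _ _ setT).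

(* [normal_prob] lives on [measurableTypeR R]; this copy lives on [R] itself. *)
Definition std_normal : probability R R :=
  distribution (normal_prob (0 : R) 1) (idTR : {mfun measurableTypeR R >-> R}).

Local Open Scope ereal_scope.

Lemma std_normalE A : std_normal A = normal_prob 0 1 A.
Proof. by []. Qed.

Lemma ge0_integral_std_normal (f : R -> \bar R) :
  (forall x, 0 <= f x) -> measurable_fun [set: R] f ->
  \int[std_normal]_x f x = \int[normal_prob 0 1]_x f x.
Proof. by move=> f0 mf; rewrite ge0_integral_distribution. Qed.

Lemma ge0_std_normal_shift (c : R) (f : R -> \bar R) :
  (forall x, 0 <= f x) -> measurable_fun [set: R] f ->
  \int[std_normal]_z f (z + c)%R =
  \int[std_normal]_z (f z * (expR (c * z - c ^+ 2 / 2))%:E).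
Proof.
move=> f0 mf; rewrite !ge0_integral_std_normal//; first exact: ge0_gauss_shift.
- by move=> x; rewrite mule_ge0// lee_fin expR_ge0.
- apply: emeasurable_funM => //; apply/measurable_EFinP.
  by apply: measurableT_comp => //; apply: measurable_funB => //; exact: measurable_funM.
- by apply: measurableT_comp => //; exact: measurable_funD.
Qed.

Lemma ge0_std_normal_conv (a b : R) (f : R -> \bar R) : (0 < a)%R ->
  (forall x, 0 <= f x) -> measurable_fun [set: R] f ->
  \int[std_normal]_z \int[std_normal]_z' f (a * z' + b * z)%R =
  \int[std_normal]_z f (Num.sqrt (a ^+ 2 + b ^+ 2) * z)%R.
Proof.
move=> a0 f0 mf.
pose F (p : R * R) := f (a * p.2 + b * p.1)%R.
have mF : measurable_fun [set: R * R] F.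
  apply: measurableT_comp => //.
  by apply: measurable_funD; apply: measurable_funM.
have mF1 : measurable_fun [set: R] (fun z => \int[std_normal]_z' f (a * z' + b * z)%R).
  exact: (measurable_fun_fubini_tonelli_F (m2 := std_normal) F mF (fun p => f0 _)).
have F10 z : 0 <= \int[std_normal]_z' f (a * z' + b * z)%R by exact: integral_ge0.
rewrite (ge0_integral_std_normal F10 mF1).
have mc : measurable_fun [set: R] (fun z => f (Num.sqrt (a ^+ 2 + b ^+ 2) * z)%R).
  by apply: (measurableT_comp mf); exact: measurable_funM.
rewrite [RHS](ge0_integral_std_normal _ mc)//.
rewrite -ge0_gauss_conv//; apply: eq_integral => z _.
rewrite ge0_integral_std_normal//.
by apply: (measurableT_comp mf); apply: measurable_funD => //; exact: measurable_funM.
Qed.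

End std_normal.

Section gauss_expectation.
Context {R : realType}.
Local Notation gamma := (@std_normal R).
Implicit Types (f g : R -> R) (c z : R).

Definition gE f : R := \int[gamma]_z f z.

(** At most exponential growth is stable under shifts, scalings and exponential tilts and implies
    Gaussian integrability, so that the real-valued integral [gE] obeys the usual rules. *)
Definition tame f := measurable_fun [set: R] f /\
  exists A B : R, forall z, `|f z| <= A * expR (B * `|z|).

Let gamma1 : gamma [set: R] = 1%E.
Proof. exact: probability_setT. Qed.

Lemma ge0_gauss_mgf c : (\int[gamma]_z (expR (c * z))%:E = (expR (c ^+ 2 / 2))%:E)%E.
Proof.
have := @ge0_std_normal_shift R c (cst 1%E) (fun=> lee01) (measurable_cst _).
rewrite integral_cst// [X in (_ * X)%E]gamma1 mule1.
have -> : (fun z => (cst 1 z * (expR (c * z - c ^+ 2 / 2))%:E)%E) =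
    (fun z => ((expR (- (c ^+ 2 / 2)))%:E * (expR (c * z))%:E)%E).
  by apply/funext => z; rewrite mul1e -EFinM -expRD addrC.
have mc : measurable_fun [set: R] (fun z : R => (expR (c * z))%:E).
  by apply/measurable_EFinP; apply: measurableT_comp => //; exact: measurable_funM.
rewrite ge0_integralZl_EFin ?expR_ge0//.
move=> /(congr1 (fun x => (expR (c ^+ 2 / 2))%:E * x)%E).
by move=> H; rewrite mule1 muleA -EFinM -expRD subrr expR0 mul1e in H; exact: esym H.
Qed.

Lemma tame_integrable f : tame f -> gamma.-integrable [set: R] (EFin \o f).
Proof.
move=> [mf [A [B fAB]]].
have mexp c : measurable_fun [set: R] (fun z : R => (expR (c * z))%:E).
  by apply/measurable_EFinP; apply: measurableT_comp => //; exact: measurable_funM.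
have iexp c : gamma.-integrable [set: R] (fun z : R => (expR (c * z))%:E).
  apply/integrableP; split => //.
  have e0 : (fun z : R => `|(expR (c * z))%:E|%E) = (fun z : R => (expR (c * z))%:E).
    by apply/funext => z; rewrite gee0_abs// lee_fin expR_ge0.
  by rewrite e0 ge0_gauss_mgf ltry.
have : gamma.-integrable [set: R]
    (fun z => ((`|A|)%:E * (expR (B * z))%:E + (`|A|)%:E * (expR ((- B) * z))%:E)%E).
  by apply: integrableD => //; apply: integrableZl.
apply: le_integrable => //; first exact/measurable_EFinP.
move=> z _ /=; rewrite lee_fin.
rewrite -mulrDr [leRHS]ger0_norm ?mulr_ge0 ?addr_ge0 ?expR_ge0//.
rewrite (le_trans (fAB z))// (le_trans (ler_norm _))// normrM.
rewrite ler_wpM2l// ger0_norm ?expR_ge0//.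
have [z0|z0] := leP 0 z.
  by rewrite ger0_norm// lerDl expR_ge0.
by rewrite ltr0_norm// mulrN mulNr lerDr expR_ge0.
Qed.

Lemma gE_EFin f : tame f -> ((gE f)%:E = \int[gamma]_z (f z)%:E)%E.
Proof.
move=> tf; rewrite /gE /Rintegral fineK//.
exact: (integrable_fin_num measurableT (tame_integrable tf)).
Qed.

Lemma gED f g : tame f -> tame g -> gE (fun z => f z + g z) = gE f + gE g.
Proof. by move=> tf tg; apply: RintegralD => //; exact: tame_integrable. Qed.

Lemma gEZ c f : tame f -> gE (fun z => c * f z) = c * gE f.
Proof. by move=> tf; apply: RintegralZl => //; exact: tame_integrable. Qed.

Lemma gE_cst c : gE (fun=> c) = c.
Proof. by rewrite /gE Rintegral_cst//= [X in fine X]gamma1 mulr1. Qed.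

Lemma gE_le f g : tame f -> tame g -> (forall z, f z <= g z) -> gE f <= gE g.
Proof. by move=> tf tg fg; apply: le_Rintegral => //; exact: tame_integrable. Qed.

Lemma gE_ge0 f : (forall z, 0 <= f z) -> 0 <= gE f.
Proof. by move=> f0; apply: Rintegral_ge0 => z _. Qed.

Lemma gE_norm f : tame f -> `|gE f| <= gE (fun z => `|f z|).
Proof. by move=> tf; apply: le_normr_Rintegral => //; exact: tame_integrable. Qed.

Lemma tame_norm f : tame f -> tame (fun z => `|f z|).
Proof.
move=> [mf [A [B fAB]]]; split; first exact: measurableT_comp.
by exists A, B => z; rewrite normr_id.
Qed.

Lemma tame_expR c d : tame (fun z => expR (c * z + d)).
Proof.
split.
  by apply: measurableT_comp => //; apply: measurable_funD => //; exact: measurable_funM.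
exists (expR d), `|c| => z; rewrite ger0_norm ?expR_ge0// -expRD ler_expR addrC.
by rewrite lerD2l -normrM ler_norm.
Qed.

Lemma gE_expR c : gE (fun z => expR (c * z)) = expR (c ^+ 2 / 2).
Proof.
have := tame_expR c 0; under eq_fun do rewrite addr0; move=> t.
by apply/EFin_inj; rewrite gE_EFin// ge0_gauss_mgf.
Qed.

Lemma tame_bound f : tame f -> exists A B, [/\ 0 <= A, 0 <= B &
  forall z, `|f z| <= A * expR (B * `|z|)].
Proof.
move=> [mf [A [B fAB]]]; exists `|A|, `|B|; split => // z.
rewrite (le_trans (fAB z))// (le_trans (ler_norm _))// normrM ler_wpM2l//.
by rewrite ger0_norm ?expR_ge0// ler_expR ler_wpM2r// ler_norm.
Qed.

Lemma tame_shift f c : tame f -> tame (fun z => f (z + c)).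
Proof.
move=> tf; have [A [B [A0 B0 fAB]]] := tame_bound tf; move: tf => [mf _]; split.
  by apply: (measurableT_comp mf); exact: measurable_funD.
exists (A * expR (B * `|c|)), B => z.
rewrite (le_trans (fAB _))// -mulrA -expRD -mulrDr ler_wpM2l// ler_expR ler_wpM2l//.
by rewrite addrC ler_normD.
Qed.

Lemma tame_scale f c : tame f -> tame (fun z => f (c * z)).
Proof.
move=> [mf [A [B fAB]]]; split.
  by apply: (measurableT_comp mf); exact: measurable_funM.
exists A, (B * `|c|) => z.
by rewrite (le_trans (fAB _))// normrM mulrA.
Qed.

Lemma tame_tilt f c d : tame f -> tame (fun z => f z * expR (c * z + d)).
Proof.
move=> [mf [A [B fAB]]]; have [me [A' [B' eAB]]] := tame_expR c d; split.
  exact: measurable_funM.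
exists (A * A'), (B + B') => z.
by rewrite normrM mulrDl [in leRHS]expRD mulrACA ler_pM.
Qed.

(** Identities proved by Tonelli for nonnegative integrands pass to signed ones through this
    splitting. *)
Lemma gE_posneg f : tame f ->
  gE f = gE (fun z => Num.max (f z) 0) - gE (fun z => Num.max (- f z) 0).
Proof.
move=> tf.
have mx g : tame g -> tame (fun z => Num.max (g z) 0).
  move=> [mg [A [B gAB]]]; split; first exact: measurable_maxr.
  exists A, B => z; rewrite (le_trans _ (gAB z))//.
  by case: (leP (g z) 0) => // g0; rewrite normr0.
have tN : tame (fun z => - f z).
  move: tf => [mf [A [B fAB]]]; split; first exact: measurable_funN.
  by exists A, B => z; rewrite normrN.
rewrite -mulN1r -gEZ; last exact: (mx (fun z => - f z)).
rewrite -gED; [|exact: mx|].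
  congr gE; apply/funext => z; rewrite mulN1r.
  case: (leP (f z) 0) => [f0|f0].
    by rewrite (max_idPl _) ?oppr_ge0// opprK add0r.
  by rewrite (max_idPr _) ?oppr_le0 ?ltW// subr0.
move: (mx _ tN) => [mg [A [B gAB]]]; split; first exact: measurable_funM.
by exists A, B => z; rewrite mulN1r normrN.
Qed.

Lemma gE_shift f c : tame f ->
  gE (fun z => f (z + c)) = gE (fun z => f z * expR (c * z - c ^+ 2 / 2)).
Proof.
have H g : tame g -> (forall z, 0 <= g z) ->
    gE (fun z => g (z + c)) = gE (fun z => g z * expR (c * z - c ^+ 2 / 2)).
  move=> tg g0; apply/EFin_inj; rewrite !gE_EFin; last 2 first.
  - exact: tame_tilt.
  - exact: tame_shift.
  have g0' z : (0 <= (g z)%:E)%E by rewrite lee_fin.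
  have mg : measurable_fun [set: R] (EFin \o g) by case: tg => mg _; exact/measurable_EFinP.
  exact: (ge0_std_normal_shift c g0' mg).
move=> tf; rewrite (gE_posneg (tame_shift c tf)) (gE_posneg (tame_tilt _ _ tf)).
have mx g : tame g -> tame (fun z => Num.max (g z) 0).
  move=> [mg [A [B gAB]]]; split; first exact: measurable_maxr.
  exists A, B => z; rewrite (le_trans _ (gAB z))//.
  by case: (leP (g z) 0) => // g0; rewrite normr0.
have tN : tame (fun z => - f z).
  move: tf => [mf [A [B fAB]]]; split; first exact: measurable_funN.
  by exists A, B => z; rewrite normrN.
rewrite (H _ (mx _ tf)); last by move=> z; rewrite le_max lexx orbT.
rewrite (H _ (mx _ tN)); last by move=> z; rewrite le_max lexx orbT.
by congr (gE _ - gE _); apply/funext => z; rewrite maxr_pMl ?expR_ge0// mul0r// mulNr.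
Qed.

End gauss_expectation.

(** * Gaussian averages over functions on a finite set *)

Section gauss_operator.
Context {R : realType} {S : finType}.
Implicit Types (v a b : S -> R) (Psi : (S -> R) -> R).

(* Measurability is required after every substitution of measurable functions
   because [S -> R] carries no measurable structure. *)
Definition good Psi :=
  (forall d (T : measurableType d) (V : T -> S -> R),
    (forall x, measurable_fun [set: T] (V ^~ x)) ->
    measurable_fun [set: T] (fun t => Psi (V t))) /\
  exists A B : R, [/\ 0 <= A, 0 <= B &
    forall v, `|Psi v| <= A * expR (B * \sum_x `|v x|)].

(** The heat operator in the direction [a]: the field [v] receives the increment z a with z standard
    Gaussian. *)
Definition G a Psi v := gE (fun z => Psi (fun x => v x + z * a x)).

Lemma good_tame Psi v a : good Psi -> tame (fun z => Psi (fun x => v x + z * a x)).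
Proof.
move=> [mP [A [B [A0 B0 PAB]]]]; split.
  by apply: mP => x; apply: measurable_funD => //; exact: measurable_funM.
exists (A * expR (B * \sum_x `|v x|)), (B * \sum_x `|a x|) => z.
rewrite (le_trans (PAB _))// -mulrA -expRD ler_wpM2l// ler_expR.
rewrite -mulrA -mulrDr ler_wpM2l// mulr_suml -big_split/= ler_sum// => x _.
by rewrite mulrC -normrM ler_normD.
Qed.

(** Measurability comes from Tonelli applied to the positive and negative parts. The growth rate [B]
    survives; the prefactor absorbs a Gaussian exponential moment. *)
Lemma good_G a Psi : good Psi -> good (G a Psi).
Proof.
move=> gP; have [mP [A [B [A0 B0 PAB]]]] := gP; split.
  move=> d T V mV.
  pose F (p : T * R) := Psi (fun x => V p.1 x + p.2 * a x).
  have mF : measurable_fun [set: T * R] F.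
    apply: (mP _ (T * R)%type (fun (p : T * R) x => V p.1 x + p.2 * a x)) => x.
    apply: measurable_funD; last exact: measurable_funM.
    exact: (measurableT_comp (mV x)).
  have -> : (fun t => G a Psi (V t)) =
      (fun t => fine (\int[std_normal]_z (EFin \o F)^\+ (t, z))
         - fine (\int[std_normal]_z (EFin \o F)^\- (t, z))).
    apply/funext => t.
    have tf := tame_integrable (good_tame (V t) a gP).
    rewrite /G /gE /Rintegral integralE.
    have fp := integrable_fin_num measurableT (integrable_funepos measurableT tf).
    have fn := integrable_fin_num measurableT (integrable_funeneg measurableT tf).
    rewrite fineB; [|exact: fp|exact: fn].
    by congr (fine _ - fine _); apply: eq_integral => z _; rewrite ?(funeposE, funenegE).
  have mE : measurable_fun [set: T * R] (EFin \o F) by exact/measurable_EFinP.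
  have mp := measurable_fun_fubini_tonelli_F (m2 := std_normal) ((EFin \o F)^\+)%E
    (measurable_funepos mE) (fun p => funepos_ge0 _ p).
  have mn := measurable_fun_fubini_tonelli_F (m2 := std_normal) ((EFin \o F)^\-)%E
    (measurable_funeneg mE) (fun p => funeneg_ge0 _ p).
  by apply: measurable_funB; apply: (measurableT_comp (@fine_measurable R setT measurableT)).
have te c : tame (fun z : R => expR (c * `|z|)).
  split; last by exists 1, c => z; rewrite mul1r ger0_norm ?expR_ge0.
  by apply: measurableT_comp => //; apply: measurable_funM => //; exact: measurableT_comp.
exists (A * gE (fun z => expR ((B * \sum_x `|a x|) * `|z|))), B; split => //.
  by rewrite mulr_ge0// gE_ge0// => z; rewrite expR_ge0.
move=> v; have tv := good_tame v a gP.
rewrite (le_trans (gE_norm tv))// mulrAC -gEZ//.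
apply: gE_le.
- exact: tame_norm.
- split; first by apply: measurable_funM => //; case: (te (B * \sum_x `|a x|)).
  exists (A * expR (B * \sum_x `|v x|)), (B * \sum_x `|a x|) => z.
  by rewrite ger0_norm// mulr_ge0// ?mulr_ge0// ?expR_ge0.
- move=> z /=; rewrite (le_trans (PAB _))//; rewrite -[leRHS]mulrA -expRD ler_wpM2l// ler_expR.
  rewrite -mulrA -mulrDr ler_wpM2l// mulr_suml -big_split/= ler_sum// => x _.
  by rewrite mulrC -normrM ler_normD.
Qed.

Lemma good_cst c : good (fun=> c).
Proof.
split => [d T V mV|]; first exact: measurable_cst.
by exists `|c|, 0; split => // v; rewrite mul0r expR0 mulr1.
Qed.

Lemma goodD Psi1 Psi2 : good Psi1 -> good Psi2 -> good (fun v => Psi1 v + Psi2 v).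
Proof.
move=> [m1 [A1 [B1 [A10 B10 P1]]]] [m2 [A2 [B2 [A20 B20 P2]]]]; split.
  by move=> d T V mV; apply: measurable_funD; [exact: m1|exact: m2].
exists (A1 + A2), (B1 + B2); split; rewrite ?addr_ge0// => v.
rewrite (le_trans (ler_normD _ _))// mulrDl lerD//.
  rewrite (le_trans (P1 _))// ler_wpM2l// ler_expR ler_wpM2r ?lerDl// sumr_ge0//.
rewrite (le_trans (P2 _))// ler_wpM2l// ler_expR ler_wpM2r ?lerDr// sumr_ge0//.
Qed.

Lemma goodM Psi1 Psi2 : good Psi1 -> good Psi2 -> good (fun v => Psi1 v * Psi2 v).
Proof.
move=> [m1 [A1 [B1 [A10 B10 P1]]]] [m2 [A2 [B2 [A20 B20 P2]]]]; split.
  by move=> d T V mV; apply: measurable_funM; [exact: m1|exact: m2].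
exists (A1 * A2), (B1 + B2); split; rewrite ?addr_ge0 ?mulr_ge0// => v.
by rewrite normrM mulrDl expRD mulrACA ler_pM.
Qed.

Lemma goodZ c Psi : good Psi -> good (fun v => c * Psi v).
Proof. by move=> gP; apply: goodM => //; exact: good_cst. Qed.

Lemma goodN Psi : good Psi -> good (fun v => - Psi v).
Proof.
by move=> gP; rewrite (_ : (fun v => _) = (fun v => -1 * Psi v));
  [exact: goodZ|apply/funext => v; rewrite mulN1r].
Qed.

Lemma goodB Psi1 Psi2 : good Psi1 -> good Psi2 -> good (fun v => Psi1 v - Psi2 v).
Proof. by move=> g1 g2; apply: goodD => //; exact: goodN. Qed.

Lemma good_sum (I : Type) (r : seq I) (P : pred I) (F : I -> (S -> R) -> R) :
  (forall i, good (F i)) -> good (fun v => \sum_(i <- r | P i) F i v).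
Proof.
move=> gF; elim: r => [|i r IH].
  by rewrite (_ : (fun v => _) = fun=> 0); [exact: good_cst|apply/funext => v; rewrite big_nil].
case Pi : (P i); last first.
  by rewrite (_ : (fun v => _) = fun v => \sum_(i <- r | P i) F i v)//;
    apply/funext => v; rewrite big_cons Pi.
rewrite (_ : (fun v => _) = fun v => F i v + \sum_(i <- r | P i) F i v).
  exact: goodD.
by apply/funext => v; rewrite big_cons Pi.
Qed.

Lemma goodX Psi n : good Psi -> good (fun v => Psi v ^+ n).
Proof.
move=> gP; elim: n => [|n IH]; first exact: good_cst.
by rewrite (_ : (fun v => _) = (fun v => Psi v * Psi v ^+ n));
  [exact: goodM|apply/funext => v; rewrite exprS].
Qed.

Lemma good_expR x : good (fun v => expR (v x)).
Proof.
split => [d T V mV|]; first exact: measurableT_comp (mV x).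
exists 1, 1; split => // v; rewrite !mul1r ger0_norm ?expR_ge0// ler_expR.
by rewrite (le_trans (ler_norm _))// (bigD1 x)//= lerDl sumr_ge0.
Qed.

Lemma good_translate Psi b : good Psi -> good (fun v => Psi (fun x => v x + b x)).
Proof.
move=> [mP [A [B [A0 B0 PAB]]]]; split.
  by move=> d T V mV; apply: (mP _ _ (fun t x => V t x + b x)) => x; exact: measurable_funD.
exists (A * expR (B * \sum_x `|b x|)), B; split => //.
  by rewrite mulr_ge0 ?expR_ge0.
move=> v; rewrite (le_trans (PAB _))// -mulrA -expRD ler_wpM2l// ler_expR.
rewrite -mulrDr ler_wpM2l// -big_split/= ler_sum// => x _.
by rewrite addrC ler_normD.
Qed.

Lemma G_cst a c : G a (fun=> c) = fun=> c.
Proof. by apply/funext => v; rewrite /G gE_cst. Qed.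

Lemma GD a Psi1 Psi2 v : good Psi1 -> good Psi2 ->
  G a (fun v => Psi1 v + Psi2 v) v = G a Psi1 v + G a Psi2 v.
Proof. by move=> g1 g2; apply: gED; exact: good_tame. Qed.

Lemma GZ a c Psi v : good Psi -> G a (fun v => c * Psi v) v = c * G a Psi v.
Proof. by move=> g1; apply: gEZ; exact: good_tame. Qed.

Lemma G_le a Psi1 Psi2 v : good Psi1 -> good Psi2 -> (forall v, Psi1 v <= Psi2 v) ->
  G a Psi1 v <= G a Psi2 v.
Proof. by move=> g1 g2 le12; apply: gE_le; [exact: good_tame..|]. Qed.

Lemma G_translate a b Psi v :
  G a (fun v => Psi (fun x => v x + b x)) v = G a Psi (fun x => v x + b x).
Proof.
by rewrite /G; congr gE; apply/funext => z; congr Psi; apply/funext => x; rewrite addrAC.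
Qed.

(** The weight exp(v x0) is absorbed by a shift of the Gaussian variable, which moves the whole
    field by its covariance with the coordinate [x0]. *)
Lemma G_tilt a Psi x0 v : good Psi ->
  G a (fun v => expR (v x0) * Psi v) v =
  expR (v x0 + a x0 ^+ 2 / 2) * G a Psi (fun x => v x + a x0 * a x).
Proof.
move=> gP; have tP := good_tame v a gP.
rewrite {2}/G.
have -> : (fun z => Psi (fun x => v x + a x0 * a x + z * a x)) =
    (fun z => (fun z => Psi (fun x => v x + z * a x)) (z + a x0)).
  apply/funext => z /=; congr Psi; apply/funext => x.
  by rewrite mulrDl addrA addrAC.
rewrite (gE_shift (a x0) tP) -gEZ; last exact: tame_tilt.
rewrite /G; congr gE; apply/funext => z.
rewrite mulrCA -expRD mulrC; congr (_ * expR _); by field.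
Qed.

End gauss_operator.

Section gauss_operator_commute.
Context {R : realType} {S : finType}.
Implicit Types (v a b : S -> R) (Psi : (S -> R) -> R).

Lemma G_EFin a Psi v : good Psi ->
  ((G a Psi v)%:E = \int[std_normal]_z (Psi (fun x => v x + z * a x)%R)%:E)%E.
Proof. by move=> gP; rewrite gE_EFin//; exact: (good_tame v a gP). Qed.

Lemma G_comm a b Psi v : good Psi -> G a (G b Psi) v = G b (G a Psi) v.
Proof.
move=> gP.
pose F (p : R * R) := Psi (fun x => v x + p.1 * a x + p.2 * b x).
have mF : measurable_fun [set: R * R] (EFin \o F).
  apply/measurable_EFinP; case: gP => mP _.
  apply: (mP _ (R * R)%type (fun (p : R * R) x => v x + p.1 * a x + p.2 * b x)) => x.
  by apply: measurable_funD; [apply: measurable_funD => //|]; exact: measurable_funM.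
have gN : good (fun v => `|Psi v|).
  case: gP => mP [A [B [A0 B0 PAB]]]; split.
    by move=> ? ? ? ?; apply: measurableT_comp => //; exact: mP.
  by exists A, B; split => // w; rewrite normr_id.
have iF : (std_normal \x std_normal)%E.-integrable [set: R * R] (EFin \o F).
  apply/integrable12ltyP => //=.
  rewrite (_ : (fun x => _) = (fun z => (G b (fun v => `|Psi v|) (fun x => v x + z * a x))%:E)).
    by rewrite -G_EFin ?ltry//; exact: good_G.
  by apply/funext => z; rewrite G_EFin.
apply/EFin_inj; rewrite (G_EFin _ _ (good_G b gP)) (G_EFin _ _ (good_G a gP)).
transitivity (\int[std_normal]_z \int[std_normal]_z' (EFin \o F) (z, z'))%E.
  by apply: eq_integral => z _; rewrite G_EFin.
rewrite (Fubini iF); apply: eq_integral => z' _.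
rewrite G_EFin//; apply: eq_integral => z _; congr (Psi _)%:E; apply/funext => x /=.
by rewrite addrAC.
Qed.

(** Variances of independent increments along one direction add up. The convolution identity is
    available for nonnegative functions and extends by positive parts. *)
Lemma G_semigroup a s t Psi v : 0 < s -> good Psi ->
  G (fun x => t * a x) (G (fun x => s * a x) Psi) v =
  G (fun x => Num.sqrt (s ^+ 2 + t ^+ 2) * a x) Psi v.
Proof.
move=> s0.
have H Phi : good Phi -> (forall v, 0 <= Phi v) ->
    G (fun x => t * a x) (G (fun x => s * a x) Phi) v =
    G (fun x => Num.sqrt (s ^+ 2 + t ^+ 2) * a x) Phi v.
  move=> gP P0; apply/EFin_inj.
  rewrite !G_EFin//; last exact: good_G.
  pose f z := (Phi (fun x => v x + z * a x))%:E.
  have f0 z : (0 <= f z)%E by rewrite lee_fin.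
  have mf : measurable_fun [set: R] f.
    by apply/measurable_EFinP; case: (good_tame v a gP).
  transitivity (\int[std_normal]_z f (Num.sqrt (s ^+ 2 + t ^+ 2) * z)%R)%E; last first.
    apply: eq_integral => z _; congr (Phi _)%:E; apply/funext => x.
    by rewrite mulrCA mulrA.
  rewrite -ge0_std_normal_conv//; apply: eq_integral => z _.
  rewrite G_EFin//; apply: eq_integral => z' _; congr (Phi _)%:E; apply/funext => x.
  by rewrite -addrA; congr (_ + _); ring.
move=> gP.
have gx Phi : good Phi -> good (fun v => Num.max (Phi v) 0).
  move=> [mP [A [B [A0 B0 PAB]]]]; split.
    by move=> d T V mV; apply: measurable_maxr => //; exact: mP.
  exists A, B; split => // w; rewrite (le_trans _ (PAB w))//.
  by case: (leP (Phi w) 0) => // ?; rewrite normr0.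
have E b Phi w : good Phi -> G b Phi w =
    G b (fun v => Num.max (Phi v) 0) w - G b (fun v => Num.max (- Phi v) 0) w.
  by move=> gPhi; rewrite /G (gE_posneg (good_tame w b gPhi)).
have g1 := gx _ gP; have g2 := gx _ (goodN gP).
have ge0 Phi (w : S -> R) : 0 <= Num.max (Phi w) (0 : R) by rewrite le_max lexx orbT.
rewrite [RHS]E// -(H _ g1 (ge0 Psi)) -(H _ g2 (ge0 (fun v => - Psi v))).
rewrite (_ : G (fun x => s * a x) Psi = fun w =>
  G (fun x => s * a x) (fun v => Num.max (Psi v) 0) w +
  (-1) * G (fun x => s * a x) (fun v => Num.max (- Psi v) 0) w).
  rewrite GD; [|exact: good_G|by apply: goodZ; exact: good_G].
  by rewrite GZ ?mulN1r//; exact: good_G.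
by apply/funext => w; rewrite mulN1r; exact: E.
Qed.

End gauss_operator_commute.

Section gauss_list.
Context {R : realType} {S : finType}.
Implicit Types (v a b : S -> R) (Psi : (S -> R) -> R) (l : seq (S -> R)).

(** A centred Gaussian field on [S] is encoded by the list of directions of its independent
    components: concatenation adds independent fields, and [cov] is the covariance. *)
Definition GG l Psi := foldr G Psi l.

Definition cov l x y : R := \sum_(a <- l) a x * a y.

Definition scale (s : R) l := [seq (fun x => s * a x) | a : S -> R <- l].

Definition nrm l v : S -> R := fun x => v x - cov l x x / 2.

Lemma cov_cat l l' x y : cov (l ++ l') x y = cov l x y + cov l' x y.
Proof. exact: big_cat. Qed.

Lemma cov_scale s l x y : cov (scale s l) x y = s ^+ 2 * cov l x y.
Proof.
rewrite /cov /scale big_map mulr_sumr; apply: eq_bigr => a _.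
by rewrite expr2; ring.
Qed.

Lemma cov_ge0 l x : 0 <= cov l x x.
Proof. by apply: sumr_ge0 => a _; rewrite -expr2 sqr_ge0. Qed.

Lemma GG_cat l l' Psi : GG (l ++ l') Psi = GG l (GG l' Psi).
Proof. by rewrite /GG foldr_cat. Qed.

Lemma good_GG l Psi : good Psi -> good (GG l Psi).
Proof. by move=> gP; elim: l => //= a l IH; exact: good_G. Qed.

Lemma GG_cst l c : GG l (fun=> c) = fun=> c.
Proof. by elim: l => //= a l ->; rewrite G_cst. Qed.

Lemma GGD l Psi1 Psi2 v : good Psi1 -> good Psi2 ->
  GG l (fun v => Psi1 v + Psi2 v) v = GG l Psi1 v + GG l Psi2 v.
Proof.
move=> g1 g2; elim: l v => //= a l IH v.
rewrite -GD; [|exact: good_GG..].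
by congr G; apply/funext.
Qed.

Lemma GGZ l c Psi v : good Psi -> GG l (fun v => c * Psi v) v = c * GG l Psi v.
Proof.
move=> g1; elim: l v => //= a l IH v.
rewrite -GZ; last exact: good_GG.
by congr G; apply/funext.
Qed.

Lemma GGN l Psi v : good Psi -> GG l (fun v => - Psi v) v = - GG l Psi v.
Proof.
move=> gP; rewrite -mulN1r -GGZ//; congr GG; apply/funext => w.
by rewrite mulN1r.
Qed.

Lemma GGB l Psi1 Psi2 v : good Psi1 -> good Psi2 ->
  GG l (fun v => Psi1 v - Psi2 v) v = GG l Psi1 v - GG l Psi2 v.
Proof. by move=> g1 g2; rewrite GGD ?GGN//; exact: goodN. Qed.

Lemma GG_sum l (I : Type) (r : seq I) (F : I -> (S -> R) -> R) v :
  (forall i, good (F i)) ->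
  GG l (fun v => \sum_(i <- r) F i v) v = \sum_(i <- r) GG l (F i) v.
Proof.
move=> gF; elim: r => [|i r IH].
  rewrite big_nil (_ : (fun v => _) = fun=> 0) ?GG_cst//.
  by apply/funext => w; rewrite big_nil.
rewrite big_cons -IH -GGD//; last exact: good_sum.
by congr GG; apply/funext => w; rewrite big_cons.
Qed.

Lemma GG_le l Psi1 Psi2 v : good Psi1 -> good Psi2 ->
  (forall v, Psi1 v <= Psi2 v) -> GG l Psi1 v <= GG l Psi2 v.
Proof.
by move=> g1 g2 le12; elim: l v => //= a l IH v; apply: G_le => //; exact: good_GG.
Qed.

Lemma GG_translate l b Psi v :
  GG l (fun v => Psi (fun x => v x + b x)) v = GG l Psi (fun x => v x + b x).
Proof.
elim: l v => //= a l IH v; rewrite -G_translate.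
by congr G; apply/funext.
Qed.

Lemma GG_tilt l Psi x0 v : good Psi ->
  GG l (fun v => expR (v x0) * Psi v) v =
  expR (v x0 + cov l x0 x0 / 2) * GG l Psi (fun x => v x + cov l x0 x).
Proof.
move=> gP; elim: l v => [|a l IH] v.
  rewrite /= /cov !big_nil mul0r addr0; congr (_ * Psi _).
  by apply/funext => x; rewrite big_nil addr0.
rewrite /= (_ : GG l _ = (fun v => expR (cov l x0 x0 / 2) *
    (expR (v x0) * GG l Psi (fun x => v x + cov l x0 x)))); last first.
  by apply/funext => w; rewrite IH expRD mulrCA mulrA.
rewrite GZ; last first.
  by apply: goodM; [exact: good_expR|apply: good_translate; exact: good_GG].
rewrite G_tilt; last by apply: good_translate; exact: good_GG.
rewrite G_translate mulrA -expRD; congr (expR _ * _).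
  by rewrite /cov big_cons expr2; field.
congr G; apply/funext => x; rewrite /cov big_cons.
by rewrite -addrA.
Qed.

Lemma G_GG_comm a l Psi v : good Psi -> G a (GG l Psi) v = GG l (G a Psi) v.
Proof.
move=> gP; elim: l v => //= b l IH v.
rewrite G_comm; last exact: good_GG.
by congr G; apply/funext.
Qed.

Lemma GG_comm l l' Psi v : good Psi -> GG l (GG l' Psi) v = GG l' (GG l Psi) v.
Proof.
move=> gP; elim: l v => //= a l IH v.
rewrite -G_GG_comm; last exact: good_GG.
by congr G; apply/funext.
Qed.

Lemma GG_semigroup l s t Psi v : 0 < s -> good Psi ->
  GG (scale t l) (GG (scale s l) Psi) v =
  GG (scale (Num.sqrt (s ^+ 2 + t ^+ 2)) l) Psi v.
Proof.
move=> s0 gP; elim: l v => //= a l IH v.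
rewrite -G_semigroup//; last exact: good_GG.
congr G; apply/funext => w.
rewrite -G_GG_comm; last exact: good_GG.
by congr G; apply/funext.
Qed.

End gauss_list.

Section gauss_affine.
Context {R : realType} {S I : finType}.

Definition linmap (M : I -> S -> R) (z : I -> R) : S -> R :=
  fun x => \sum_i z i * M i x.

Lemma good_linmap (M : I -> S -> R) (v : S -> R) Psi : good Psi ->
  good (fun z => Psi (fun x => v x + linmap M z x)).
Proof.
move=> [mP [A [B [A0 B0 PAB]]]]; split.
  move=> d T V mV; apply: (mP _ _ (fun t x => v x + linmap M (V t) x)) => x.
  apply: measurable_funD => //; apply: measurable_sum => i.
  by apply: measurable_funM.
exists (A * expR (B * \sum_x `|v x|)), (B * \sum_x \sum_i `|M i x|).
split; rewrite ?mulr_ge0 ?expR_ge0// ?sumr_ge0//.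
  by move=> x _; rewrite sumr_ge0.
move=> z; rewrite (le_trans (PAB _))//; rewrite -[leRHS]mulrA -expRD ler_wpM2l//.
rewrite ler_expR -mulrA -mulrDr ler_wpM2l// mulr_suml -big_split/=.
apply: ler_sum => x _; rewrite (le_trans (ler_normD _ _))// lerD2l.
rewrite (le_trans (ler_norm_sum _ _ _))// mulr_suml; apply: ler_sum => i _.
rewrite normrM mulrC ler_wpM2l// (bigD1 i)//= lerDl sumr_ge0//.
Qed.

End gauss_affine.

(** * Elementary inequalities for exp, ln and x ln x *)

Section scalar_bounds.
Context {R : realType}.
Implicit Types (u s t eta : R).

(** From 1 - s <= exp(-s) comes exp s <= 1 / (1 - s), which stays below the quadratic exactly as
    long as s <= 1/2. *)
Lemma expR_le_quadratic s : s <= 2^-1 -> expR s <= 1 + s + 2 * s ^+ 2.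
Proof.
move=> s2; have h : expR (- s) >= 1 - s by exact: expR_ge1Dx.
have s1 : 0 < 1 - s by lra.
have -> : expR s = (expR (- s))^-1 by rewrite expRN invrK.
rewrite (@le_trans _ _ (1 - s)^-1)//.
  by rewrite lef_pV2// posrE expR_gt0.
rewrite -[leLHS]mul1r ler_pdivrMr//; nra.
Qed.

Lemma ge_at_one (f df : R -> R) :
  (forall x : R, 0 < x -> is_derive x 1 f (df x)) ->
  (forall x : R, 0 < x -> 0 <= (x - 1) * df x) -> forall u, 0 < u -> f 1 <= f u.
Proof.
move=> fd dfs u u0.
have cf (a b : R) : 0 < a -> {within `[a, b], continuous f}.
  move=> a0; apply: derivable_within_continuous => x; rewrite in_itv/= => /andP[ax _].
  by have [] := fd x (lt_le_trans a0 ax).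
have [u1|u1|->//] := ltgtP u 1.
- have [c] : exists2 c, c \in `]u, 1[ & f 1 - f u = df c * (1 - u).
    apply: MVT => //; last exact: cf.
    by move=> x; rewrite in_itv/= => /andP[ux _]; apply: fd; lra.
  rewrite in_itv/= => /andP[uc c1] H; have := dfs c (lt_trans u0 uc).
  by rewrite nmulr_rge0 ?subr_lt0// => h; rewrite -subr_le0 H mulr_le0_ge0//; lra.
- have [c] : exists2 c, c \in `]1, u[ & f u - f 1 = df c * (u - 1).
    apply: MVT => //; last exact: cf.
    by move=> x; rewrite in_itv/= => /andP[ux _]; apply: fd; lra.
  rewrite in_itv/= => /andP[uc c1] H; have := dfs c (lt_trans ltr01 uc).
  by rewrite pmulr_rge0 ?subr_gt0// => h; rewrite -subr_ge0 H mulr_ge0//; lra.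
Qed.

Lemma ln_le_cubic u : 0 < u ->
  ln u <= (u - 1) - (u - 1) ^+ 2 / 2 + (u - 1) ^+ 3 / 3.
Proof.
move=> u0.
pose f (x : R) := x - 1 - 2^-1 * (x - 1) ^+ 2 + 3^-1 * (x - 1) ^+ 3 - ln x.
have := @ge_at_one f (fun x => (x - 1) ^+ 3 / x) _ _ u u0.
rewrite /f ln1 subrr expr0n/= expr0n/= !mulr0 !subr0 addr0.
move=> h; have {h} : 0 <= f u.
  apply: h => x x0.
  - have xn0 : x != 0 by rewrite gt_eqF.
    have dl := is_derive1_ln x0.
    by apply: is_derive_eq; rewrite /GRing.scale/=; field.
  - by rewrite mulrA -exprS divr_ge0// ?exprn_even_ge0// ltW.
rewrite /f; lra.
Qed.

(** As ln tends to minus infinity at 0, the lower bound needs [u] in a denominator. With this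
    quartic term the difference of the two sides has derivative (u - 1)^3 / (3 u^2), which has the
    sign of u - 1. *)
Lemma ln_ge_cubic u : 0 < u ->
  (u - 1) - (u - 1) ^+ 2 / 2 + (u - 1) ^+ 3 / 3 - (u - 1) ^+ 4 / (3 * u) <= ln u.
Proof.
move=> u0.
pose f (x : R) := ln x - (x - 1) + 2^-1 * (x - 1) ^+ 2 - 3^-1 * (x - 1) ^+ 3
  + 3^-1 * ((x - 1) ^+ 4 * x^-1).
have := @ge_at_one f (fun x => (x - 1) ^+ 3 / (3 * x ^+ 2)) _ _ u u0.
rewrite /f ln1 subrr expr0n/= expr0n/= expr0n/= !(mulr0, mul0r) !subr0 !addr0.
move=> h; have {h} : 0 <= f u.
  apply: h => x x0.
  - have xn0 : x != 0 by rewrite gt_eqF.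
    have dl := is_derive1_ln x0.
    have dV : is_derive x 1 (fun y : R => y^-1) (- x ^- 2).
      by have := is_deriveV xn0 (is_derive_id x (1 : R)); rewrite /GRing.scale/= ?mulr1.
    by apply: is_derive_eq; rewrite /GRing.scale/=; field.
  - by rewrite mulrA -exprS divr_ge0// ?exprn_even_ge0// mulr_ge0// exprn_ge0// ltW.
rewrite /f invfM; lra.
Qed.

(* The remainder [eta t^2 + t^4 / eta + t^4 / u], where t = u - 1, has an
   expectation that Jensen's inequality reduces to a single log-normal variable. *)
Lemma cube_le t eta : 0 < eta ->
  `|t ^+ 3| <= (eta * t ^+ 2 + t ^+ 4 / eta) / 2.
Proof.
move=> e0; rewrite normrX.
have -> : t ^+ 2 = `|t| ^+ 2 by rewrite -normrX ger0_norm ?sqr_ge0.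
have -> : t ^+ 4 = `|t| ^+ 4 by rewrite -normrX ger0_norm ?exprn_even_ge0.
have := normr_ge0 t; move: `|t| => a a0.
have -> : (eta * a ^+ 2 + a ^+ 4 / eta) / 2 =
    a ^+ 3 + (a ^+ 2 * (eta - a) ^+ 2) / (2 * eta).
  by field; rewrite gt_eqF.
rewrite lerDl divr_ge0//; last lra.
by rewrite mulr_ge0 ?sqr_ge0.
Qed.

Lemma ln_quadratic u eta : 0 < u -> 0 < eta <= 1 ->
  `|ln u - ((u - 1) - (u - 1) ^+ 2 / 2)| <=
    eta * (u - 1) ^+ 2 + (u - 1) ^+ 4 / eta + (u - 1) ^+ 4 / u.
Proof.
move=> u0 /andP[e0 e1].
have := ln_le_cubic u0; have := ln_ge_cubic u0.
set t := u - 1; have -> : t ^+ 4 / (3 * u) = 3^-1 * (t ^+ 4 / u).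
  by field; rewrite gt_eqF.
have : 0 <= t ^+ 4 / u by rewrite divr_ge0 ?exprn_even_ge0// ltW.
move: (t ^+ 4 / u) => A A0.
have H := cube_le t e0.
have : 0 <= eta * t ^+ 2 + t ^+ 4 / eta.
  by rewrite addr_ge0//; [rewrite mulr_ge0 ?sqr_ge0// ltW|rewrite divr_ge0 ?exprn_even_ge0// ltW].
move: H; move: (eta * t ^+ 2 + t ^+ 4 / eta) => B.
rewrite ler_norml => /andP[H1 H2] B0 H3 H4; rewrite ler_norml; lra.
Qed.

(** The cubic bounds on ln multiplied by [u]. The remainder is given the same form as for ln, so
    that one step lemma serves both functions. *)
Lemma xlnx_quadratic u eta : 0 < u -> 0 < eta <= 1 ->
  `|u * ln u - ((u - 1) + (u - 1) ^+ 2 / 2)| <=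
    eta * (u - 1) ^+ 2 + (u - 1) ^+ 4 / eta + (u - 1) ^+ 4 / u.
Proof.
move=> u0 /andP[e0 e1].
have := ler_wpM2l (ltW u0) (ln_le_cubic u0).
have := ler_wpM2l (ltW u0) (ln_ge_cubic u0).
have H := cube_le (u - 1) e0.
have : (u - 1) ^+ 4 <= (u - 1) ^+ 4 / eta.
  by rewrite ler_pdivlMr// ler_piMr// exprn_even_ge0.
have : 0 <= (u - 1) ^+ 4 / u by rewrite divr_ge0 ?exprn_even_ge0// ltW.
have : 0 <= (u - 1) ^+ 4 by rewrite exprn_even_ge0.
have : 0 <= eta * (u - 1) ^+ 2 by rewrite mulr_ge0 ?sqr_ge0// ltW.
have -> : u * (u - 1 - (u - 1) ^+ 2 / 2 + (u - 1) ^+ 3 / 3 - (u - 1) ^+ 4 / (3 * u)) =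
    (u - 1) + (u - 1) ^+ 2 / 2 - (u - 1) ^+ 3 / 6.
  by field; rewrite gt_eqF.
have -> : u * (u - 1 - (u - 1) ^+ 2 / 2 + (u - 1) ^+ 3 / 3) =
    (u - 1) + (u - 1) ^+ 2 / 2 - (u - 1) ^+ 3 / 6 + (u - 1) ^+ 4 / 3.
  by field.
move: H; rewrite ler_norml => /andP[].
move: ((u - 1) ^+ 3) ((u - 1) ^+ 4 / eta) ((u - 1) ^+ 4 / u) => a b c.
move: (u * ln u) (eta * (u - 1) ^+ 2) => d e.
move: ((u - 1) ^+ 4) => f; move: ((u - 1) ^+ 2) => g.
by move=> *; rewrite ler_norml; lra.
Qed.

End scalar_bounds.

(** * Normalised Gaussian fields and their partition functions *)

Section tilted_operator.
Context {R : realType} {S : finType}.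
Implicit Types (v a b : S -> R) (Psi : (S -> R) -> R) (l : seq (S -> R)).

(* [GG l] averages over [v x + \sum_(a <- l) z_a a x] with independent standard
   gaussians z_a; the shift by half the variance keeps the mean of each [expR (v x)]. *)
Definition TT l Psi v := GG l Psi (nrm l v).

Lemma good_TT l Psi : good Psi -> good (TT l Psi).
Proof. by move=> gP; apply: (good_translate (fun x => - (cov l x x / 2))); exact: good_GG. Qed.

Lemma TT_cst l c : TT l (fun=> c) = fun=> c.
Proof. by apply/funext => v; rewrite /TT GG_cst. Qed.

Lemma TTD l Psi1 Psi2 v : good Psi1 -> good Psi2 ->
  TT l (fun v => Psi1 v + Psi2 v) v = TT l Psi1 v + TT l Psi2 v.
Proof. exact: GGD. Qed.

Lemma TTZ l c Psi v : good Psi -> TT l (fun v => c * Psi v) v = c * TT l Psi v.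
Proof. exact: GGZ. Qed.

Lemma TTN l Psi v : good Psi -> TT l (fun v => - Psi v) v = - TT l Psi v.
Proof. exact: GGN. Qed.

Lemma TTB l Psi1 Psi2 v : good Psi1 -> good Psi2 ->
  TT l (fun v => Psi1 v - Psi2 v) v = TT l Psi1 v - TT l Psi2 v.
Proof. exact: GGB. Qed.

Lemma TT_sum l (I : Type) (r : seq I) (F : I -> (S -> R) -> R) v :
  (forall i, good (F i)) ->
  TT l (fun v => \sum_(i <- r) F i v) v = \sum_(i <- r) TT l (F i) v.
Proof. exact: GG_sum. Qed.

Lemma TT_le l Psi1 Psi2 v : good Psi1 -> good Psi2 ->
  (forall v, Psi1 v <= Psi2 v) -> TT l Psi1 v <= TT l Psi2 v.
Proof. exact: GG_le. Qed.

Lemma TT_translate l b Psi v :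
  TT l (fun v => Psi (fun x => v x + b x)) v = TT l Psi (fun x => v x + b x).
Proof.
by rewrite /TT GG_translate; congr GG; apply/funext => x; rewrite /nrm addrAC.
Qed.

(** The normalisation cancels the variance factor of [GG_tilt]; only the shift by the covariance is
    left. *)
Lemma TT_tilt l Psi x0 v : good Psi ->
  TT l (fun v => expR (v x0) * Psi v) v =
  expR (v x0) * TT l Psi (fun x => v x + cov l x0 x).
Proof.
move=> gP; rewrite /TT GG_tilt// /nrm subrK; congr (_ * GG _ _ _).
by apply/funext => x; rewrite addrAC.
Qed.

Lemma TT_cat l l' Psi v : TT (l ++ l') Psi v = TT l (TT l' Psi) v.
Proof.
rewrite /TT GG_cat.
rewrite (GG_translate l (fun x => - (cov l' x x / 2)) (GG l' Psi)).
congr GG; apply/funext => x; rewrite /nrm cov_cat; by field.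
Qed.

Lemma TT_comm l l' Psi v : good Psi -> TT l (TT l' Psi) v = TT l' (TT l Psi) v.
Proof.
move=> gP; rewrite -!TT_cat /TT !GG_cat GG_comm//.
by congr GG; apply/funext => x; rewrite /nrm !cov_cat addrC (addrC (cov l x x)) addrC.
Qed.

Lemma TT_semigroup l s t Psi v : 0 < s -> good Psi ->
  TT (scale t l) (TT (scale s l) Psi) v =
  TT (scale (Num.sqrt (s ^+ 2 + t ^+ 2)) l) Psi v.
Proof.
move=> s0 gP; rewrite -TT_cat /TT GG_cat GG_semigroup//.
congr GG; apply/funext => x; rewrite /nrm cov_cat !cov_scale sqr_sqrtr; last first.
  by rewrite addr_ge0 ?sqr_ge0.
by field.
Qed.

Lemma scale1 l : scale 1 l = l.
Proof.
rewrite /scale -[RHS]map_id; apply: eq_map => a; apply/funext => x.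
by rewrite mul1r.
Qed.

Lemma good_iter_TT l Psi k : good Psi -> good (iter k (TT l) Psi).
Proof. by move=> gP; elim: k => //= k IH; exact: good_TT. Qed.

(** Variances add: k + 1 steps of variance s^2 make one of variance (k + 1) s^2. This is what allows
    a field to be cut into small steps. *)
Lemma iter_TT l s Psi k v : 0 < s -> good Psi ->
  iter k.+1 (TT (scale s l)) Psi v = TT (scale (s * Num.sqrt k.+1%:R) l) Psi v.
Proof.
move=> s0 gP; elim: k v => [|k IH] v; first by rewrite /= sqrtr1 mulr1.
rewrite iterS (_ : iter _ _ _ = TT (scale (s * Num.sqrt k.+1%:R) l) Psi);
  last by apply/funext => w; exact: IH.
rewrite TT_semigroup//; last by rewrite mulr_gt0// sqrtr_gt0.
congr (TT (scale _ l) Psi v); rewrite exprMn sqr_sqrtr//.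
rewrite -[X in _ + X]mulr1 -mulrDr -natr1 -mulrSr natr1.
by rewrite sqrtrM ?sqr_ge0// sqrtr_sqr gtr0_norm.
Qed.

(** In k^2 - k the square is the Gaussian moment and the linear term is taken away by the
    normalisation. *)
Lemma TT_expRk l k x v :
  TT l (fun v => expR (k * v x)) v = expR (k * v x + (k ^+ 2 - k) * cov l x x / 2).
Proof.
have HG a : G a (fun v => expR (k * v x)) = fun v => expR ((k * a x) ^+ 2 / 2) * expR (k * v x).
  apply/funext => w; rewrite /G -gE_expR mulrC -gEZ; last first.
    by have := tame_expR (k * a x) 0; under eq_fun do rewrite addr0.
  congr gE; apply/funext => z; rewrite -expRD; congr expR; by ring.
have gk : good (fun v => expR (k * v x)).
  split => [d T V mV|].
    by apply: measurableT_comp => //; apply: measurable_funM.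
  exists 1, `|k|; split => // w; rewrite mul1r ger0_norm ?expR_ge0// ler_expR.
  rewrite (le_trans (ler_norm _))// normrM ler_wpM2l//.
  by rewrite (bigD1 x)//= lerDl sumr_ge0.
have HGG w : GG l (fun v => expR (k * v x)) w = expR (k * w x + k ^+ 2 * cov l x x / 2).
  elim: l w => [|a l IH] w; first by rewrite /= /cov big_nil mulr0 mul0r addr0.
  rewrite /= (_ : GG l _ = fun v => expR (k ^+ 2 * cov l x x / 2) * expR (k * v x)); last first.
    by apply/funext => u; rewrite IH addrC expRD.
  rewrite GZ// HG -!expRD; congr expR; rewrite /cov big_cons; by field.
by rewrite /TT HGG /nrm; congr expR; by field.
Qed.

Lemma good_expRk k x : good (fun v : S -> R => expR (k * v x)).
Proof.
split => [d T V mV|].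
  by apply: measurableT_comp => //; apply: measurable_funM.
exists 1, `|k|; split => // w; rewrite mul1r ger0_norm ?expR_ge0// ler_expR.
rewrite (le_trans (ler_norm _))// normrM ler_wpM2l//.
by rewrite (bigD1 x)//= lerDl sumr_ge0.
Qed.

End tilted_operator.

Section partition_function.
Context {R : realType} {S : finType}.
Variable w : S -> R.
Hypothesis w0 : forall x, 0 <= w x.
Hypothesis wpos : 0 < \sum_x w x.
Implicit Types (v : S -> R) (l : seq (S -> R)).

Definition Zf v := \sum_x w x * expR (v x).

Definition gibbs v x := w x * expR (v x) / Zf v.

Lemma Zf_ge v : (\sum_x w x) * expR (- \sum_x `|v x|) <= Zf v.
Proof.
rewrite mulr_suml; apply: ler_sum => x _; rewrite ler_wpM2l// ler_expR.
rewrite lerNl (le_trans (ler_norm _))// normrN.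
by rewrite (bigD1 x)//= lerDl sumr_ge0.
Qed.

Lemma Zf_le v : Zf v <= (\sum_x w x) * expR (\sum_x `|v x|).
Proof.
rewrite mulr_suml; apply: ler_sum => x _; rewrite ler_wpM2l// ler_expR.
by rewrite (le_trans (ler_norm _))// (bigD1 x)//= lerDl sumr_ge0.
Qed.

Lemma Zf_gt0 v : 0 < Zf v.
Proof. by rewrite (lt_le_trans _ (Zf_ge v))// mulr_gt0// expR_gt0. Qed.

Lemma good_Zf : good Zf.
Proof. by apply: good_sum => x; apply: goodZ; exact: good_expR. Qed.

Lemma good_lnZf : good (fun v => ln (Zf v)).
Proof.
split => [d T V mV|].
  apply: (measurableT_comp (@measurable_ln R)).
  by case: good_Zf => mZ _; exact: mZ.
pose W := \sum_x w x.
exists (expR `|ln W|), 1; split; rewrite ?expR_ge0// => v.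
rewrite mul1r -expRD; apply: (@le_trans _ _ (`|ln W| + \sum_x `|v x|)); last first.
  by rewrite (le_trans _ (expR_ge1Dx _))// lerDr.
have s0 : 0 <= \sum_x `|v x| by rewrite sumr_ge0.
have := Zf_le v; have := Zf_ge v.
rewrite -ler_ln ?posrE ?Zf_gt0 ?mulr_gt0 ?expR_gt0// lnM ?posrE ?expR_gt0// expRK => h1.
rewrite -ler_ln ?posrE ?Zf_gt0 ?mulr_gt0 ?expR_gt0// lnM ?posrE ?expR_gt0// expRK => h2.
have := ler_norm (ln W); have := lerNnormlW (lexx `|ln W|).
rewrite ler_norml -/W in h1 h2 *; lra.
Qed.

Lemma good_ZfV : good (fun v => (Zf v)^-1).
Proof.
split => [d T V mV|].
  rewrite (_ : (fun t => _) = (fun t => expR (- ln (Zf (V t))))).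
    apply: measurableT_comp => //; apply: measurableT_comp => //.
    by case: good_lnZf => mZ _; exact: mZ.
  by apply/funext => t; rewrite expRN lnK// posrE Zf_gt0.
exists (\sum_x w x)^-1, 1; split; rewrite ?invr_ge0 ?ltW// => v.
rewrite gtr0_norm ?invr_gt0 ?Zf_gt0// mul1r -[expR _]invrK -expRN -invfM.
by rewrite lef_pV2 ?posrE ?Zf_gt0 ?mulr_gt0 ?expR_gt0// Zf_ge.
Qed.

Lemma good_gibbs x : good (gibbs ^~ x).
Proof. by apply: goodM; [apply: goodZ; exact: good_expR|exact: good_ZfV]. Qed.

Lemma gibbs_ge0 v x : 0 <= gibbs v x.
Proof. by rewrite divr_ge0 ?mulr_ge0 ?expR_ge0// ltW// Zf_gt0. Qed.

Lemma sum_gibbs v : \sum_x gibbs v x = 1.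
Proof. by rewrite -mulr_suml divff// gt_eqF// Zf_gt0. Qed.

Lemma Zf_gibbs v v' : Zf v' / Zf v = \sum_x gibbs v x * expR (v' x - v x).
Proof.
rewrite mulr_suml; apply: eq_bigr => x _.
rewrite /gibbs (_ : expR (v' x) = expR (v x) * expR (v' x - v x)).
  by rewrite mulrA mulrAC.
by rewrite -expRD subrKC.
Qed.

(** Weighting by [Zf] plants a configuration: x is chosen with weight w x exp(v x), and the field
    acquires as drift its covariance with x. The two-replica formula and the planted form of the
    free energy both come from here. *)
Lemma TT_Zf_mul l (Psi : (S -> R) -> R) v : good Psi ->
  TT l (fun v => Zf v * Psi v) v =
  \sum_x w x * expR (v x) * TT l Psi (fun y => v y + cov l x y).
Proof.
move=> gP; rewrite (_ : (fun v => _) = (fun v => \sum_x w x * (expR (v x) * Psi v))).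
  rewrite TT_sum; last by move=> x; apply: goodZ; apply: goodM => //; exact: good_expR.
  apply: eq_bigr => x _; rewrite TTZ; last by apply: goodM => //; exact: good_expR.
  by rewrite TT_tilt// mulrA.
by apply/funext => u; rewrite mulr_suml; apply: eq_bigr => x _; rewrite mulrA.
Qed.

(** A sum of normalised exponentials has constant mean: [Zf] behaves as a martingale when
    independent fields are added. *)
Lemma TT_Zf l v : TT l Zf v = Zf v.
Proof.
rewrite (_ : Zf = fun v => Zf v * 1); last by apply/funext => u; rewrite mulr1.
rewrite TT_Zf_mul; last exact: good_cst.
by rewrite mulr1; apply: eq_bigr => x _; rewrite TT_cst mulr1.
Qed.

End partition_function.

(** * Kahane's inequality *)

Ltac solve_good := first [assumption | lazymatch goal with
  | |- good (fun _ => ?c) => exact: good_cst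
  | |- good (fun v => @?A v + @?B v) => apply: (@goodD _ _ A B); solve_good
  | |- good (fun v => - @?A v) => apply: (@goodN _ _ A); solve_good
  | |- good (fun v => @?A v * @?B v) => apply: (@goodM _ _ A B); solve_good
  | |- good (fun v => @?A v ^+ ?n) => apply: (@goodX _ _ A n); solve_good
  | |- good (fun v => \sum_(x <- _ | _) _) => apply: good_sum => ?; solve_good
  | |- _ => try (by [])
  end].

Section one_step.
Context {R : realType} {S : finType}.
Variable w : S -> R.
Hypothesis w0 : forall x, 0 <= w x.
Hypothesis wpos : 0 < \sum_x w x.
Variables (l : seq (S -> R)) (r : R).
Hypothesis r0 : 0 < r.
Hypothesis r12 : r <= 12^-1.
Hypothesis covr : forall x y, `|cov l x y| <= r.
Implicit Types v : S -> R.

Local Notation Z := (Zf w).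
Local Notation p := (gibbs w).

(** The covariance averaged over two independent Gibbs replicas, the second-order quantity of a
    step. *)
Definition kappa v := \sum_x \sum_y p v x * p v y * cov l x y.

Let gibbs2_ge0 v x y : 0 <= p v x * p v y.
Proof. by rewrite mulr_ge0// gibbs_ge0. Qed.

(** Jensen's inequality with a supporting line of slope [c] as hypothesis: the ratio of the
    partition functions is the Gibbs mean of exp(v' - v). *)
Lemma jensen_gibbs v v' (F : R -> R) (c : R) :
  (forall t : R, 0 < t -> F (Z v' / Z v) + c * (t - Z v' / Z v) <= F t) ->
  F (Z v' / Z v) <= \sum_x p v x * F (expR (v' x - v x)).
Proof.
move=> H; pose u := Z v' / Z v.
rewrite (@le_trans _ _ (\sum_x p v x * (F u + c * (expR (v' x - v x) - u))))//.
  under eq_bigr do rewrite mulrDr mulrCA mulrBr.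
  rewrite big_split/= -mulr_suml (sum_gibbs w0 wpos) mul1r -mulr_sumr big_split/=.
  rewrite sumrN -mulr_suml (sum_gibbs w0 wpos) mul1r -(Zf_gibbs w).
  by rewrite subrr mulr0 addr0.
apply: ler_sum => x _; rewrite ler_wpM2l ?gibbs_ge0//.
by apply: H; exact: expR_gt0.
Qed.

Lemma quartic_tangent (u t : R) : (u - 1) ^+ 4 + 4 * (u - 1) ^+ 3 * (t - u) <= (t - 1) ^+ 4.
Proof.
rewrite -subr_ge0.
have -> : (t - 1) ^+ 4 - ((u - 1) ^+ 4 + 4 * (u - 1) ^+ 3 * (t - u)) =
  (t - u) ^+ 2 * ((t + u - 2) ^+ 2 + 2 * (u - 1) ^+ 2) by ring.
apply: mulr_ge0; first exact: sqr_ge0.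
by apply: addr_ge0; [exact: sqr_ge0|apply: mulr_ge0 => //; exact: sqr_ge0].
Qed.

(** Supporting lines of (t - 1)^4 / t: the difference of the two sides factors through (t - u)^2 and
    a sum of nonnegative terms. *)
Lemma quartic_div_tangent (u t : R) : 0 < u -> 0 < t ->
  (u - 1) ^+ 4 / u + ((u - 1) ^+ 3 * (3 * u + 1) / u ^+ 2) * (t - u) <= (t - 1) ^+ 4 / t.
Proof.
move=> u0 t0; rewrite -subr_ge0.
have -> : (t - 1) ^+ 4 / t - ((u - 1) ^+ 4 / u + ((u - 1) ^+ 3 * (3 * u + 1) / u ^+ 2) * (t - u)) =
  (t - u) ^+ 2 * ((t * u - 1) ^+ 2 + 2 * (t * u) * (u - 1) ^+ 2) / (t * u ^+ 2).
  by field; rewrite ?gt_eqF.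
have tu0 : 0 <= t * u by rewrite mulr_ge0// ltW.
apply: divr_ge0; last by apply: mulr_ge0; [exact: ltW|exact: sqr_ge0].
apply: mulr_ge0; first exact: sqr_ge0.
apply: addr_ge0; [exact: sqr_ge0|apply: mulr_ge0; [exact: mulr_ge0|exact: sqr_ge0]].
Qed.

Let e (k : R) x v v' := expR (k * (v' x - v x)).

Let good_e k x v : good (e k x v).
Proof.
have -> : e k x v = fun v' => expR (- (k * v x)) * expR (k * v' x).
  by apply/funext => v'; rewrite /e -expRD; congr expR; ring.
by apply: goodZ; exact: good_expRk.
Qed.

Let TT_e k x v : TT l (e k x v) v = expR ((k ^+ 2 - k) / 2 * cov l x x).
Proof.
have -> : e k x v = fun v' => expR (- (k * v x)) * expR (k * v' x).
  by apply/funext => v'; rewrite /e -expRD; congr expR; ring.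
rewrite TTZ; last exact: good_expRk.
by rewrite TT_expRk -expRD; congr expR; field.
Qed.

Let covxx x : 0 <= cov l x x <= r.
Proof. by rewrite cov_ge0/= (le_trans (ler_norm _)). Qed.

Let good_Z : good Z. Proof. exact: good_Zf. Qed.
Let good_ZV : good (fun v => (Z v)^-1). Proof. exact: good_ZfV. Qed.

Lemma TT_ratio v : TT l (fun v' => Z v' / Z v - 1) v = 0.
Proof.
rewrite TTB; [|solve_good..]; rewrite TT_cst.
rewrite (_ : (fun v' => Z v' / Z v) = fun v' => (Z v)^-1 * Z v'); last first.
  by apply/funext => v'; rewrite mulrC.
by rewrite TTZ// TT_Zf// mulVf ?subrr// gt_eqF// Zf_gt0.
Qed.

(** In the mean of Z^2 one factor plants a replica x and the other is invariant, hence evaluated at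
    the field shifted by its covariance with x. This yields the Gibbs average of exp(cov x y) - 1,
    of which [kappa] is the linear part. *)
Lemma TT_ratio_sqr v : `|TT l (fun v' => (Z v' / Z v - 1) ^+ 2) v - kappa v| <= 2 * r ^+ 2.
Proof.
have Z0 := Zf_gt0 w0 wpos v.
have -> : TT l (fun v' => (Z v' / Z v - 1) ^+ 2) v =
    \sum_x \sum_y p v x * p v y * (expR (cov l x y) - 1).
  rewrite (_ : (fun v' => _) = fun v' => (Z v) ^- 2 * (Z v' * Z v') - 2 * (Z v)^-1 * Z v' + 1).
    rewrite TTD; [|solve_good..]; rewrite TT_cst TTB; [|solve_good..].
    rewrite !TTZ; [|solve_good..]; rewrite TT_Zf// TT_Zf_mul//.
    under [RHS]eq_bigr do under eq_bigr do rewrite mulrBr mulr1.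
    under [RHS]eq_bigr do rewrite sumrB -mulr_sumr (sum_gibbs w0 wpos) mulr1.
    rewrite sumrB (sum_gibbs w0 wpos) -mulrA mulVf ?gt_eqF// mulr1.
    rewrite -addrA (_ : - 2 + 1 = - 1); last by ring.
    congr (_ - _); rewrite mulr_sumr; apply: eq_bigr => x _.
    rewrite TT_Zf// /Zf !mulr_sumr; apply: eq_bigr => y _.
    rewrite expRD /gibbs -/(Zf w v).
    by field; rewrite gt_eqF.
  by apply/funext => v'; field; rewrite gt_eqF.
rewrite -sumrB (le_trans (ler_norm_sum _ _ _))//.
rewrite (@le_trans _ _ (\sum_x \sum_y p v x * p v y * (2 * r ^+ 2)))//; last first.
  under eq_bigr do rewrite -mulr_suml -mulr_sumr (sum_gibbs w0 wpos) mulr1.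
  by rewrite -mulr_suml (sum_gibbs w0 wpos) mul1r.
apply: ler_sum => x _; rewrite -sumrB (le_trans (ler_norm_sum _ _ _))//.
apply: ler_sum => y _; rewrite -mulrBr normrM ger0_norm ?gibbs2_ge0// ler_wpM2l ?gibbs2_ge0//.
have h1 : 1 + cov l x y <= expR (cov l x y) by exact: expR_ge1Dx.
have := covr x y; rewrite ler_norml => /andP[c1 c2].
have h2 : expR (cov l x y) <= 1 + cov l x y + 2 * cov l x y ^+ 2.
  by apply: expR_le_quadratic; have := r12; lra.
have : cov l x y ^+ 2 <= r ^+ 2 by nra.
by have := sqr_ge0 r; move=> *; rewrite ler_norml; lra.
Qed.

(** Jensen reduces to one normalised exponential of variance s <= r, whose fourth centred moment is
    e^(6s) - 4 e^(3s) + 6 e^s - 3. Orders 0 and 1 cancel, and the quadratic remainders 72 s^2 and 12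
    s^2 add up to 84. The bound 12^-1 on [r] ensures 6 s <= 1/2. *)
Lemma TT_ratio_quartic v : TT l (fun v' => (Z v' / Z v - 1) ^+ 4) v <= 84 * r ^+ 2.
Proof.
pose Q x v' := e 4 x v v' - 4 * e 3 x v v' + 6 * e 2 x v v' - 4 * e 1 x v v' + 1.
have gQ x : good (Q x) by rewrite /Q; solve_good; exact: good_e.
rewrite (@le_trans _ _ (TT l (fun v' => \sum_x p v x * Q x v') v))//.
  apply: TT_le; [solve_good..|] => v'.
  rewrite (le_trans (@jensen_gibbs v v' (fun t => (t - 1) ^+ 4) _ (fun t _ => quartic_tangent _ t)))//.
  apply: ler_sum => x _; rewrite ler_wpM2l ?gibbs_ge0// le_eqVlt; apply/orP; left; apply/eqP.
  rewrite /Q /e !(mulrC _ (v' x - v x)) !expRM_natr mulr1; ring.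
rewrite TT_sum; last by move=> x; solve_good.
rewrite (@le_trans _ _ (\sum_x p v x * (84 * r ^+ 2)))//; last first.
  by rewrite -mulr_suml (sum_gibbs w0 wpos) mul1r.
apply: ler_sum => x _; rewrite TTZ// ler_wpM2l ?gibbs_ge0//.
rewrite /Q; do !(rewrite TTD || rewrite TTN || rewrite TTZ); try by solve_good; exact: good_e.
rewrite !TT_e TT_cst.
have /andP[s0 sr] := covxx x; move: (cov l x x) s0 sr => s s0 sr.
have h6 : expR ((4 ^+ 2 - 4) / 2 * s) <= 1 + 6 * s + 2 * (6 * s) ^+ 2.
  by rewrite (_ : _ / 2 * s = 6 * s); [apply: expR_le_quadratic; have := r12; lra|field].
have h3 : 1 + 3 * s <= expR ((3 ^+ 2 - 3) / 2 * s).
  by rewrite (_ : _ / 2 * s = 3 * s); [exact: expR_ge1Dx|field].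
have h1 : expR ((2 ^+ 2 - 2) / 2 * s) <= 1 + s + 2 * s ^+ 2.
  by rewrite (_ : _ / 2 * s = s); [apply: expR_le_quadratic; have := r12; lra|field].
rewrite (_ : (1 ^+ 2 - 1) / 2 * s = 0); last by field.
rewrite expR0; have : s ^+ 2 <= r ^+ 2 by nra.
by move: h6; rewrite exprMn; lra.
Qed.

Lemma good_ratio_quartic_div v : good (fun v' => (Z v' / Z v - 1) ^+ 4 / (Z v' / Z v)).
Proof.
rewrite (_ : (fun v' => _) = fun v' => (Z v' / Z v - 1) ^+ 4 * (Z v * (Z v')^-1)).
  by solve_good.
by apply/funext => v'; rewrite invfM invrK (mulrC (Z v)).
Qed.

(** Here (t - 1)^4 / t = t^3 - 4 t^2 + 6 t - 4 + 1 / t has log-normal mean e^(3s) - 3 e^s + 2, which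
    again starts at order s^2. *)
Lemma TT_ratio_quartic_div v :
  TT l (fun v' => (Z v' / Z v - 1) ^+ 4 / (Z v' / Z v)) v <= 18 * r ^+ 2.
Proof.
pose Q x v' := e 3 x v v' - 4 * e 2 x v v' + 6 * e 1 x v v' - 4 + e (-1) x v v'.
have gQ x : good (Q x) by rewrite /Q; solve_good; exact: good_e.
have gL := good_ratio_quartic_div v.
rewrite (@le_trans _ _ (TT l (fun v' => \sum_x p v x * Q x v') v))//.
  apply: TT_le; [solve_good..|] => v'.
  have u0 : 0 < Z v' / Z v by rewrite divr_gt0// Zf_gt0.
  rewrite (le_trans (@jensen_gibbs v v' (fun t => (t - 1) ^+ 4 / t) _ (fun t => quartic_div_tangent u0)))//.
  apply: ler_sum => x _; rewrite ler_wpM2l ?gibbs_ge0// le_eqVlt; apply/orP; left; apply/eqP.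
  rewrite /Q /e !(mulrC _ (v' x - v x)) !expRM_natr mulr1 mulrN1 expRN.
  by field; rewrite gt_eqF// expR_gt0.
rewrite TT_sum; last by move=> x; solve_good.
rewrite (@le_trans _ _ (\sum_x p v x * (18 * r ^+ 2)))//; last first.
  by rewrite -mulr_suml (sum_gibbs w0 wpos) mul1r.
apply: ler_sum => x _; rewrite TTZ// ler_wpM2l ?gibbs_ge0//.
rewrite /Q; do !(rewrite TTD || rewrite TTN || rewrite TTZ); try by solve_good; exact: good_e.
rewrite !TT_e TT_cst.
have /andP[s0 sr] := covxx x; move: (cov l x x) s0 sr => s s0 sr.
have h3 : expR ((3 ^+ 2 - 3) / 2 * s) <= 1 + 3 * s + 2 * (3 * s) ^+ 2.
  by rewrite (_ : _ / 2 * s = 3 * s); [apply: expR_le_quadratic; have := r12; lra|field].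
rewrite (_ : (1 ^+ 2 - 1) / 2 * s = 0); last by field.
rewrite (_ : (2 ^+ 2 - 2) / 2 * s = s); last by field.
rewrite (_ : ((-1) ^+ 2 - -1) / 2 * s = s); last by field.
have h1 : 1 + s <= expR s by exact: expR_ge1Dx.
rewrite expR0; have : s ^+ 2 <= r ^+ 2 by nra.
by move: h3; rewrite exprMn; lra.
Qed.

(* [eta = sqrt r] balances the two error terms of the scalar bounds. *)
Lemma TT_step v (Phi : (S -> R) -> R) (s : R) : good Phi -> `|s| <= 1 ->
  (forall (v' : S -> R) (eta : R), 0 < eta <= 1 -> let u := Z v' / Z v in
    `|Phi v' - ((u - 1) + s * ((u - 1) ^+ 2 / 2))| <=
    eta * (u - 1) ^+ 2 + (u - 1) ^+ 4 / eta + (u - 1) ^+ 4 / u) ->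
  `|TT l Phi v - s * (kappa v / 2)| <= 120 * (r * Num.sqrt r).
Proof.
move=> gPhi s1 H; pose eta := Num.sqrt r.
have eta0 : 0 < eta by rewrite sqrtr_gt0.
have etar : eta ^+ 2 = r by rewrite sqr_sqrtr// ltW.
have eta1 : eta <= 1 by have := r12; nra.
have gL := good_ratio_quartic_div v.
pose M v' := (Z v' / Z v - 1) + s * ((Z v' / Z v - 1) ^+ 2 / 2).
pose E v' := eta * (Z v' / Z v - 1) ^+ 2 + (Z v' / Z v - 1) ^+ 4 / eta +
   (Z v' / Z v - 1) ^+ 4 / (Z v' / Z v).
have gM : good M by rewrite /M; solve_good.
have gE : good E by rewrite /E; solve_good.
have MU : TT l Phi v <= TT l M v + TT l E v.
  rewrite -TTD//; apply: TT_le => //; first exact: goodD.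
  move=> v'; have := H v' eta; rewrite eta0 eta1 => /(_ isT) /=.
  by rewrite ler_norml => /andP[_]; rewrite lerBlDl.
have ML : TT l M v - TT l E v <= TT l Phi v.
  rewrite -TTB//; apply: TT_le => //; first exact: goodB.
  move=> v'; have := H v' eta; rewrite eta0 eta1 => /(_ isT) /=.
  by rewrite ler_norml => /andP[+ _]; rewrite lerBrDl.
have t2 := TT_ratio_sqr v.
have ME : TT l M v = s * (TT l (fun v' => (Z v' / Z v - 1) ^+ 2) v / 2).
  rewrite /M TTD; [|solve_good..].
  rewrite TT_ratio add0r TTZ; last by solve_good.
  rewrite (_ : (fun v0 : S -> R => _ / 2) = fun v' => 2^-1 * (Z v' / Z v - 1) ^+ 2).
    by rewrite TTZ; [rewrite mulrC (mulrC _ 2^-1) mulrC|solve_good].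
  by apply/funext => v'; rewrite mulrC.
have EE : TT l E v = eta * TT l (fun v' => (Z v' / Z v - 1) ^+ 2) v +
    eta^-1 * TT l (fun v' => (Z v' / Z v - 1) ^+ 4) v +
    TT l (fun v' => (Z v' / Z v - 1) ^+ 4 / (Z v' / Z v)) v.
  rewrite /E TTD; [|solve_good..]; congr (_ + _).
  rewrite TTD; [|solve_good..].
  rewrite TTZ; last by solve_good.
  congr (_ + _); rewrite -TTZ; last by solve_good.
  congr (TT l _ v).
  by apply/funext => v'; rewrite mulrC.
have q4 := TT_ratio_quartic v; have q5 := TT_ratio_quartic_div v.
have kr : `|kappa v| <= r.
  rewrite (le_trans (ler_norm_sum _ _ _))//.
  rewrite (@le_trans _ _ (\sum_x \sum_y p v x * p v y * r))//; last first.
    under eq_bigr do rewrite -mulr_suml -mulr_sumr (sum_gibbs w0 wpos) mulr1.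
    by rewrite -mulr_suml (sum_gibbs w0 wpos) mul1r.
  apply: ler_sum => x _; rewrite (le_trans (ler_norm_sum _ _ _))//.
  apply: ler_sum => y _; rewrite normrM ger0_norm ?gibbs2_ge0//.
  by rewrite ler_wpM2l ?gibbs2_ge0.
move: MU ML t2 ME EE q4 q5 kr.
move: (TT l (fun v' => (Z v' / Z v - 1) ^+ 2) v) (TT l (fun v' => (Z v' / Z v - 1) ^+ 4) v).
move=> A B; move: (TT l (fun v' => (Z v' / Z v - 1) ^+ 4 / (Z v' / Z v)) v) => C.
move: (TT l Phi v) (TT l M v) (TT l E v) => P m E' MU ML t2 ME EE q4 q5 kr.
have reta : r * Num.sqrt r = eta ^+ 3 by rewrite -/eta -[X in X * _]etar -exprSr.
have q4' : eta^-1 * B <= 84 * eta ^+ 3.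
  rewrite ler_pdivrMl// (le_trans q4)// -etar le_eqVlt; apply/orP; left; apply/eqP; ring.
have A2 : A <= 2 * eta ^+ 2.
  move: t2 kr; rewrite !ler_norml -etar => /andP[_ t2] /andP[_ kr].
  have : (eta ^+ 2) ^+ 2 <= eta ^+ 2 * 12^-1.
    by rewrite expr2 ler_wpM2l ?sqr_ge0// etar.
  have := sqr_ge0 eta; lra.
have etaA : eta * A <= 2 * eta ^+ 3.
  by rewrite (le_trans (ler_wpM2l (ltW eta0) A2))// mulrCA -exprS.
have e34 : eta ^+ 4 <= eta ^+ 3.
  by rewrite exprS ler_piMl// exprn_ge0// ltW.
have q5' : C <= 18 * eta ^+ 3.
  by rewrite (le_trans q5)// -etar -exprM ler_wpM2l.
have t2' : `|s * (A / 2) - s * (kappa v / 2)| <= eta ^+ 3.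
  rewrite -mulrBr -mulrBl normrM (le_trans (ler_piMl _ s1))// normrM (@ger0_norm _ 2^-1)//.
  by rewrite ler_pdivrMr// (le_trans t2)// -etar -exprM mulrC ler_wpM2r.
have e30 : 0 <= eta ^+ 3 by rewrite exprn_ge0// ltW.
(* The errors are eta^3 from the second moment, then 2, 84 and 18 times eta^3: together less than
   120 eta^3. *)
rewrite reta; move: t2'; rewrite !ler_norml -ME => /andP[t1 t3].
rewrite EE in MU ML; lra.
Qed.

Lemma TT_ln_step v :
  `|TT l (fun v => ln (Z v)) v - (ln (Z v) - kappa v / 2)| <= 120 * (r * Num.sqrt r).
Proof.
have Z0 v' : 0 < Z v' by exact: Zf_gt0.
have gl : good (fun v => ln (Z v)) by exact: good_lnZf.
have := @TT_step v (fun v' => ln (Z v') - ln (Z v)) (-1).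
rewrite TTB//; last exact: good_cst.
rewrite TT_cst normrN normr1 lexx mulN1r opprK => H.
rewrite (_ : _ - (_ - _) = TT l (fun v => ln (Z v)) v - ln (Z v) + kappa v / 2); last by ring.
apply: H => //; first by apply: goodB => //; exact: good_cst.
move=> v' eta e01 /=; rewrite -ln_div ?posrE// mulN1r.
by apply: ln_quadratic => //; rewrite divr_gt0.
Qed.

(** [Phi] is Z ln Z divided by its present value [Z v], less the multiple of the invariant [Z] that
    turns it into u ln u. The error is therefore relative to [Z v]. *)
Lemma TT_xlnx_step v :
  `|TT l (fun v => Z v * ln (Z v)) v - (Z v * ln (Z v) + Z v * (kappa v / 2))|
    <= 120 * (r * Num.sqrt r) * Z v.
Proof.
have Z0 v' : 0 < Z v' by exact: Zf_gt0.
have gl : good (fun v => ln (Z v)) by exact: good_lnZf.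
pose Phi v' := (Z v)^-1 * (Z v' * ln (Z v')) - ((Z v)^-1 * ln (Z v)) * Z v'.
have gPhi : good Phi by rewrite /Phi; solve_good.
have := @TT_step v Phi 1 gPhi.
rewrite normr1 lexx mul1r /Phi TTB; [|solve_good..].
rewrite !TTZ; [|solve_good..].
rewrite TT_Zf// => H.
rewrite -ler_pdivrMr// -[X in _ / X]gtr0_norm// -normfV -normrM.
rewrite (_ : (_ - (_ + _)) / Z v =
  (Z v)^-1 * TT l (fun v : S -> R => Z v * ln (Z v)) v - (Z v)^-1 * ln (Z v) * Z v - kappa v / 2).
  apply: H => // v' eta e01 /=.
  rewrite mul1r (_ : _ - _ * Z v' = Z v' / Z v * ln (Z v' / Z v)).
    by apply: xlnx_quadratic => //; rewrite divr_gt0.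
  by rewrite ln_div ?posrE//; ring.
by field; rewrite gt_eqF.
Qed.

End one_step.

(** Removes a discretisation error of order N^(-1/2); the threshold [B] leaves room for the
    condition that the steps be small. *)
Lemma le_of_le_sqrt {R : realType} (x y K B : R) : 0 <= K ->
  (forall N : nat, B <= N.+1%:R -> x <= y + K / Num.sqrt N.+1%:R) -> x <= y.
Proof.
move=> K0 H; rewrite leNgt; apply/negP => yx.
pose d := x - y; have d0 : 0 < d by rewrite subr_gt0.
pose C := `|B| + (K / d) ^+ 2.
have [N CN] : exists N : nat, C < N.+1%:R.
  exists (Num.bound C); rewrite (lt_le_trans (archi_boundP _))//.
    by rewrite addr_ge0// sqr_ge0.
  by rewrite ler_nat.
have sN : 0 < Num.sqrt N.+1%:R :> R by rewrite sqrtr_gt0.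
have := H N; have -> : B <= N.+1%:R.
  rewrite ltW// (le_lt_trans _ CN)// (le_trans (ler_norm _))// lerDl sqr_ge0//.
move=> /(_ isT); apply/negP; rewrite -ltNge -ltrBrDl -/d ltr_pdivrMr//.
have : K / d < Num.sqrt N.+1%:R.
  rewrite -(@ger0_norm _ (K / d)) ?divr_ge0 ?(ltW d0)//.
  by rewrite -sqrtr_sqr ltr_sqrt ?ltr0n// (le_lt_trans _ CN)// lerDr.
by rewrite ltr_pdivrMr// mulrC.
Qed.

Section kahane.
Context {R : realType} {S : finType}.
Implicit Types (v : S -> R) (l : seq (S -> R)) (Phi H : (S -> R) -> R).

Lemma iter_TT_comm l l' Phi k v : good Phi ->
  TT l (iter k (TT l') Phi) v = iter k (TT l') (TT l Phi) v.
Proof.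
move=> gP; elim: k v => //= k IH v.
rewrite TT_comm; last exact: good_iter_TT.
by congr TT; apply/funext.
Qed.

Lemma iter_TT_le l Phi1 Phi2 k v : good Phi1 -> good Phi2 ->
  (forall v, Phi1 v <= Phi2 v) -> iter k (TT l) Phi1 v <= iter k (TT l) Phi2 v.
Proof.
move=> g1 g2 le12; elim: k v => //= k IH v.
by apply: TT_le => //; exact: good_iter_TT.
Qed.

Lemma iter_TT_addZ l Phi H e k v : good Phi -> good H ->
  (forall v, TT l H v = H v) ->
  iter k (TT l) (fun v => Phi v + e * H v) v = iter k (TT l) Phi v + e * H v.
Proof.
move=> gP gH TH; elim: k v => //= k IH v.
rewrite (_ : iter k _ _ = fun v => iter k (TT l) Phi v + e * H v); last exact/funext.
rewrite TTD; [|exact: good_iter_TT|exact: goodZ].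
by rewrite TTZ// TH.
Qed.

(** Steps of [la] are exchanged for steps of [lb] one at a time. The operators commute, so the
    one-step comparison can be applied innermost, and the errors accumulate as multiples of [H]
    because both operators fix [H]. This function will be 1 for ln and [Z] for x ln x. *)
Lemma iter_compare la lb Phi H e k v : good Phi -> good H ->
  (forall v, TT la H v = H v) -> (forall v, TT lb H v = H v) ->
  (forall v, TT la Phi v <= TT lb Phi v + e * H v) ->
  iter k (TT la) Phi v <= iter k (TT lb) Phi v + k%:R * e * H v.
Proof.
move=> gP gH Ha Hb step; elim: k v => [|k IH] v; first by rewrite /= mul0r mul0r addr0.
have gk l : good (iter k (TT l) Phi) by exact: good_iter_TT.
rewrite iterS (@le_trans _ _ (TT la (fun v => iter k (TT lb) Phi v + k%:R * e * H v) v))//.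
  by apply: TT_le => //; apply: goodD => //; exact: goodZ.
rewrite TTD//; last exact: goodZ.
rewrite TTZ// Ha iter_TT_comm// -natr1 mulrDl mulrDl mul1r addrA addrAC lerD2r.
rewrite iterSr -(iter_TT_addZ e k v _ gH Hb); last exact: good_TT.
apply: iter_TT_le => //; first exact: good_TT.
by apply: goodD; [exact: good_TT|exact: goodZ].
Qed.

Lemma iter_TT_sqrt l Phi N v : good Phi ->
  iter N.+1 (TT (scale (Num.sqrt N.+1%:R)^-1 l)) Phi v = TT l Phi v.
Proof.
have s0 : 0 < (Num.sqrt N.+1%:R)^-1 :> R by rewrite invr_gt0 sqrtr_gt0.
move=> gP; rewrite iter_TT//.
by rewrite mulVf ?scale1// gt_eqF// sqrtr_gt0.
Qed.

Variable w : S -> R.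
Hypothesis w0 : forall x, 0 <= w x.
Hypothesis wpos : 0 < \sum_x w x.
Local Notation Z := (Zf w).
Variables (la lb : seq (S -> R)) (c : R).
Hypothesis covab : forall x y, cov lb x y <= cov la x y + c.

Let M := 1 + \sum_x \sum_y (`|cov la x y| + `|cov lb x y|).

Let M_ge x y : `|cov la x y| <= M /\ `|cov lb x y| <= M.
Proof.
have : `|cov la x y| + `|cov lb x y| <= M.
  rewrite /M (bigD1 x)//= (bigD1 y)//=.
  set A := `|_| + `|_|; set B := \sum_(i | i != y) _; set C := \sum_(i | i != x) _.
  have B0 : 0 <= B by rewrite sumr_ge0// => i _; rewrite addr_ge0.
  have C0 : 0 <= C by rewrite sumr_ge0// => i _; rewrite sumr_ge0// => j _; rewrite addr_ge0.
  lra.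
have := normr_ge0 (cov la x y); have := normr_ge0 (cov lb x y).
by move=> *; split; lra.
Qed.

Let M0 : 0 < M.
Proof. by rewrite ltr_pwDl// sumr_ge0// => i _; rewrite sumr_ge0// => j _; rewrite addr_ge0. Qed.

Let KM0 : 0 <= 240 * (M * Num.sqrt M).
Proof.
apply: mulr_ge0; first exact: ler0n.
by apply: mulr_ge0; [exact: ltW M0|exact: sqrtr_ge0].
Qed.

Lemma kappa_scale s l v : kappa w (scale s l) v = s ^+ 2 * kappa w l v.
Proof.
rewrite /kappa mulr_sumr; apply: eq_bigr => x _; rewrite mulr_sumr.
by apply: eq_bigr => y _; rewrite cov_scale mulrCA.
Qed.

Let kappa_ab v : kappa w lb v <= kappa w la v + c.
Proof.
rewrite (_ : c = \sum_x \sum_y gibbs w v x * gibbs w v y * c).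
  rewrite -big_split/=; apply: ler_sum => x _; rewrite -big_split/=.
  apply: ler_sum => y _; rewrite -mulrDr ler_wpM2l//.
  by apply: mulr_ge0; exact: gibbs_ge0.
under eq_bigr do rewrite -mulr_suml -mulr_sumr (sum_gibbs w0 wpos) mulr1.
by rewrite -mulr_suml (sum_gibbs w0 wpos) mul1r.
Qed.

Let N_facts (N : nat) : 12 * M <= N.+1%:R -> let s := (Num.sqrt N.+1%:R)^-1 in
  let r := M / N.+1%:R in
  [/\ 0 < r, r <= 12^-1, s ^+ 2 = N.+1%:R^-1,
    (forall x y, `|cov (scale s la) x y| <= r) &
    (forall x y, `|cov (scale s lb) x y| <= r)].
Proof.
move=> MN s r; have s2 : s ^+ 2 = N.+1%:R^-1 by rewrite exprVn sqr_sqrtr.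
have n0 : (0 : R) < N.+1%:R by [].
have cr l x y : `|cov l x y| <= M -> `|cov (scale s l) x y| <= r.
  move=> lM; rewrite cov_scale s2 normrM ger0_norm ?invr_ge0// mulrC.
  by rewrite ler_wpM2r// invr_ge0.
split => //; first by rewrite divr_gt0.
- by rewrite ler_pdivrMr// -ler_pdivrMl ?invr_gt0// invrK.
- by move=> x y; apply: cr; case: (M_ge x y).
- by move=> x y; apply: cr; case: (M_ge x y).
Qed.

(** Each step costs twice 120 r^(3/2), once per field, with r = M / (N + 1); over N + 1 steps this
    decays like N^(-1/2). The slack is c / 2 because [kappa] enters a step with the factor 1/2. *)
Let err_total (N : nat) : let r := M / N.+1%:R in
  N.+1%:R * (c / 2 / N.+1%:R + 240 * (r * Num.sqrt r)) =
  c / 2 + 240 * (M * Num.sqrt M) / Num.sqrt N.+1%:R.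
Proof.
move=> r; rewrite /r sqrtrM ?ltW// sqrtrV//.
by field; rewrite ?gt_eqF ?sqrtr_gt0//= pnatr_eq0.
Qed.

(* Kahane's inequality: a larger covariance lowers the mean of a concave
   function of a normalised exponential sum, up to the slack [c]. *)
Lemma kahane_ln v : TT la (fun v => ln (Z v)) v <= TT lb (fun v => ln (Z v)) v + c / 2.
Proof.
have gl : good (fun v => ln (Z v)) by exact: good_lnZf.
apply: (@le_of_le_sqrt _ _ _ (240 * (M * Num.sqrt M)) (12 * M)).
  exact: KM0.
move=> N MN; have [r0 r12 s2 ca cb] := N_facts MN.
rewrite -addrA -err_total -(iter_TT_sqrt la N v gl) -(iter_TT_sqrt lb N v gl).
rewrite -[X in _ + X]mulr1; apply: (@iter_compare _ _ _ (fun=> 1)) => //.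
- exact: good_cst.
- by move=> u; rewrite TT_cst.
- by move=> u; rewrite TT_cst.
move=> u; have := TT_ln_step w0 wpos r0 r12 ca u; have := TT_ln_step w0 wpos r0 r12 cb u.
rewrite !kappa_scale !s2 !ler_norml => /andP[h1 _] /andP[_ h2].
have : N.+1%:R^-1 * kappa w lb u <= N.+1%:R^-1 * kappa w la u + c / N.+1%:R.
  by rewrite (mulrC c) -mulrDr ler_wpM2l ?invr_ge0.
rewrite mulr1 (mulrAC c) => h3; move: h1 h2 h3.
move: (M / _ * Num.sqrt _) (c / _) (_ * kappa w lb u) (_ * kappa w la u) => A B C D.
by move: (TT _ _ _) (TT _ _ _) (ln _) => E F H h1 h2 h3; lra.
Qed.

(** For the convex function x ln x the inequality is reversed, and slack and errors are measured by
    the invariant [Z]. *)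
Lemma kahane_xlnx v :
  TT lb (fun v => Z v * ln (Z v)) v <= TT la (fun v => Z v * ln (Z v)) v + c / 2 * Z v.
Proof.
have gl : good (fun v => Z v * ln (Z v)) by apply: goodM; [exact: good_Zf|exact: good_lnZf].
have Z0 := Zf_gt0 w0 wpos v.
apply: (@le_of_le_sqrt _ _ _ (240 * (M * Num.sqrt M) * Z v) (12 * M)).
  by apply: mulr_ge0; [exact: KM0|exact: ltW].
move=> N MN; have [r0 r12 s2 ca cb] := N_facts MN.
rewrite [240 * _ * Z v / _]mulrAC -addrA -mulrDl -err_total -(iter_TT_sqrt la N v gl) -(iter_TT_sqrt lb N v gl).
apply: iter_compare => //.
- exact: good_Zf.
- by move=> u; rewrite TT_Zf.
- by move=> u; rewrite TT_Zf.
move=> u; have := TT_xlnx_step w0 wpos r0 r12 ca u; have := TT_xlnx_step w0 wpos r0 r12 cb u.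
rewrite !kappa_scale !s2 !ler_norml => /andP[_ h1] /andP[h2 _].
have : Z u * (N.+1%:R^-1 * kappa w lb u) <= Z u * (N.+1%:R^-1 * kappa w la u + c / N.+1%:R).
  by rewrite ler_wpM2l ?(ltW (Zf_gt0 w0 wpos u))// (mulrC c) -mulrDr ler_wpM2l ?invr_ge0.
rewrite (mulrAC c) => h3; move: h1 h2 h3.
move: (M / _ * Num.sqrt _) (c / _) (_ * kappa w lb u) (_ * kappa w la u) => A B C D.
move: (TT _ _ _) (TT _ _ _) => E F; move: (ln (Z u)) => H.
move: (Z u) => z h1 h2 h3.
have -> : (B / 2 + 240 * A) * z = z * B / 2 + 240 * (z * A) by ring.
move: h1 h2 h3; rewrite mulrDr !(mulrA z _ 2^-1) -!(mulrA 120 A z) (mulrC A z).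
by move: (z * C) (z * B) (z * D) (z * H) (z * A) => *; lra.
Qed.

End kahane.

(** * Convexity of the free energy in the signal-to-noise ratio *)

Section interpolation.
Context {R : realType} {S : finType}.
Variable w : S -> R.
Hypothesis w0 : forall x, 0 <= w x.
Hypothesis wpos : 0 < \sum_x w x.
Variables (l : seq (S -> R)) (v : S -> R).
Local Notation Z := (Zf w).

(** The factor [Z] passes to the planted law: the pure-noise mean of this quantity is the planted,
    unnormalised mean of [kappa]. *)
Definition overlap_energy (u : S -> R) := Z u * kappa w l u.

(* [free_slope] is the derivative of [free_energy]; only the chord inequalities are proved. *)
Definition free_energy (s : R) := TT (scale (Num.sqrt s) l) (fun v => Z v * ln (Z v)) v.

Definition free_slope (s : R) := TT (scale (Num.sqrt s) l) overlap_energy v / 2.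

Let M := 1 + \sum_x \sum_y `|cov l x y|.

Let M_ge x y : `|cov l x y| <= M.
Proof.
rewrite /M (bigD1 x)//= (bigD1 y)//=.
set A := `|_|; set B := \sum_(i | i != y) _; set C := \sum_(i | i != x) _.
have B0 : 0 <= B by rewrite sumr_ge0.
have C0 : 0 <= C by rewrite sumr_ge0// => i _; rewrite sumr_ge0.
lra.
Qed.

Let M0 : 0 < M.
Proof. by rewrite ltr_pwDl// sumr_ge0// => i _; rewrite sumr_ge0. Qed.

Let good_xlnx : good (fun v => Z v * ln (Z v)).
Proof. by apply: goodM; [exact: good_Zf|exact: good_lnZf]. Qed.

Lemma good_kappa : good (kappa w l).
Proof.
apply: good_sum => x; apply: good_sum => y; apply: goodM; last exact: good_cst.
by apply: goodM; exact: good_gibbs.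
Qed.

Lemma good_overlap_energy : good overlap_energy.
Proof. by apply: goodM; [exact: good_Zf|exact: good_kappa]. Qed.

Lemma sqrt_semigroup s d (Psi : (S -> R) -> R) u : 0 <= s -> 0 < d -> good Psi ->
  TT (scale (Num.sqrt s) l) (TT (scale (Num.sqrt d) l) Psi) u =
  TT (scale (Num.sqrt (s + d)) l) Psi u.
Proof.
move=> s0 d0 gP; rewrite TT_semigroup// ?sqrtr_gt0//.
by rewrite !sqr_sqrtr ?(ltW d0)// addrC.
Qed.

(** A step of variance [d] is composed with the field at level [s], and its expansion is integrated
    over that field. The relative error has mean proportional to [Z v] since [Z] is invariant. *)
Lemma free_energy_step s d : 0 <= s -> 0 < d -> d * M <= 12^-1 ->
  `|free_energy (s + d) - free_energy s - d * free_slope s| <= 120 * (d * M * Num.sqrt (d * M)) * Z v.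
Proof.
move=> s0 d0 dM.
have dM0 : 0 < d * M by rewrite mulr_gt0.
have cr x y : `|cov (scale (Num.sqrt d) l) x y| <= d * M.
  rewrite cov_scale sqr_sqrtr ?(ltW d0)// normrM (gtr0_norm d0).
  by rewrite ler_wpM2l// ltW.
have step u := TT_xlnx_step w0 wpos dM0 dM cr u.
pose A u := TT (scale (Num.sqrt d) l) (fun v => Z v * ln (Z v)) u.
pose B u := Z u * ln (Z u) + d / 2 * overlap_energy u.
pose e := 120 * (d * M * Num.sqrt (d * M)).
have gA : good A by exact: good_TT.
have gB : good B.
  by apply: goodD => //; apply: goodZ; exact: good_overlap_energy.
have gZ : good Z by exact: good_Zf.
have stepAB u : `|A u - B u| <= e * Z u.
  have := step u; rewrite kappa_scale sqr_sqrtr ?(ltW d0)//.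
  rewrite (_ : Z u * (d * _ / 2) = d / 2 * overlap_energy u)//.
  by rewrite /overlap_energy; field.
have FA : free_energy (s + d) = TT (scale (Num.sqrt s) l) A v.
  by rewrite /A sqrt_semigroup.
have FB : TT (scale (Num.sqrt s) l) B v = free_energy s + d * free_slope s.
  rewrite TTD//; last by apply: goodZ; exact: good_overlap_energy.
  rewrite TTZ; last exact: good_overlap_energy.
  by rewrite /free_slope; congr (_ + _); field.
have TZ : TT (scale (Num.sqrt s) l) (fun u => e * Z u) v = e * Z v.
  by rewrite TTZ// TT_Zf.
have le1 : TT (scale (Num.sqrt s) l) A v <= TT (scale (Num.sqrt s) l) B v + e * Z v.
  rewrite -TZ -TTD//; last exact: goodZ.
  apply: TT_le => //; first by apply: goodD => //; exact: goodZ.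
  by move=> u; have := stepAB u; rewrite ler_norml => /andP[_]; rewrite lerBlDl.
have le2 : TT (scale (Num.sqrt s) l) B v <= TT (scale (Num.sqrt s) l) A v + e * Z v.
  rewrite -TZ -TTD//; last exact: goodZ.
  apply: TT_le => //; first by apply: goodD => //; exact: goodZ.
  by move=> u; have := stepAB u; rewrite ler_norml => /andP[+ _]; rewrite lerBrDl lerBlDr.
move: le1 le2; rewrite -FA FB -/e; move: (e * Z v) => E h1 h2.
rewrite ler_norml; lra.
Qed.

Lemma overlap_energyE u :
  overlap_energy u = \sum_(a <- l) (\sum_x w x * expR (u x) * a x) ^+ 2 / Z u.
Proof.
rewrite /overlap_energy /kappa /cov.
transitivity (\sum_(a <- l) \sum_x \sum_y
    w x * expR (u x) * (w y * expR (u y)) * (a x * a y) / Z u).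
  rewrite [RHS]exchange_big/= mulr_sumr; apply: eq_bigr => x _.
  rewrite mulr_sumr [RHS]exchange_big/=; apply: eq_bigr => y _.
  rewrite !mulr_sumr; apply: eq_bigr => a _.
  by rewrite /gibbs; field; rewrite gt_eqF// Zf_gt0.
apply: eq_bigr => a _; rewrite expr2 mulr_suml mulr_suml; apply: eq_bigr => x _.
rewrite mulr_sumr mulr_suml; apply: eq_bigr => y _.
by congr (_ / _); ring.
Qed.

Lemma TT_linear l' (a : S -> R) u :
  TT l' (fun u => \sum_x w x * expR (u x) * a x) u = \sum_x w x * expR (u x) * a x.
Proof.
rewrite TT_sum; last first.
  by move=> x; apply: goodM; [apply: goodZ; exact: good_expR|exact: good_cst].
apply: eq_bigr => x _.
rewrite (_ : (fun u => _) = fun u => (w x * a x) * expR (1 * u x)); last first.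
  by apply/funext => u'; rewrite mul1r mulrAC.
rewrite TTZ; last exact: good_expRk.
by rewrite TT_expRk expr1n subrr !mul0r addr0 mul1r mulrAC.
Qed.

(* [x^2 / y] is convex and 1-homogeneous, and [TT] preserves linear functions. *)
Lemma overlap_energy_le l' u : overlap_energy u <= TT l' overlap_energy u.
Proof.
have Z0 u' : 0 < Z u' by exact: Zf_gt0.
pose A a (u : S -> R) := \sum_x w x * expR (u x) * a x.
have gA a : good (A a).
  by apply: good_sum => x; apply: goodM; [apply: goodZ; exact: good_expR|exact: good_cst].
pose t a := A a u / Z u.
pose B u' := \sum_(a <- l) (2 * t a * A a u' - t a ^+ 2 * Z u').
have gZ : good Z by exact: good_Zf.
have gB : good B.
  by apply: good_sum => a; apply: goodB; apply: goodZ.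
apply: (@le_trans _ _ (TT l' B u)); last first.
  apply: TT_le => //; first exact: good_overlap_energy.
  move=> u'; rewrite overlap_energyE; apply: ler_sum => a _.
  rewrite -/(A a u') ler_pdivlMr// -subr_ge0.
  have -> : A a u' ^+ 2 - (2 * t a * A a u' - t a ^+ 2 * Z u') * Z u' =
      (A a u' - t a * Z u') ^+ 2 by ring.
  exact: sqr_ge0.
rewrite TT_sum; last by move=> a; apply: goodB; exact: goodZ.
rewrite overlap_energyE le_eqVlt; apply/orP; left; apply/eqP.
apply: eq_bigr => a _; rewrite TTB; [|exact: goodZ|exact: goodZ].
rewrite !TTZ// TT_Zf// TT_linear -/(A a u) /t.
by field; rewrite gt_eqF.
Qed.

(** Passing from [s] to [t] averages the energy over one more independent field, which can only
    raise it. Together with the chord inequalities this is the convexity of [free_energy]. *)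
Lemma free_slope_nondecreasing s t : 0 <= s -> s <= t -> free_slope s <= free_slope t.
Proof.
move=> s0; rewrite le_eqVlt => /predU1P[->//|st].
rewrite ler_pM2r ?invr_gt0//.
rewrite [leRHS](_ : _ = TT (scale (Num.sqrt s) l) (TT (scale (Num.sqrt (t - s)) l) overlap_energy) v).
  apply: TT_le => //.
  - exact: good_overlap_energy.
  - by apply: good_TT; exact: good_overlap_energy.
  - by move=> u; exact: overlap_energy_le.
rewrite sqrt_semigroup//; first by rewrite subrKC.
- by rewrite subr_gt0.
- exact: good_overlap_energy.
Qed.

Lemma free_slope_ge0 s : 0 <= free_slope s.
Proof.
rewrite divr_ge0//.
apply: (@le_trans _ _ (TT (scale (Num.sqrt s) l) (fun=> 0) v)).
  by rewrite TT_cst.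
apply: TT_le; [exact: good_cst|exact: good_overlap_energy|].
move=> u; rewrite overlap_energyE sumr_ge0// => a _.
by rewrite divr_ge0 ?sqr_ge0// ltW// Zf_gt0.
Qed.

(** The interval is cut into N + 1 steps of length h. By monotonicity each increment lies between h
    times the two extreme slopes, up to O(h^(3/2)), so the total error is O(N^(-1/2)). *)
Lemma free_energy_chord s t : 0 <= s -> s < t ->
  (t - s) * free_slope s <= free_energy t - free_energy s <= (t - s) * free_slope t.
Proof.
move=> s0 st.
pose d := t - s; have d0 : 0 < d by rewrite subr_gt0.
pose K := 120 * (d * M * Num.sqrt (d * M)) * Z v.
have K0 : 0 <= K.
  apply: mulr_ge0; last by rewrite ltW// Zf_gt0.
  apply: mulr_ge0 => //; apply: mulr_ge0; last exact: sqrtr_ge0.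
  by apply: mulr_ge0; exact: ltW.
have H N : 12 * (d * M) <= N.+1%:R ->
    d * free_slope s - K / Num.sqrt N.+1%:R <= free_energy t - free_energy s /\
    free_energy t - free_energy s <= d * free_slope t + K / Num.sqrt N.+1%:R.
  move=> NM; pose h := d / N.+1%:R.
  have n0 : (0 : R) < N.+1%:R by [].
  have h0 : 0 < h by rewrite divr_gt0.
  have hM : h * M <= 12^-1.
    rewrite /h mulrAC ler_pdivrMr// -ler_pdivrMl ?invr_gt0// invrK//.
  pose e := 120 * (h * M * Num.sqrt (h * M)) * Z v.
  have sub k : (k <= N.+1)%N -> s + k%:R * h <= t.
    move=> kN; rewrite -lerBrDl -/d /h mulrCA ler_piMr ?(ltW d0)//.
    by rewrite ler_pdivrMr// mul1r ler_nat.
  have ind k : (k <= N.+1)%N ->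
      k%:R * (h * free_slope s - e) <= free_energy (s + k%:R * h) - free_energy s /\
      free_energy (s + k%:R * h) - free_energy s <= k%:R * (h * free_slope t + e).
    elim: k => [_|k IH kN]; first by rewrite !mul0r addr0 subrr.
    have [IH1 IH2] := IH (ltnW kN).
    have sk0 : 0 <= s + k%:R * h by rewrite addr_ge0// mulr_ge0// ltW.
    have := free_energy_step sk0 h0 hM.
    have -> : s + k%:R * h + h = s + k.+1%:R * h by rewrite -natr1 mulrDl mul1r addrA.
    rewrite -/e ler_norml => /andP[s1 s2].
    have D1 : free_slope s <= free_slope (s + k%:R * h).
      by apply: free_slope_nondecreasing => //; rewrite lerDl mulr_ge0// ltW.
    have D2 : free_slope (s + k%:R * h) <= free_slope t by apply: free_slope_nondecreasing => //; exact: sub (ltnW kN).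
    have hD1 := ler_wpM2l (ltW h0) D1; have hD2 := ler_wpM2l (ltW h0) D2.
    have S1 (x : R) : k.+1%:R * x = k%:R * x + x by rewrite -natr1 mulrDl mul1r.
    rewrite (S1 (h * free_slope s - e)) (S1 (h * free_slope t + e)).
    move: (free_energy (s + k.+1%:R * h)) (k%:R * (h * free_slope s - e)) (k%:R * (h * free_slope t + e)) IH1 IH2 s1 s2 hD1 hD2.
    move: (h * free_slope s) (h * free_slope t) (h * free_slope _) (free_energy _) (free_energy _) => *; split; lra.
  have [] := ind N.+1 (leqnn _).
  have -> : s + N.+1%:R * h = t by rewrite /h mulrC divfK ?subrKC ?gt_eqF.
  have -> : N.+1%:R * (h * free_slope s - e) = d * free_slope s - K / Num.sqrt N.+1%:R.
    rewrite mulrBr mulrA mulrC (mulrC N.+1%:R) divfK ?gt_eqF// mulrC; congr (_ - _).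
    rewrite /e /K /h (mulrAC d) sqrtrM ?mulr_ge0 ?(ltW d0) ?(ltW M0)// sqrtrV//.
    by field; rewrite ?gt_eqF ?sqrtr_gt0//= pnatr_eq0.
  have -> : N.+1%:R * (h * free_slope t + e) = d * free_slope t + K / Num.sqrt N.+1%:R.
    rewrite mulrDr mulrA mulrC (mulrC N.+1%:R) divfK ?gt_eqF// mulrC; congr (_ + _).
    rewrite /e /K /h (mulrAC d) sqrtrM ?mulr_ge0 ?(ltW d0) ?(ltW M0)// sqrtrV//.
    by field; rewrite ?gt_eqF ?sqrtr_gt0//= pnatr_eq0.
  by [].
apply/andP; split; apply: (le_of_le_sqrt K0 (B := 12 * (d * M))) => N NM.
  by have [h1 _] := H N NM; rewrite -lerBlDr.
by have [_ h2] := H N NM.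
Qed.

End interpolation.

(** * Bounds on the free energy *)

Section coordinates.
Context {R : realType} {I : finType}.
Implicit Types (z : I -> R) (f : I -> R -> R).

Definition delta (i : I) : I -> R := fun j => (i == j)%:R.

Lemma linmap_delta {S : finType} (M : I -> S -> R) z t i x :
  linmap M (fun j => z j + t * delta i j) x = linmap M z x + t * M i x.
Proof.
rewrite /linmap; under eq_bigr do rewrite mulrDl.
rewrite big_split/= (bigD1 i)//= [X in _ + X](bigD1 i)//= /delta eqxx mulr1.
rewrite [X in _ + (_ + X)]big1 ?addr0// => j ji.
by rewrite eq_sym (negbTE ji) mulr0 mul0r.
Qed.

(** A field with directions [M i] is a linear image of independent coordinates. Averages are moved
    to the coordinates because products factorise there. *)
Lemma GG_coords {S : finType} (M : I -> S -> R) (s : seq I) Psi (v : S -> R) z :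
  GG [seq M i | i <- s] Psi (fun x => v x + linmap M z x) =
  GG [seq delta i | i <- s] (fun z => Psi (fun x => v x + linmap M z x)) z.
Proof.
elim: s z => //= i s IH z; rewrite /G; congr gE; apply/funext => t.
rewrite -IH; congr GG; apply/funext => x.
by rewrite linmap_delta addrA.
Qed.

Lemma linmap0 {S : finType} (M : I -> S -> R) : linmap M (fun=> 0) = fun=> 0.
Proof. by apply/funext => x; rewrite /linmap big1// => i _; rewrite mul0r. Qed.

Lemma good_coord i (g : R -> R) : tame g -> good (fun z : I -> R => g (z i)).
Proof.
move=> tg; have [A [B [A0 B0 gAB]]] := tame_bound tg; case: tg => mg _; split.
  by move=> d T V mV; exact: (measurableT_comp mg (mV i)).
exists A, B; split => // z; rewrite (le_trans (gAB _))// ler_wpM2l// ler_expR.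
by rewrite ler_wpM2l// (bigD1 i)//= lerDl sumr_ge0.
Qed.

Lemma good_prod_coord f : (forall i, tame (f i)) -> good (fun z => \prod_i f i (z i)).
Proof.
move=> tf; elim: (index_enum I) => [|i r IH].
  rewrite (_ : (fun z => _) = fun=> 1); first exact: good_cst.
  by apply/funext => z; rewrite big_nil.
rewrite (_ : (fun z => _) = fun z => f i (z i) * \prod_(j <- r) f j (z j)).
  by apply: goodM => //; exact: good_coord.
by apply/funext => z; rewrite big_cons.
Qed.

Lemma GG_prod_coord f (s : seq I) z : (forall i, tame (f i)) -> uniq s ->
  GG [seq delta i | i <- s] (fun z => \prod_i f i (z i)) z =
  \prod_i (if i \in s then gE (fun t => f i (z i + t)) else f i (z i)).
Proof.
move=> tf; elim: s z => [|i s IH] z /=.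
  by move=> _; apply: eq_bigr => i _.
move=> /andP[iNs us]; rewrite (bigD1 i)//= in_cons eqxx/=.
rewrite /G (_ : (fun t => _) = fun t => \prod_(j | j != i)
   (if j \in s then gE (fun t => f j (z j + t)) else f j (z j)) * f i (z i + t)).
  rewrite gEZ; last first.
    by rewrite (_ : (fun t => _) = fun t => f i (t + z i));
      [exact: tame_shift|apply/funext => t; rewrite addrC].
  rewrite mulrC; congr (_ * _); apply: eq_bigr => j ji.
  by rewrite in_cons (negbTE ji).
apply/funext => t; rewrite IH// (bigD1 i)//= (negbTE iNs) /delta eqxx mulr1 mulrC.
congr (_ * _); apply: eq_bigr => j ji.
by rewrite eq_sym (negbTE ji) mulr0 addr0.
Qed.

Lemma GG_prod_coord0 f : (forall i, tame (f i)) ->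
  GG [seq delta i | i <- enum I] (fun z => \prod_i f i (z i)) (fun=> 0) =
  \prod_i gE (f i).
Proof.
move=> tf; rewrite GG_prod_coord ?enum_uniq//; apply: eq_bigr => i _.
by rewrite mem_enum; congr gE; apply/funext => t; rewrite add0r.
Qed.

End coordinates.

(** * The scalar Bernoulli channel *)

Section bernoulli_weights.
Context {R : realType}.
Variable eps : R.
Hypothesis eps01 : 0 < eps <= 1.

Definition bern (b : bool) : R := if b then eps else 1 - eps.

Lemma bern_ge0 b : 0 <= bern b.
Proof. by move: eps01 => /andP[? ?]; rewrite /bern; case: b; lra. Qed.

Lemma sum_bern : \sum_b bern b = 1.
Proof. by rewrite big_bool /bern/=; ring. Qed.

Lemma sum_bern_gt0 : 0 < \sum_b bern b. Proof. by rewrite sum_bern. Qed.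

Definition bit : bool -> R := fun b => b%:R.

(** The scalar analogue of the null mean of Z ln Z, with the single direction [bit] on a two-point
    space. Being a [free_energy], it inherits the chord inequalities. *)
Definition psi (h : R) := free_energy bern [:: bit] (fun=> 0) h.

(* Likelihood ratio of the scalar channel at signal-to-noise ratio h. *)
Definition zeta (h t : R) := 1 - eps + eps * expR (Num.sqrt h * t - h / 2).

Lemma zeta_gt0 h t : 0 < zeta h t.
Proof.
move: eps01 => /andP[e0 e1]; rewrite /zeta ltr_wpDl ?subr_ge0//.
by rewrite mulr_gt0// expR_gt0.
Qed.

Lemma zetaE h t : 0 <= h ->
  Zf bern (fun b => nrm (scale (Num.sqrt h) [:: bit]) (fun=> 0) b
                    + t * (Num.sqrt h * bit b)) = zeta h t.
Proof.
move=> h0; rewrite /Zf big_bool /nrm !cov_scale sqr_sqrtr// /cov !big_seq1 /bit/=.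
rewrite /zeta !(mulr0, mul0r) subrr addr0 expR0 mulr1 addrC; congr (_ + _ * expR _).
by field.
Qed.

Lemma good_tame_zeta h (Psi : R -> R) : 0 <= h ->
  good (fun v => Psi (Zf bern v)) -> tame (fun t => Psi (zeta h t)).
Proof.
move=> h0 gP; under eq_fun do rewrite -zetaE//.
exact: (good_tame _ (fun b => Num.sqrt h * bit b) gP).
Qed.

Lemma tame_zeta h : 0 <= h -> tame (zeta h).
Proof. by move=> h0; apply: (good_tame_zeta (Psi := id)) => //; exact: good_Zf. Qed.

Lemma tame_xln_zeta h : 0 <= h -> tame (fun t => zeta h t * ln (zeta h t)).
Proof.
move=> h0; apply: (good_tame_zeta (Psi := fun y => y * ln y)) => //.
by apply: goodM; [exact: good_Zf|apply: good_lnZf; [exact: bern_ge0|exact: sum_bern_gt0]].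
Qed.

Lemma gE_zeta h : 0 <= h -> gE (zeta h) = 1.
Proof.
move=> h0; have := TT_Zf bern (scale (Num.sqrt h) [:: bit]) (fun=> 0).
rewrite {2}/Zf; under [X in _ = X -> _]eq_bigr do rewrite expR0 mulr1.
rewrite sum_bern /TT /= /G => <-; congr gE; apply/funext => t.
by rewrite -zetaE.
Qed.

Lemma psiE h : 0 <= h -> psi h = gE (fun t => zeta h t * ln (zeta h t)).
Proof.
by move=> h0; rewrite /psi /free_energy /TT /= /G; congr gE; apply/funext => t; rewrite zetaE.
Qed.

End bernoulli_weights.

(** * Prior, overlaps and edge directions *)

Section wigner.
Context {R : realType}.
Variables (eps : R) (n : nat).
Hypothesis eps01 : 0 < eps <= 1.
Local Notation spin := {ffun 'I_n -> bool}.
Implicit Types (x y : spin).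

Definition prior x : R := \prod_i bern eps (x i).

Lemma prior_ge0 x : 0 <= prior x.
Proof. by apply: prodr_ge0 => i _; exact: bern_ge0. Qed.

Lemma sum_prod_spin (F : 'I_n -> bool -> R) :
  \sum_(x : spin) \prod_i F i (x i) = \prod_i \sum_b F i b.
Proof. by rewrite bigA_distr_bigA. Qed.

Lemma sum_prior : \sum_x prior x = 1.
Proof.
by rewrite (sum_prod_spin (fun=> bern eps)) big1// => i _; exact: sum_bern.
Qed.

Lemma sum_prior_gt0 : 0 < \sum_x prior x. Proof. by rewrite sum_prior. Qed.

Definition overlap x y : R := \sum_i (x i)%:R * (y i)%:R.

Lemma overlap_ge0 x y : 0 <= overlap x y.
Proof. by apply: sumr_ge0 => i _; rewrite mulr_ge0. Qed.

Lemma overlap_le x y : overlap x y <= n%:R.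
Proof.
rewrite -[leRHS](_ : \sum_(i < n) (1 : R) = _); last by rewrite sumr_const card_ord.
by apply: ler_sum => i _; case: (x i); case: (y i); rewrite ?mul0r ?mulr0 ?mulr1.
Qed.

Lemma overlapC x y : overlap x y = overlap y x.
Proof. by apply: eq_bigr => i _; rewrite mulrC. Qed.

Definition edge_dir (e : edge n) x : R :=
  (x (val e).1)%:R * (x (val e).2)%:R / Num.sqrt n%:R.

Definition edge_dirs : seq (spin -> R) := [seq edge_dir e | e <- enum {: edge n}].

Lemma sum_edge (f : 'I_n -> R) :
  \sum_(e : edge n) f (val e).1 * f (val e).2 =
  ((\sum_i f i) ^+ 2 - \sum_i f i ^+ 2) / 2.
Proof.
have -> : \sum_(e : edge n) f (val e).1 * f (val e).2 =
    \sum_(i < n) \sum_(j < n | (i < j)%N) f i * f j.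
  rewrite pair_big_dep/= (@reindex_omap _ _ _ _ (edge n) (fun e => val e) insub)/=; last first.
    by move=> p ltp; rewrite insubT.
  apply: eq_bigl => e; rewrite valK eqxx andbT; symmetry.
  exact: (valP e).
have H : \sum_(i < n) \sum_(j < n | (j < i)%N) f i * f j = \sum_(i < n) \sum_(j < n | (i < j)%N) f i * f j.
  rewrite (exchange_big_dep predT)//=; apply: eq_bigr => i _.
  by apply: eq_bigr => j _; rewrite mulrC.
have -> : (\sum_i f i) ^+ 2 = \sum_i f i ^+ 2 +
    (\sum_(i < n) \sum_(j < n | (i < j)%N) f i * f j + \sum_(i < n) \sum_(j < n | (j < i)%N) f i * f j).
  rewrite -!big_split/= expr2 mulr_suml; apply: eq_bigr => i _.
  rewrite mulr_sumr (bigD1 i)//= -expr2; congr (_ + _).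
  rewrite (bigID (fun j : 'I_n => (i < j)%N))/=; congr (_ + _).
    by apply: eq_bigl => j; rewrite -val_eqE/= neq_ltn; case: ltngtP.
  by apply: eq_bigl => j; rewrite -val_eqE/= neq_ltn; case: ltngtP.
by rewrite H; field.
Qed.

End wigner.

Section wigner_bounds.
Context {R : realType}.
Variables (eps : R) (n : nat).
Hypothesis eps01 : 0 < eps <= 1.
Hypothesis n0 : (0 < n)%N.
Local Notation spin := {ffun 'I_n -> bool}.
Local Notation dirs := (@edge_dirs R n).
Local Notation pX := (@prior R eps n).
Implicit Types (x y : spin).

Let nR : (0 : R) < n%:R. Proof. by rewrite ltr0n. Qed.

Lemma bit_sqr (b : bool) : (b%:R : R) ^+ 2 = b%:R.
Proof. by case: b; rewrite ?expr0n ?expr1n. Qed.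

(** The squared overlap counts each pair i < j twice and the diagonal once; bits being idempotent,
    the diagonal is the overlap itself. *)
Lemma cov_edge_dirs x y :
  cov dirs x y = (overlap x y ^+ 2 - overlap x y) / (2 * n%:R).
Proof.
rewrite /cov /edge_dirs big_map big_enum/=.
pose f i : R := (x i)%:R * (y i)%:R.
have -> : overlap x y = \sum_i f i ^+ 2.
  by apply: eq_bigr => i _; rewrite exprMn !bit_sqr.
have -> : (\sum_i f i ^+ 2) ^+ 2 = (\sum_i f i) ^+ 2.
  by congr (_ ^+ 2); apply: eq_bigr => i _; rewrite exprMn !bit_sqr.
rewrite invfM mulrA -sum_edge mulr_suml; apply: eq_bigr => e _.
have sn : Num.sqrt n%:R ^+ 2 = n%:R :> R by rewrite sqr_sqrtr// ltW.
have sn0 : Num.sqrt n%:R != 0 :> R by rewrite gt_eqF// sqrtr_gt0.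
rewrite /edge_dir /f; move: (Num.sqrt n%:R) sn sn0 => s <- s0; by field.
Qed.

(* The null mean of Z ln Z, i.e. the mean of ln Z under the planted law. *)
Definition F_n (lambda : R) := free_energy pX dirs (fun=> 0) lambda.
Definition D_n (lambda : R) := free_slope pX dirs (fun=> 0) lambda.

Definition side_dir (h : R) (i : 'I_n) x : R := Num.sqrt h * (x i)%:R.
Definition side_dirs (h : R) := [seq side_dir h i | i <- enum 'I_n].

Lemma cov_side_dirs h x y : 0 <= h -> cov (side_dirs h) x y = h * overlap x y.
Proof.
move=> h0; rewrite /cov big_map big_enum/= mulr_sumr; apply: eq_bigr => i _.
by rewrite /side_dir mulrACA -expr2 sqr_sqrtr.
Qed.

(** The identity x_i^2 = x_i makes the normalising term linear in the bits, so weights and exponent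
    both factorise over the sites. *)
Lemma Zf_side h (z : 'I_n -> R) : 0 <= h ->
  Zf pX (fun x => nrm (side_dirs h) (fun=> 0) x + linmap (side_dir h) z x) =
  \prod_i zeta eps h (z i).
Proof.
move=> h0; rewrite /Zf.
transitivity (\sum_(x : spin) \prod_i
    (bern eps (x i) * expR ((Num.sqrt h * z i - h / 2) * (x i)%:R))).
  apply: eq_bigr => x _; rewrite big_split/= -expR_sum; congr (_ * expR _).
  rewrite /nrm cov_side_dirs// /overlap /linmap mulr_sumr mulr_suml sub0r -sumrN.
  rewrite -big_split/=; apply: eq_bigr => i _.
  by rewrite /side_dir -expr2 bit_sqr; field.
rewrite (sum_prod_spin (fun i b => bern eps b * expR ((Num.sqrt h * z i - h / 2) * b%:R))).
apply: eq_bigr => i _; rewrite big_bool/= mulr1 mulr0 expR0 mulr1.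
by rewrite /zeta addrC.
Qed.

Lemma ln_prod (I : finType) (f : I -> R) : (forall i, 0 < f i) ->
  ln (\prod_i f i) = \sum_i ln (f i).
Proof.
move=> f0; elim: (index_enum I) => [|i r IH]; first by rewrite !big_nil ln1.
rewrite !big_cons lnM ?IH// posrE//.
by elim: (r) => [|j s IHs]; rewrite ?big_nil ?big_cons ?mulr_gt0.
Qed.

(** The ln of the product is a sum over sites. In the term of site j the other factors are
    likelihood ratios and integrate to 1. *)
Lemma TT_side h : 0 <= h ->
  TT (side_dirs h) (fun v => Zf pX v * ln (Zf pX v)) (fun=> 0) = n%:R * psi eps h.
Proof.
move=> h0; rewrite /TT /side_dirs.
rewrite -[X in GG _ _ X](_ : (fun x => nrm (side_dirs h) (fun=> 0) x
    + linmap (side_dir h) (fun=> 0) x) = _); last first.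
  by apply/funext => x; rewrite linmap0 addr0.
rewrite (GG_coords (side_dir h) (enum 'I_n) (fun v => Zf pX v * ln (Zf pX v))).
pose F (j i : 'I_n) t := if i == j then zeta eps h t * ln (zeta eps h t) else zeta eps h t.
have tF j i : tame (F j i).
  rewrite /F; case: (i == j); [exact: tame_xln_zeta|exact: tame_zeta].
rewrite (_ : (fun z => _) = fun z => \sum_j \prod_i F j i (z i)); last first.
  apply/funext => z; rewrite Zf_side// ln_prod; last by move=> i; exact: zeta_gt0.
  rewrite mulr_sumr; apply: eq_bigr => j _.
  rewrite (bigD1 j)//= [RHS](bigD1 j)//= {1}/F eqxx mulrAC; congr (_ * _).
  by apply: eq_bigr => i ij; rewrite /F (negbTE ij).
rewrite GG_sum; last by move=> j; exact: good_prod_coord.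
rewrite (eq_bigr (fun=> psi eps h)).
  by rewrite sumr_const card_ord mulr_natl.
move=> j _; rewrite GG_prod_coord0// (bigD1 j)//= {1}/F eqxx -psiE//.
by rewrite big1 ?mulr1// => i ij; rewrite /F (negbTE ij) gE_zeta.
Qed.

Lemma Zf_prior0 : Zf pX (fun=> 0) = 1.
Proof.
by rewrite /Zf; under eq_bigr do rewrite expR0 mulr1; exact: sum_prior.
Qed.

Lemma F_n_lower lambda q : 0 <= lambda -> 0 <= q ->
  n%:R * psi eps (lambda * q) <=
  F_n lambda + n%:R * (lambda * q ^+ 2 / 4) + lambda / 4.
Proof.
move=> l0 q0; have lq0 : 0 <= lambda * q by rewrite mulr_ge0.
(* The first term completes N^2 - 2 n q N to a square; lambda / 2 turns the diagonal contribution -N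
   into n - N >= 0. *)
pose c := n%:R * lambda * q ^+ 2 / 2 + lambda / 2.
have H x y : cov (side_dirs (lambda * q)) x y <=
    cov (scale (Num.sqrt lambda) dirs) x y + c.
  rewrite cov_side_dirs// cov_scale sqr_sqrtr// cov_edge_dirs.
  have := @overlap_le R n x y; have := @overlap_ge0 R n x y.
  move: (overlap x y) => N N0 Nn; rewrite -subr_ge0.
  have -> : lambda * ((N ^+ 2 - N) / (2 * n%:R)) + c - lambda * q * N =
      lambda / (2 * n%:R) * ((N - n%:R * q) ^+ 2 + (n%:R - N)).
    by rewrite /c; field; rewrite gt_eqF.
  apply: mulr_ge0; first by rewrite divr_ge0// mulr_ge0// ltW.
  by apply: addr_ge0; [exact: sqr_ge0|rewrite subr_ge0].
have := kahane_xlnx (prior_ge0 eps01) (sum_prior_gt0 eps n) H (fun=> 0).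
rewrite TT_side// Zf_prior0 mulr1 -/(F_n lambda) => h.
rewrite (le_trans h)// -addrA lerD2l /c le_eqVlt; apply/orP; left; apply/eqP.
by field.
Qed.

End wigner_bounds.

Section jensen_field.
Context {R : realType} {S : finType}.
Variable w : S -> R.
Hypothesis w0 : forall x, 0 <= w x.
Hypothesis wpos : 0 < \sum_x w x.
Local Notation Z := (Zf w).

Lemma tame_id : tame (fun z : R => z).
Proof.
split; first exact: measurable_id.
exists 1, 1 => z; rewrite !mul1r (le_trans _ (expR_ge1Dx _))// lerDr//.
Qed.

(** From 1 + c z <= exp(c z) and the Gaussian moment, c E <= c^2 for small c of either sign; a c
    small against |E| then rules out a nonzero mean. *)
Lemma gE_id : gE (fun z : R => z) = 0.
Proof.
set E := gE _.
have H c : `|c| <= 2^-1 -> c * E <= c ^+ 2.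
  move=> c1; have c2 : c ^+ 2 <= 4^-1.
    rewrite -real_normK ?num_real// (_ : 4^-1 = 2^-1 ^+ 2 :> R); last by field.
    by rewrite ler_pXn2r// nnegrE.
  have tc : tame (fun z : R => c * z) by exact: (tame_scale c tame_id).
  have te : tame (fun z : R => expR (c * z)).
    by have := tame_expR c 0; under eq_fun do rewrite addr0.
  have tc1 : tame (fun z : R => 1 + c * z).
    have := tame_shift (c^-1) tc; have [->|c0 h] := eqVneq c 0.
      move=> _; split; first by apply: measurable_funD => //; exact: measurable_funM.
      by exists 1, 0 => z; rewrite !mul0r addr0 normr1 expR0 mul1r.
    by rewrite (_ : (fun z => 1 + c * z) = (fun z => c * (z + c^-1)))//;
      apply/funext => z; rewrite mulrDr divff// addrC.
  have : 1 + c * E <= expR (c ^+ 2 / 2).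
    have -> : 1 + c * E = gE (fun z => 1 + c * z).
      rewrite /E -gEZ; last exact: tame_id.
      rewrite (gED (f := fun=> 1)) ?gE_cst//.
      by split; [exact: measurable_cst|exists 1, 0 => z; rewrite mul0r expR0 mul1r normr1].
    rewrite -gE_expR; apply: gE_le => // z; exact: expR_ge1Dx.
  have : expR (c ^+ 2 / 2) <= 1 + c ^+ 2 / 2 + 2 * (c ^+ 2 / 2) ^+ 2.
    by apply: expR_le_quadratic; lra.
  have := sqr_ge0 c; nra.
apply/eqP; rewrite -normr_le0 leNgt; apply/negP => E0.
pose m := Num.min (`|E| / 2) 2^-1.
have m0 : 0 < m by rewrite lt_min; apply/andP; split; [rewrite divr_gt0|].
have mE : m <= `|E| / 2 by rewrite ge_min lexx.
have m2 : m <= 2^-1 by rewrite ge_min lexx orbT.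
have : m * `|E| <= m ^+ 2.
  have [E1|E1] := leP 0 E.
    by rewrite (ger0_norm E1); apply: H; rewrite gtr0_norm.
  by rewrite (ltr0_norm E1) mulrN -mulNr -sqrrN; apply: H; rewrite normrN gtr0_norm.
by rewrite expr2 ler_pM2l//; lra.
Qed.

(** Supporting line of the convex function t -> ln Z(u + t a), whose slope at 0 is the Gibbs mean of
    [a]; it reduces to 1 + y <= exp y under the Gibbs measure. *)
Lemma lnZf_affine u a (t : R) :
  ln (Z u) + t * (\sum_x gibbs w u x * a x) <= ln (Z (fun x => u x + t * a x)).
Proof.
have Z0 v : 0 < Z v by exact: Zf_gt0.
set c := t * _.
rewrite -[c]expRK -lnM ?posrE ?expR_gt0// ler_ln ?posrE ?mulr_gt0 ?expR_gt0//.
rewrite -ler_pdivlMl// mulrC (Zf_gibbs w u).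
rewrite -[leLHS]mulr1 -ler_pdivlMl ?expR_gt0// -expRN mulr_sumr.
rewrite (@le_trans _ _ (\sum_x gibbs w u x * (1 + (t * a x - c))))//.
  rewrite le_eqVlt; apply/orP; left; apply/eqP.
  under eq_bigr do rewrite mulrDr mulr1 mulrBr.
  rewrite big_split/= (sum_gibbs w0 wpos) sumrB -mulr_suml (sum_gibbs w0 wpos) mul1r.
  by under eq_bigr do rewrite mulrCA; rewrite -mulr_sumr subrr addr0.
apply: ler_sum => x _; rewrite mulrCA -expRD ler_wpM2l ?gibbs_ge0//.
by rewrite (le_trans (expR_ge1Dx _))// ler_expR addrAC subrr add0r addrC.
Qed.

(** The supporting line has mean ln Z(u) because z is centred. The term a^2 / 2 undoes the
    normalisation built into [TT]. *)
Lemma lnZf_le_TT a u :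
  ln (Z u) <= TT [:: a] (fun v => ln (Z v)) (fun x => u x + a x ^+ 2 / 2).
Proof.
rewrite /TT /= /G.
rewrite (_ : (fun z => _) = fun z => ln (Z (fun x => u x + z * a x))); last first.
  apply/funext => z; congr (ln (Z _)); apply/funext => x.
  by rewrite /nrm /cov big_seq1 -expr2 addrK.
set m := \sum_x gibbs w u x * a x.
have tm : tame (fun z : R => m * z) by exact: (tame_scale m tame_id).
have tm1 : tame (fun z : R => ln (Z u) + z * m).
  split; first by apply: measurable_funD => //; exact: measurable_funM.
  exists (`|ln (Z u)| + `|m|), 1 => z; rewrite (le_trans (ler_normD _ _))//.
  rewrite mulrDl lerD//.
    by rewrite -[leLHS]mulr1 ler_wpM2l// mul1r -[leLHS]expR0 ler_expR.
  rewrite normrM mulrC ler_wpM2l// mul1r (le_trans _ (expR_ge1Dx _))// lerDr//.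
have -> : ln (Z u) = gE (fun z => ln (Z u) + z * m).
  under eq_fun do rewrite mulrC.
  rewrite (gED (f := fun=> ln (Z u))) ?gE_cst//.
    by rewrite gEZ ?gE_id ?mulr0 ?addr0//; exact: tame_id.
  split; first exact: measurable_cst.
  by exists `|ln (Z u)|, 0 => z; rewrite mul0r expR0 mulr1.
apply: gE_le => //; last by move=> z; exact: lnZf_affine.
exact: (@good_tame _ _ (fun v => ln (Z v)) u a (good_lnZf w0 wpos)).
Qed.

Lemma lnZf_mono u v : (forall x, u x <= v x) -> ln (Z u) <= ln (Z v).
Proof.
move=> uv; rewrite ler_ln ?posrE ?Zf_gt0//; apply: ler_sum => x _.
by rewrite ler_wpM2l// ler_expR.
Qed.

Lemma TT_lnZf_mono l u v : (forall x, u x <= v x) ->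
  TT l (fun v => ln (Z v)) u <= TT l (fun v => ln (Z v)) v.
Proof.
move=> uv; have gl : good (fun v => ln (Z v)) by exact: good_lnZf.
pose b x := v x - u x.
have -> : v = fun x => u x + b x by apply/funext => x; rewrite subrKC.
rewrite -TT_translate; apply: TT_le => //; first exact: (good_translate b gl).
by move=> v'; apply: lnZf_mono => x; rewrite lerDl subr_ge0.
Qed.

End jensen_field.

Section scalar_channel.
Context {R : realType}.
Variable eps : R.
Hypothesis eps01 : 0 < eps <= 1.

Lemma tame_le (f g : R -> R) : measurable_fun [set: R] f -> tame g ->
  (forall t, `|f t| <= g t) -> tame f.
Proof.
move=> mf [_ [A [B gAB]]] fg; split => //; exists A, B => t.
by rewrite (le_trans (fg t))// (le_trans (ler_norm _)).
Qed.

Lemma tame_cst (c : R) : tame (fun=> c).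
Proof.
split; first exact: measurable_cst.
by exists `|c|, 0 => z; rewrite mul0r expR0 mulr1.
Qed.

Lemma tameZ c (f : R -> R) : tame f -> tame (fun t => c * f t).
Proof.
move=> [mf [A [B fAB]]]; split; first exact: measurable_funM.
by exists (`|c| * A), B => t; rewrite normrM -[leRHS]mulrA ler_wpM2l.
Qed.

Lemma tameD (f g : R -> R) : tame f -> tame g -> tame (fun t => f t + g t).
Proof.
move=> tf tg; have [A [B [A0 B0 fAB]]] := tame_bound tf.
have [A' [B' [A0' B0' gAB]]] := tame_bound tg.
case: tf tg => [mf _] [mg _]; split; first exact: measurable_funD.
exists (A + A'), (B + B') => t; rewrite (le_trans (ler_normD _ _))// mulrDl lerD//.
  by rewrite (le_trans (fAB t))// ler_wpM2l// ler_expR ler_wpM2r// lerDl.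
by rewrite (le_trans (gAB t))// ler_wpM2l// ler_expR ler_wpM2r// lerDr.
Qed.

Lemma tame_expR_norm (c d : R) : tame (fun t : R => expR (c * `|t| + d)).
Proof.
split; last first.
  by exists (expR d), c => t; rewrite ger0_norm ?expR_ge0// expRD mulrC.
apply: measurableT_comp => //; apply: measurable_funD => //.
by apply: measurable_funM => //; exact: measurableT_comp.
Qed.

(* Likelihood ratio of the scalar channel when the signal is [b]. *)
Definition zeta_at (b : bool) (h t : R) := zeta eps h (t + Num.sqrt h * b%:R).

Lemma tame_ln_zeta h : 0 <= h -> tame (fun t => ln (zeta eps h t)).
Proof.
move=> h0; apply: (good_tame_zeta (Psi := fun y => ln y)) => //.
by apply: good_lnZf; [exact: bern_ge0|exact: sum_bern_gt0].
Qed.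

Lemma tame_ln_zeta_at b h : 0 <= h -> tame (fun t => ln (zeta_at b h t)).
Proof. by move=> h0; apply: (tame_shift _ (tame_ln_zeta h0)). Qed.

(** The outer factor [zeta] is split into its two terms; by Cameron-Martin the exponential one
    shifts the noise by the signal 1. *)
Lemma psi_planted h : 0 <= h ->
  psi eps h = \sum_b bern eps b * gE (fun t => ln (zeta_at b h t)).
Proof.
move=> h0; rewrite psiE// big_bool/= addrC.
have tl := tame_ln_zeta h0.
have -> : (fun t => ln (zeta_at true h t)) = fun t => ln (zeta eps h (t + Num.sqrt h)).
  by apply/funext => t; rewrite /zeta_at mulr1.
have -> : (fun t => ln (zeta_at false h t)) = fun t => ln (zeta eps h t).
  by apply/funext => t; rewrite /zeta_at mulr0 addr0.
rewrite (gE_shift (Num.sqrt h) tl) -!gEZ//; last exact: tame_tilt.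
rewrite -gED; [|exact: tameZ|by apply: tameZ; exact: tame_tilt].
congr gE; apply/funext => t; rewrite sqr_sqrtr// /zeta; by ring.
Qed.

(** A mixture of 1 and exp y lies between exp(-|y|) and exp |y|. *)
Lemma ln_mix_bound (y : R) : `|ln (1 - eps + eps * expR y)| <= `|y|.
Proof.
move: eps01 => /andP[e0 e1].
have p0 : 0 < 1 - eps + eps * expR y.
  by rewrite ltr_wpDl ?subr_ge0// mulr_gt0// expR_gt0.
have e1' : expR (- `|y|) <= 1 by rewrite -expR0 ler_expR oppr_le0.
have e2' : 1 <= expR `|y| by rewrite -[leLHS]expR0 ler_expR.
have e3' : expR (- `|y|) <= expR y by rewrite ler_expR lerNnormlW.
have e4' : expR y <= expR `|y| by rewrite ler_expR ler_norm.
rewrite ler_norml; apply/andP; split.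
  rewrite -[leLHS]expRK ler_ln ?posrE ?expR_gt0//; nra.
rewrite -[leRHS]expRK ler_ln ?posrE ?expR_gt0//; nra.
Qed.

Lemma ln_zeta_at_bound b h t : 0 <= h ->
  `|ln (zeta_at b h t)| <= Num.sqrt h * `|t| + h / 2.
Proof.
move=> h0; rewrite (le_trans (ln_mix_bound _))//.
rewrite mulrDr mulrA -expr2 sqr_sqrtr// -addrA (le_trans (ler_normD _ _))//.
rewrite normrM (@ger0_norm _ (Num.sqrt h)) ?sqrtr_ge0// lerD2l.
by case: b; rewrite /= ?mulr1 ?mulr0 ?add0r ?normrN ger0_norm ?divr_ge0//; lra.
Qed.

Lemma tame_norm_id : tame (fun t : R => `|t|).
Proof. exact: (tame_norm (@tame_id R)). Qed.

Definition psi_bound lambda : R := Num.sqrt lambda * gE (fun t => `|t|) + lambda / 2.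

Lemma psi_le_bound lambda h : 0 <= h -> h <= lambda -> `|psi eps h| <= psi_bound lambda.
Proof.
move=> h0 hl.
have tg : tame (fun t : R => Num.sqrt lambda * `|t| + lambda / 2).
  by apply: tameD; [apply: tameZ; exact: tame_norm_id|exact: tame_cst].
have Eg : gE (fun t : R => Num.sqrt lambda * `|t| + lambda / 2) = psi_bound lambda.
  rewrite gED; [|by apply: tameZ; exact: tame_norm_id|exact: tame_cst].
  by rewrite gE_cst gEZ//; exact: tame_norm_id.
rewrite psi_planted// (le_trans (ler_norm_sum _ _ _))//.
rewrite (@le_trans _ _ (\sum_b bern eps b * psi_bound lambda))//; last first.
  by rewrite -mulr_suml sum_bern mul1r.
apply: ler_sum => b _; rewrite normrM ger0_norm ?bern_ge0// ler_wpM2l ?bern_ge0//.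
have tl := tame_ln_zeta_at b h0.
rewrite (le_trans (gE_norm tl))// -Eg; apply: gE_le => //; first exact: tame_norm.
move=> t; rewrite (le_trans (ln_zeta_at_bound b t h0))//.
by rewrite lerD ?ler_wpM2r ?invr_ge0// ler_wsqrtr.
Qed.

(** For y <= 1/2 this is the quadratic bound; beyond, 4 y^2 >= 1 lets the last term dominate
    alone. *)
Lemma expR_le_quadratic_norm (y : R) : expR y <= 1 + y + 4 * y ^+ 2 * expR `|y|.
Proof.
have y2 := sqr_ge0 y; have e1 : 1 <= expR `|y| by rewrite -[leLHS]expR0 ler_expR.
have [h|h] := leP y 2^-1.
  have := expR_le_quadratic h.
  have : y ^+ 2 <= y ^+ 2 * expR `|y| by rewrite ler_peMr.
  nra.
have y0 : 0 < y by rewrite (lt_trans _ h).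
rewrite (gtr0_norm y0) in e1 *.
have y4 : 1 <= 4 * y ^+ 2 by nra.
have : expR y <= 4 * y ^+ 2 * expR y by rewrite ler_peMl ?expR_ge0.
lra.
Qed.

(** The 4 is that of the preceding bound on exp. The rate 3 adds v^2 <= exp(2 |v|) to exp |theta v|
    with theta <= 1. Since h <= lambda is all that enters, the bound is uniform over the scalar
    channels. *)
Definition moment_bound lambda : R :=
  4 * gE (fun t => expR (3 * Num.sqrt lambda * `|t| + 3 * (lambda / 2 + psi_bound lambda))).

Lemma moment_bound_ge0 lambda : 0 <= moment_bound lambda.
Proof. by rewrite mulr_ge0// gE_ge0// => t; exact: expR_ge0. Qed.

Definition centered b h theta t := expR (theta * (ln (zeta_at b h t) - psi eps h)).

Lemma tame_centered b h theta : 0 <= h -> 0 < theta <= 1 -> tame (centered b h theta).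
Proof.
move=> h0 /andP[t0 t1].
apply: (tame_le (g := fun t => expR (Num.sqrt h * `|t| + (h / 2 + `|psi eps h|)))).
- case: (tame_ln_zeta_at b h0) => ml _.
  apply: measurableT_comp => //; apply: measurable_funM => //.
  by apply: measurable_funB.
- exact: tame_expR_norm.
- move=> t; rewrite ger0_norm ?expR_ge0// ler_expR (le_trans (ler_norm _))//.
  rewrite normrM (gtr0_norm t0) (le_trans (ler_piMl _ t1))// (le_trans (ler_normB _ _))//.
  by rewrite addrA lerD2r ln_zeta_at_bound.
Qed.

(** The term linear in theta vanishes because [psi] is the planted mean of the scalar
    log-likelihood. *)
Lemma moment_centered lambda h theta : 0 <= h -> h <= lambda -> 0 < theta <= 1 ->
  \sum_b bern eps b * gE (centered b h theta) <= 1 + theta ^+ 2 * moment_bound lambda.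
Proof.
move=> h0 hl th; have /andP[t0 t1] := th.
pose K (t : R) : R := expR (3 * Num.sqrt lambda * `|t| + 3 * (lambda / 2 + psi_bound lambda)).
have tK : tame K by exact: tame_expR_norm.
have tv b : tame (fun t => ln (zeta_at b h t) - psi eps h).
  by apply: tameD; [exact: tame_ln_zeta_at|exact: tame_cst].
have pw b t : centered b h theta t <=
    1 + (theta * (ln (zeta_at b h t) - psi eps h) + 4 * theta ^+ 2 * K t).
  set v := ln _ - _.
  have vb : `|v| <= Num.sqrt lambda * `|t| + (lambda / 2 + psi_bound lambda).
    rewrite (le_trans (ler_normB _ _))// addrA lerD ?psi_le_bound//.
    rewrite (le_trans (ln_zeta_at_bound b t h0))//.
    by rewrite lerD ?ler_wpM2r ?invr_ge0// ler_wsqrtr.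
  rewrite (le_trans (expR_le_quadratic_norm _))// -addrA lerD2l lerD2l.
  have -> : 4 * (theta * v) ^+ 2 * expR `|theta * v| =
      4 * theta ^+ 2 * (v ^+ 2 * expR `|theta * v|) by ring.
  apply: ler_wpM2l; first by rewrite mulr_ge0// sqr_ge0.
  have vv : v ^+ 2 <= expR (2 * `|v|).
    rewrite -real_normK ?num_real// mulrC expRM_natr ler_pXn2r ?nnegrE ?expR_ge0//.
    by rewrite (le_trans _ (expR_ge1Dx _))// lerDr.
  apply: (@le_trans _ _ (expR (2 * `|v|) * expR `|v|)).
    rewrite ler_pM ?sqr_ge0 ?expR_ge0// ler_expR normrM (gtr0_norm t0).
    by rewrite ler_piMl.
  rewrite -expRD /K ler_expR; lra.
apply: (@le_trans _ _ (\sum_b bern eps b *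
    (1 + (theta * (gE (fun t => ln (zeta_at b h t)) - psi eps h) + 4 * theta ^+ 2 * gE K)))).
  apply: ler_sum => b _; rewrite ler_wpM2l ?bern_ge0//.
  rewrite (_ : 1 + _ = gE (fun t => 1 + (theta * (ln (zeta_at b h t) - psi eps h) + 4 * theta ^+ 2 * K t))).
    apply: gE_le => //; first exact: tame_centered.
    by apply: tameD; [exact: tame_cst|apply: tameD; exact: tameZ].
  rewrite gED ?gE_cst; [|exact: tame_cst|by apply: tameD; exact: tameZ].
  rewrite gED; [|exact: tameZ|exact: tameZ].
  rewrite !gEZ// gED; [|exact: tame_ln_zeta_at|exact: tame_cst].
  by rewrite gE_cst.
rewrite big_bool/=.
have -> : psi eps h = eps * gE (fun t => ln (zeta_at true h t)) +
    (1 - eps) * gE (fun t => ln (zeta_at false h t)).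
  by rewrite psi_planted// big_bool.
rewrite le_eqVlt /moment_bound -/K; apply/orP; left; apply/eqP.
by move: (gE K) (gE (fun t => ln (zeta_at true h t)))
  (gE (fun t => ln (zeta_at false h t))) => k a c; ring.
Qed.

End scalar_channel.

(** * Upper bound: planted field and union bound over the magnetisation *)

Section wigner_upper.
Context {R : realType}.
Variables (eps : R) (n : nat).
Hypothesis eps01 : 0 < eps <= 1.
Hypothesis n0 : (0 < n)%N.
Local Notation spin := {ffun 'I_n -> bool}.
Local Notation dirs := (@edge_dirs R n).
Local Notation pX := (@prior R eps n).
Variable lambda : R.
Hypothesis l0 : 0 <= lambda.
Implicit Types (x y X : spin).

Let nR : (0 : R) < n%:R. Proof. by rewrite ltr0n. Qed.
Let p0 := @prior_ge0 R eps n eps01.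
Let ppos := @sum_prior_gt0 R eps n.

Let lnZ (v : spin -> R) := ln (Zf pX v).
Let good_lnZ : good lnZ. Proof. exact: good_lnZf. Qed.

Definition magn X x : R := overlap x X / n%:R.

Lemma magn_ge0 X x : 0 <= magn X x.
Proof. by rewrite divr_ge0 ?overlap_ge0// ltW. Qed.

Lemma F_n_planted : F_n eps n lambda =
  \sum_X pX X * TT (scale (Num.sqrt lambda) dirs) lnZ
                   (fun x => lambda * cov dirs X x).
Proof.
rewrite /F_n /free_energy TT_Zf_mul//; apply: eq_bigr => X _.
rewrite expR0 mulr1; congr (_ * TT _ _ _); apply/funext => x.
by rewrite cov_scale sqr_sqrtr// add0r.
Qed.

(** The signal-to-noise ratio varies with the configuration. These are still directions of a
    Gaussian field on [spin], so Kahane's inequality applies to them. *)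
Definition cavity_dir X (i : 'I_n) x : R := Num.sqrt (lambda * magn X x) * (x i)%:R.
Definition cavity_dirs X := [seq cavity_dir X i | i <- enum 'I_n].
(** The scale is chosen so that the covariance n lambda m(x) m(y) / 2 supplies the missing term of
    the square. *)
Definition magn_dir X x : R := Num.sqrt (n%:R * lambda / 2) * magn X x.

Lemma cov_cavity_dirs X x y :
  cov (cavity_dirs X) x y =
  Num.sqrt (lambda * magn X x) * Num.sqrt (lambda * magn X y) * overlap x y.
Proof.
rewrite /cov big_map big_enum/= mulr_sumr; apply: eq_bigr => i _.
by rewrite /cavity_dir mulrACA.
Qed.

(* The difference is a perfect square: that of the replica overlap minus the
   geometric mean of the two magnetisations. *)
Lemma cov_cavity_le X x y : cov (cavity_dirs X) x y <=
  cov (scale (Num.sqrt lambda) dirs ++ [:: magn_dir X]) x y + lambda / 2.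
Proof.
rewrite cov_cavity_dirs cov_cat cov_scale sqr_sqrtr// cov_edge_dirs//.
rewrite /cov big_seq1 /magn_dir mulrACA -expr2 sqr_sqrtr; last first.
  by rewrite divr_ge0// mulr_ge0// ltW.
rewrite (@sqrtrM R lambda (magn X x))// (@sqrtrM R lambda (magn X y))// mulrACA -expr2 sqr_sqrtr//.
have := @overlap_le R n x y; have := @overlap_ge0 R n x y.
have := sqr_sqrtr (magn_ge0 X x); have := sqr_sqrtr (magn_ge0 X y).
move: (overlap x y) (Num.sqrt (magn X x)) (Num.sqrt (magn X y)) => N a b <- <- N0 Nn.
rewrite -subr_ge0.
have -> : lambda * ((N ^+ 2 - N) / (2 * n%:R)) + n%:R * lambda / 2 * (a ^+ 2 * b ^+ 2)
    + lambda / 2 - lambda * (a * b) * N =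
    lambda / (2 * n%:R) * ((N - n%:R * (a * b)) ^+ 2 + (n%:R - N)).
  by field; rewrite gt_eqF.
apply: mulr_ge0; first by rewrite divr_ge0// mulr_ge0// ltW.
by apply: addr_ge0; [exact: sqr_ge0|rewrite subr_ge0].
Qed.

(** The 3/4 is 1/2 from the planted drift plus 1/4 from half the variance of [magn_dir]. The
    remaining part of the drift, -lambda N / (2 n) with N the overlap with X, is nonpositive and
    dropped by monotonicity. *)
Lemma planted_le_cavity X :
  TT (scale (Num.sqrt lambda) dirs) lnZ (fun x => lambda * cov dirs X x) <=
  TT (cavity_dirs X) lnZ (fun x => 3 / 4 * n%:R * lambda * magn X x ^+ 2) + lambda / 4.
Proof.
have h1 : TT (scale (Num.sqrt lambda) dirs) lnZ (fun x => lambda * cov dirs X x) <=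
    TT (scale (Num.sqrt lambda) dirs ++ [:: magn_dir X]) lnZ
       (fun x => lambda * cov dirs X x + magn_dir X x ^+ 2 / 2).
  rewrite TT_cat -(TT_translate _ (fun x => magn_dir X x ^+ 2 / 2)).
  apply: TT_le => //.
    exact: (good_translate (fun x => magn_dir X x ^+ 2 / 2) (good_TT [:: magn_dir X] good_lnZ)).
  by move=> v; exact: lnZf_le_TT.
rewrite (le_trans h1)//.
have h2 := kahane_ln p0 ppos (cov_cavity_le X) (fun x => lambda * cov dirs X x + magn_dir X x ^+ 2 / 2).
rewrite (le_trans h2)//; apply: lerD; last first.
  by rewrite le_eqVlt; apply/orP; left; apply/eqP; field.
apply: TT_lnZf_mono => // x.
rewrite /magn_dir exprMn sqr_sqrtr; last by rewrite divr_ge0// mulr_ge0// ltW.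
rewrite cov_edge_dirs// overlapC /magn.
have := @overlap_ge0 R n x X; move: (overlap x X) => N N0.
rewrite -subr_ge0.
have -> : 3 / 4 * n%:R * lambda * (N / n%:R) ^+ 2 -
    (lambda * ((N ^+ 2 - N) / (2 * n%:R)) + n%:R * lambda / 2 * (N / n%:R) ^+ 2 / 2) =
    lambda * N / (2 * n%:R) by field; rewrite gt_eqF.
by rewrite divr_ge0 ?mulr_ge0// ltW.
Qed.

Let hk (k : 'I_n.+1) : R := lambda * (k%:R / n%:R).

Let hk0 k : 0 <= hk k. Proof. by rewrite mulr_ge0// divr_ge0// ltW. Qed.

Let hkl k : hk k <= lambda.
Proof.
rewrite /hk ler_piMr// ler_pdivrMr// mul1r ler_nat.
by rewrite -ltnS ltn_ord.
Qed.

Lemma overlap_nat x X : exists k : 'I_n.+1, overlap x X = k%:R :> R.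
Proof.
have E : overlap x X = (\sum_i (x i : nat) * (X i : nat))%N%:R :> R.
  by rewrite natr_sum; apply: eq_bigr => i _; rewrite natrM.
have := @overlap_le R n x X; rewrite E ler_nat -ltnS => kn.
by exists (Ordinal kn).
Qed.

(** At magnetisation m = k / n, planted scalar channels contribute n lambda m^2 to the exponent;
    having only 3/4 of it leaves exp(-n lambda m^2 / 4), the quadratic term of the potential. Each x
    is matched with its own k, and the other terms of the double sum are nonnegative; without the
    constraint on m the sum over x factorises. *)
Lemma Zf_cavity_le X (z : 'I_n -> R) :
  Zf pX (fun x => nrm (cavity_dirs X) (fun x => 3 / 4 * n%:R * lambda * magn X x ^+ 2) x
                  + linmap (cavity_dir X) z x) <=
  \sum_(k < n.+1) expR (- (n%:R * (hk k * (k%:R / n%:R) / 4))) *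
    \prod_i zeta_at eps (X i) (hk k) (z i).
Proof.
pose T (k : 'I_n.+1) x := pX x * expR (- (n%:R * (hk k * (k%:R / n%:R) / 4)) +
  \sum_i (Num.sqrt (hk k) * (z i + Num.sqrt (hk k) * (X i)%:R) - hk k / 2) * (x i)%:R).
have Tk k : \sum_x T k x = expR (- (n%:R * (hk k * (k%:R / n%:R) / 4))) *
    \prod_i zeta_at eps (X i) (hk k) (z i).
  have Zi i : zeta_at eps (X i) (hk k) (z i) = \sum_b bern eps b *
      expR ((Num.sqrt (hk k) * (z i + Num.sqrt (hk k) * (X i)%:R) - hk k / 2) * b%:R).
    by rewrite big_bool/= mulr1 mulr0 expR0 mulr1 /zeta_at /zeta addrC.
  rewrite (eq_bigr _ (fun i _ => Zi i)) -(sum_prod_spin (fun i b => bern eps b *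
    expR ((Num.sqrt (hk k) * (z i + Num.sqrt (hk k) * (X i)%:R) - hk k / 2) * b%:R)))//.
  rewrite mulr_sumr; apply: eq_bigr => x _.
  by rewrite /T expRD mulrCA expR_sum -big_split.
rewrite -(eq_bigr _ (fun k _ => Tk k)) exchange_big/=; apply: ler_sum => x _.
have [k kE] := overlap_nat x X.
rewrite (bigD1 k)//= ler_wpDr//.
  by apply: sumr_ge0 => j _; rewrite mulr_ge0// expR_ge0.
rewrite /T ler_wpM2l// ler_expR le_eqVlt; apply/orP; left; apply/eqP.
have mk : magn X x = k%:R / n%:R by rewrite /magn kE.
rewrite /nrm cov_cavity_dirs -expr2 sqr_sqrtr mk -/(hk k)//.
have xx : overlap x x = \sum_i (x i)%:R :> R.
  by apply: eq_bigr => i _; rewrite -expr2 bit_sqr.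
have -> : \sum_i (Num.sqrt (hk k) * (z i + Num.sqrt (hk k) * (X i)%:R) - hk k / 2) * (x i)%:R =
    linmap (cavity_dir X) z x + hk k * overlap x X - hk k / 2 * overlap x x.
  rewrite /linmap xx !mulr_sumr -!big_split/= -sumrN -big_split/=.
  apply: eq_bigr => i _; rewrite /cavity_dir mk -/(hk k).
  have := sqr_sqrtr (hk0 k); move: (Num.sqrt (hk k)) => s.
  by move: (hk k) => h <-; ring.
rewrite kE /hk; move: (linmap _ _ _) (overlap x x) => L O.
by field; rewrite gt_eqF.
Qed.

Variables (f theta : R).
Hypothesis fsup : forall q : R, 0 <= q <= 1 -> psi eps (lambda * q) - lambda * q ^+ 2 / 4 <= f.
Hypothesis th : 0 < theta <= 1.

Let t0 : 0 < theta. Proof. by case/andP: th. Qed.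

Let W (X : spin) (z : 'I_n -> R) :=
  \sum_(k < n.+1) \prod_i centered eps (X i) (hk k) theta (z i).

Let prod_gt0 k (X : spin) (z : 'I_n -> R) : 0 < \prod_i centered eps (X i) (hk k) theta (z i).
Proof. by apply: prodr_gt0 => i _; exact: expR_gt0. Qed.

Let W_gt0 X z : 0 < W X z.
Proof.
rewrite /W (bigD1 ord0)//= ltr_pwDl// sumr_ge0// => k _.
by rewrite ltW.
Qed.

(* The fluctuations of the [n + 1] scalar free energies are all controlled by [W],
   through their exponential moments of small order theta. *)
Let sum_le (X : spin) (z : 'I_n -> R) : \sum_(k < n.+1) expR (- (n%:R * (hk k * (k%:R / n%:R) / 4))) *
    \prod_i zeta_at eps (X i) (hk k) (z i) <=
  expR (n%:R * f + ln n.+1%:R + ln (W X z) / theta).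
Proof.
have -> : expR (n%:R * f + ln n.+1%:R + ln (W X z) / theta) =
    \sum_(k < n.+1) expR (n%:R * f + ln (W X z) / theta).
  by rewrite sumr_const card_ord -[RHS]mulr_natl addrAC expRD lnK ?posrE// [LHS]mulrC.
apply: ler_sum => k _.
have zp i : 0 < zeta_at eps (X i) (hk k) (z i) by exact: zeta_gt0.
pose Y := \sum_i (ln (zeta_at eps (X i) (hk k) (z i)) - psi eps (hk k)).
have -> : \prod_i zeta_at eps (X i) (hk k) (z i) = expR (Y + n%:R * psi eps (hk k)).
  rewrite /Y sumrB sumr_const card_ord mulr_natl subrK expR_sum.
  by apply: eq_bigr => i _; rewrite lnK// posrE.
rewrite -expRD ler_expR.
have YW : Y <= ln (W X z) / theta.
  rewrite ler_pdivlMr// -[leLHS]expRK ler_ln ?posrE ?expR_gt0//.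
  rewrite mulrC /Y mulr_sumr expR_sum /W (bigD1 k)//= lerDl.
  by apply: sumr_ge0 => j _; rewrite ltW.
have kn : 0 <= (k%:R / n%:R : R) <= 1.
  by rewrite divr_ge0//= ler_pdivrMr// mul1r ler_nat -ltnS ltn_ord.
have := ler_wpM2l (ltW nR) (fsup kn); rewrite -/(hk k) => H.
have -> : hk k * (k%:R / n%:R) / 4 = lambda * (k%:R / n%:R) ^+ 2 / 4.
  by rewrite /hk; ring.
rewrite mulrBr in H; lra.
Qed.

(** The ln of [W] is bounded by its tangent at [c], so only the mean of [W] matters. One [c] is
    meant for all planted configurations, as the average over X comes afterwards. *)
Lemma TT_cavity_le (X : spin) c : 0 < c ->
  TT (cavity_dirs X) (fun v => ln (Zf pX v))
     (fun x => 3 / 4 * n%:R * lambda * magn X x ^+ 2) <=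
  n%:R * f + ln n.+1%:R + theta^-1 * (ln c - 1 +
    c^-1 * \sum_(k < n.+1) \prod_i gE (centered eps (X i) (hk k) theta)).
Proof.
move=> c0; pose u (x : spin) : R := 3 / 4 * n%:R * lambda * magn X x ^+ 2; rewrite -/u.
have gl : good (fun v : spin -> R => ln (Zf pX v)).
  by apply: good_lnZf; [exact: prior_ge0|exact: sum_prior_gt0].
have tc k i : tame (centered eps (X i) (hk k) theta) by exact: tame_centered.
have gp k : good (fun z : 'I_n -> R => \prod_i centered eps (X i) (hk k) theta (z i)).
  exact: (good_prod_coord (tc k)).
have gW : good (W X) by apply: good_sum => k; exact: gp.
have Zp v : 0 < Zf pX v by apply: Zf_gt0; [exact: prior_ge0|exact: sum_prior_gt0].
rewrite /TT -[X in GG _ _ X](_ : (fun x => nrm (cavity_dirs X) u x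
    + linmap (cavity_dir X) (fun=> 0) x) = _); last first.
  by apply/funext => x; rewrite linmap0 addr0.
rewrite (GG_coords (cavity_dir X) (enum 'I_n) (fun v => ln (Zf pX v))).
rewrite (@le_trans _ _ (GG [seq delta i | i <- enum 'I_n]
    (fun z => n%:R * f + ln n.+1%:R + theta^-1 * (ln c - 1) + (theta^-1 * c^-1) * W X z) (fun=> 0)))//.
  apply: GG_le.
  - exact: (good_linmap (cavity_dir X) (nrm (cavity_dirs X) u) gl).
  - by apply: goodD; [exact: good_cst|exact: goodZ].
  - move=> z; have h1 := Zf_cavity_le X z.
    have := le_trans h1 (sum_le X z); rewrite -[leLHS]lnK ?posrE ?Zp// ler_expR => {}h1.
    have := @le_ln1Dx R (W X z / c - 1); rewrite subrKC => h2.
    have {}h2 : ln (W X z) <= ln c + W X z / c - 1.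
      rewrite -[X in ln X](@divfK _ c) ?gt_eqF// lnM ?posrE ?divr_gt0//.
      have := h2 _; move: (ln _) (ln c) => a b H; rewrite addrC -addrA lerD2l H//.
      by rewrite ltrDr divr_gt0.
    rewrite (le_trans h1)//.
    have -> : n%:R * f + ln n.+1%:R + theta^-1 * (ln c - 1) + theta^-1 * c^-1 * W X z =
       n%:R * f + ln n.+1%:R + (ln c + W X z / c - 1) / theta.
      by move: (ln c) (ln _) (W X z) => a b w; field; rewrite !gt_eqF.
    by rewrite lerD2l ler_pM2r ?invr_gt0.
rewrite GGD; [|exact: good_cst|exact: goodZ].
rewrite GG_cst GGZ// /W GG_sum//.
under eq_bigr => k _ do rewrite (GG_prod_coord0 (tc k)).
by rewrite [X in _ <= _ + X]mulrDr addrA mulrA.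
Qed.

(** [c] bounds the planted mean of [W]: n + 1 magnetisations, each with n independent sites of
    exponential moment at most 1 + theta^2 C. One ln(n + 1) comes from the union bound, theta^-1 of
    them from ln c. *)
Lemma F_n_upper :
  F_n eps n lambda <= n%:R * f + lambda / 4 + (1 + theta^-1) * ln n.+1%:R +
    n%:R * (theta * moment_bound lambda).
Proof.
have /andP[_ t1] := th.
pose C : R := moment_bound lambda; have C0 : 0 <= C by exact: moment_bound_ge0.
have q0 : 0 < 1 + theta ^+ 2 * C by rewrite ltr_pwDl// mulr_ge0// sqr_ge0.
pose c := n.+1%:R * (1 + theta ^+ 2 * C) ^+ n.
have c0 : 0 < c by rewrite mulr_gt0// exprn_gt0.
pose Q (X : spin) := \sum_(k < n.+1) \prod_i gE (centered eps (X i) (hk k) theta).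
have SQ : \sum_(X : spin) pX X * Q X <= c.
  rewrite /Q; under eq_bigr do rewrite mulr_sumr.
  rewrite exchange_big/=.
  have -> : c = \sum_(k < n.+1) (1 + theta ^+ 2 * C) ^+ n.
    by rewrite sumr_const card_ord /c mulr_natl.
  apply: ler_sum => k _.
  under eq_bigr do rewrite -big_split/=.
  rewrite (sum_prod_spin (fun i b => bern eps b * gE (centered eps b (hk k) theta))).
  have -> : (1 + theta ^+ 2 * C) ^+ n = \prod_(i < n) (1 + theta ^+ 2 * C).
    by rewrite prodr_const card_ord.
  apply: ler_prod => i _.
  rewrite moment_centered// andbT sumr_ge0// => b _.
  by rewrite mulr_ge0 ?bern_ge0 ?gE_ge0// => t; exact: expR_ge0.
have lnc : ln c <= ln n.+1%:R + n%:R * (theta ^+ 2 * C).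
  rewrite /c lnM ?posrE ?exprn_gt0// lerD2l lnXn// -[leLHS]mulr_natl ler_wpM2l//.
  by apply: le_ln1Dx; rewrite (lt_le_trans (ltrN10 _))// mulr_ge0// sqr_ge0.
rewrite F_n_planted.
pose A := n%:R * f + ln n.+1%:R + theta^-1 * (ln c - 1) + lambda / 4.
apply: (@le_trans _ _ (\sum_X pX X * (A + theta^-1 * c^-1 * Q X))).
  apply: ler_sum => X _; rewrite ler_wpM2l ?prior_ge0//.
  rewrite (le_trans (planted_le_cavity X))//.
  rewrite (le_trans (lerD (TT_cavity_le X c0) (lexx _)))// /A -/(Q X).
  by rewrite mulrDr mulrA addrA -[leLHS]addrA [X in _ + X]addrC addrA.
under eq_bigr do rewrite mulrDr mulrCA.
rewrite big_split/= -mulr_suml sum_prior mul1r -mulr_sumr.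
have : theta^-1 * c^-1 * \sum_X pX X * Q X <= theta^-1.
  rewrite -[leRHS]mulr1 -mulrA ler_wpM2l ?invr_ge0 ?(ltW t0)//.
  by rewrite ler_pdivrMl// mulr1.
have : theta^-1 * (ln c - 1) <= theta^-1 * ln n.+1%:R + n%:R * (theta * C) - theta^-1.
  have -> : theta^-1 * ln n.+1%:R + n%:R * (theta * C) - theta^-1 =
      theta^-1 * (ln n.+1%:R + n%:R * (theta ^+ 2 * C) - 1) by field; rewrite gt_eqF.
  by rewrite ler_wpM2l ?invr_ge0 ?(ltW t0)// lerD2r.
rewrite /A mulrDl mul1r => h1 h2.
move: (theta^-1 * c^-1 * _) h2 h1 => x; rewrite -/C; move: (theta^-1 * (ln c - 1)) (theta^-1 * ln _) => y z.
move: (n%:R * (theta * C)) (n%:R * f) (ln _) theta^-1 => a b u v h2 h1.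
lra.
Qed.

End wigner_upper.

(** * The limiting free energy *)

Section convex_limit.
Context {R : realType}.

Definition subgradient (f : R -> R) (s r : R) :=
  forall t, 0 < t -> f s + (t - s) * r <= f t.

(** The open intervals between two subgradients are ordered like the points they belong to; a
    rational chosen in each gives an injection. *)
Lemma countable_nonunique_subgradient (f : R -> R) :
  countable [set s | 0 < s /\ exists r r', [/\ r < r', subgradient f s r & subgradient f s r']].
Proof.
set N := [set s | _].
have between s : exists q : rat, N s -> exists r r',
    [/\ r < ratr q, ratr q < r', subgradient f s r & subgradient f s r'].
  have [[s0 [r [r' [rr' sr sr']]]]|] := pselect (N s); last by move=> Ns; exists 0.
  have [q] := rat_in_itvoo rr'; rewrite in_itv/= => /andP[rq qr'].
  by exists q => _; exists r, r'.
have [g Hg] := choice between.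
have gmono s t : N s -> N t -> s < t -> g s != g t.
  move=> Ns Nt st; have [s0 _] := Ns; have [t0 _] := Nt.
  have [r [r' [_ gr' _ sr']]] := Hg s Ns; have [q [q' [qg _ sq _]]] := Hg t Nt.
  have := sr' t t0; have := sq s s0 => h1 h2.
  rewrite -(inj_eq (@fmorph_inj _ _ (@ratr R))) lt_eqF//.
  rewrite (lt_le_trans gr')// (le_trans _ (ltW qg))//.
  rewrite -(@ler_pM2l _ (t - s)) ?subr_gt0//.
  have E : (s - t) * q = - ((t - s) * q) by ring.
  rewrite E in h1; lra.
apply/countable_injP; exists (fun s => choice.pickle (g s)) => s t.
rewrite !inE => Ns Nt /(pcan_inj choice.pickleK) gst.
case: (ltgtP s t) => // st.
  by have := gmono _ _ Ns Nt st; rewrite gst eqxx.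
by have := gmono _ _ Nt Ns st; rewrite gst eqxx.
Qed.

Variables (F D : nat -> R -> R) (f : R -> R).
Hypothesis chord : forall n s t, 0 < s -> 0 < t -> F n s + (t - s) * D n s <= F n t.
Hypothesis cvgF : forall s, 0 < s -> F n s @[n --> \oo] --> f s.

Let slope (g : R -> R) s t := (g t - g s) / (t - s).

(** The chord inequality at the middle point, used towards both ends with suitable weights,
    eliminates [D n y]; what is left passes to the limit. *)
Lemma limit_convex x y z : 0 < x -> x < y -> y < z ->
  (z - x) * f y <= (z - y) * f x + (y - x) * f z.
Proof.
move=> x0 xy yz; have y0 := lt_trans x0 xy; have z0 := lt_trans y0 yz.
have c1 : (z - x) * F n y @[n --> \oo] --> (z - x) * f y by exact: cvgMr (cvgF y0).
have c2 : (z - y) * F n x + (y - x) * F n z @[n --> \oo] --> (z - y) * f x + (y - x) * f z.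
  by apply: cvgD; [exact: cvgMr (cvgF x0)|exact: cvgMr (cvgF z0)].
apply: (ler_cvg_to c1 c2); apply: nearW => n /=.
have := chord n y0 x0; have := chord n y0 z0.
move: (F n x) (F n y) (F n z) (D n y) => a b c r h1 h2.
have h3 : (y - x) * (b + (z - y) * r) <= (y - x) * c by rewrite ler_pM2l// subr_gt0.
have h4 : (z - y) * (b + (x - y) * r) <= (z - y) * a by rewrite ler_pM2l// subr_gt0.
have -> : (z - x) * b = (y - x) * (b + (z - y) * r) + (z - y) * (b + (x - y) * r) by ring.
lra.
Qed.

Lemma subgradient_slope s r : 0 < s ->
  (forall t, 0 < t -> t < s -> slope f t s <= r) ->
  (forall t, s < t -> r <= slope f s t) -> subgradient f s r.
Proof.
move=> s0 hl hr t t0; case: (ltgtP t s) => [ts|st|->]; last by rewrite subrr mul0r addr0.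
  have := hl t t0 ts; rewrite /slope ler_pdivrMr ?subr_gt0// => h.
  have -> : (t - s) * r = - (r * (s - t)) by ring.
  by lra.
have := hr t st; rewrite /slope ler_pdivlMr ?subr_gt0// => h.
rewrite [_ * r]mulrC; lra.
Qed.

Lemma slope_le s t u : 0 < t -> t < s -> s < u -> slope f t s <= slope f s u.
Proof.
move=> t0 ts su; rewrite /slope ler_pdivrMr ?subr_gt0// mulrAC ler_pdivlMr ?subr_gt0//.
have := limit_convex t0 ts su.
by move: (f t) (f s) (f u) => a b c; nra.
Qed.

(** The infimum of the slopes to the right and the supremum of those to the left are the one-sided
    derivatives of [f]; both are subgradients. *)
Let up s := [set slope f s t | t in [set t | s < t]].
Let dn s := [set slope f t s | t in [set t | 0 < t /\ t < s]].
Let rp s := inf (up s).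
Let rm s := sup (dn s).

Let up0 s : up s !=set0.
Proof. by exists (slope f s (s + 1)), (s + 1) => //=; rewrite ltrDl. Qed.

Let dn0 s : 0 < s -> dn s !=set0.
Proof.
by move=> s0; exists (slope f (s / 2) s), (s / 2) => //=; split; lra.
Qed.

Let up_lb s : 0 < s -> has_lbound (up s).
Proof.
move=> s0; have [_ [t [t0 ts] _]] := dn0 s0.
by exists (slope f t s) => _ [u su <-]; exact: slope_le.
Qed.

Let dn_ub s : 0 < s -> has_ubound (dn s).
Proof.
move=> s0; have [_ [u su _]] := up0 s.
by exists (slope f s u) => _ [t [t0 ts] <-]; exact: slope_le.
Qed.

Let sub_rp s : 0 < s -> subgradient f s (rp s).
Proof.
move=> s0; apply: subgradient_slope => // t => [t0 ts|st].
  apply: lb_le_inf; first exact: up0.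
  by move=> _ [u su <-]; exact: slope_le.
by apply: ge_inf; [exact: up_lb|exists t].
Qed.

Let sub_rm s : 0 < s -> subgradient f s (rm s).
Proof.
move=> s0; apply: subgradient_slope => // t => [t0 ts|st].
  by apply: ub_le_sup; [exact: dn_ub|exists t].
apply: ge_sup; first exact: dn0.
by move=> _ [u [u0 us] <-]; exact: slope_le.
Qed.

Let cvg_slope s t : 0 < s -> 0 < t -> slope (F n) s t @[n --> \oo] --> slope f s t.
Proof. by move=> s0 t0; apply: cvgMl; apply: cvgB; exact: cvgF. Qed.

(** Uniqueness makes both one-sided derivatives equal to [r], which gives chords of [f] on either
    side with slopes within e / 2 of [r]. With their end points fixed, the slopes of [F n] converge,
    and they enclose [D n s]. *)
Lemma cvg_derivative s r : 0 < s -> subgradient f s r ->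
  (forall r', subgradient f s r' -> r' = r) -> D n s @[n --> \oo] --> r.
Proof.
move=> s0 sr ur.
have Ep : rp s = r by apply: ur; exact: sub_rp.
have Em : rm s = r by apply: ur; exact: sub_rm.
apply/cvgrPdist_le => e e0; have e2 : 0 < e / 2 by rewrite divr_gt0.
have [_ [t st <-] tr] := inf_adherent e2 (conj (up0 s) (up_lb s0)).
have [_ [u [u0 us] <-] ru] := sup_adherent e2 (conj (dn0 s0) (dn_ub s0)).
have t0 : 0 < t by rewrite (lt_trans s0).
rewrite -/(rp s) Ep in tr; rewrite -/(rm s) Em in ru.
have /cvgrPdist_le /(_ _ e2) c1 := cvg_slope s0 t0.
have /cvgrPdist_le /(_ _ e2) c2 := cvg_slope u0 s0.
near=> n.
have h1 : `|slope f s t - slope (F n) s t| <= e / 2 by near: n.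
have h2 : `|slope f u s - slope (F n) u s| <= e / 2 by near: n.
have h3 : D n s <= slope (F n) s t.
  rewrite /slope ler_pdivlMr ?subr_gt0//.
  have := chord n s0 t0; rewrite [_ * D _ _]mulrC; lra.
have h4 : slope (F n) u s <= D n s.
  rewrite /slope ler_pdivrMr ?subr_gt0//.
  have := chord n s0 u0; have -> : (u - s) * D n s = - (D n s * (s - u)) by ring.
  lra.
move: h1 h2 h3 h4 tr ru; rewrite !ler_norml.
move: (slope f s t) (slope f u s) (slope (F n) s t) (slope (F n) u s) => a b c d.
by move=> /andP[h1 h1'] /andP[h2 h2'] h3 h4 h5 h6; apply/andP; split; lra.
Unshelve. all: by end_near.
Qed.

Lemma le_affine_right (s t a c : R) : s < t ->
  (forall x, s < x -> x < t -> c <= a * x) -> c <= a * s.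
Proof.
move=> st H; rewrite leNgt; apply/negP => asc.
have [a0|a0] := leP a 0.
  have := H ((s + t) / 2); have : a * ((s + t) / 2) <= a * s by nra.
  by move=> h1 h2; have := h2 _ _; lra.
have sca : s < c / a by rewrite ltr_pdivlMr// mulrC.
pose y := Num.min t (c / a); have sy : s < y by rewrite lt_min st.
have yt : y <= t by rewrite ge_min lexx.
have ya : a * y <= c by rewrite mulrC -ler_pdivlMr// ge_min lexx orbT.
have := H ((s + y) / 2) _ _; nra.
Qed.

Lemma le_affine_left (s t a c : R) : t < s ->
  (forall x, t < x -> x < s -> a * x <= c) -> a * s <= c.
Proof.
move=> ts H; have : - c <= a * - s; last by rewrite mulrN lerN2.
apply: (@le_affine_right _ (- t)); first by rewrite ltrN2.
move=> x sx xt; rewrite -[x]opprK mulrN lerN2; apply: H; lra.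
Qed.

(** The minorant agrees with the line of slope [b] at [s] only to first order. Slopes of a convex
    function are monotone, so chords shrinking to [s] recover the line. *)
Lemma subgradient_harmonic s b : 0 < s ->
  (forall t, 0 < t -> b * (s * (t - s) / t) <= f t - f s) -> subgradient f s b.
Proof.
move=> s0 H; apply: subgradient_slope => // t => [t0 ts|st].
  rewrite -(ler_pM2r s0); apply: (le_affine_left ts) => x tx xs.
  have x0 := lt_trans t0 tx; rewrite -ler_pdivlMr//.
  apply: (@le_trans _ _ (slope f x s)).
    rewrite /slope ler_pdivrMr ?subr_gt0// mulrAC ler_pdivlMr ?subr_gt0//.
    have := limit_convex t0 tx xs; move: (f t) (f x) (f s) => u v w; lra.
  rewrite /slope ler_pdivrMr ?subr_gt0//; have := H x x0.
  have -> : b * s / x * (s - x) = - (b * (s * (x - s) / x)) by field; rewrite gt_eqF.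
  lra.
have t0 := lt_trans s0 st.
rewrite -(ler_pM2r s0); apply: (le_affine_right st) => x sx xt.
have x0 := lt_trans s0 sx; rewrite -ler_pdivrMr//.
apply: (@le_trans _ _ (slope f s x)).
  rewrite /slope ler_pdivlMr ?subr_gt0//; have := H x x0.
  by have -> : b * s / x * (x - s) = b * (s * (x - s) / x) by field; rewrite gt_eqF.
rewrite /slope ler_pdivrMr ?subr_gt0// mulrAC ler_pdivlMr ?subr_gt0//.
have := limit_convex s0 sx xt; move: (f t) (f x) (f s) => u v w; lra.
Qed.

End convex_limit.

Section limiting_free_energy.
Context {R : realType}.
Variable eps : R.
Hypothesis eps01 : 0 < eps <= 1.

Let b0 := @bern_ge0 R eps eps01.
Let bpos := @sum_bern_gt0 R eps.
Let K h := free_slope (bern eps) [:: @bit R] (fun=> 0) h.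

(** Slopes are nonnegative and nondecreasing, so the slope at the right end [h] bounds all
    chords. *)
Lemma psi_lipschitz h s t : 0 <= s -> 0 <= t -> s <= h -> t <= h ->
  `|psi eps s - psi eps t| <= K h * `|s - t|.
Proof.
wlog st : s t / s < t.
  move=> H s0 t0 sh th; case: (ltgtP s t) => [st|ts|->]; first exact: H.
    by rewrite distrC (distrC s); exact: H.
  by rewrite !subrr normr0 mulr0.
move=> s0 t0 sh th.
have := free_energy_chord b0 bpos [:: @bit R] (fun=> 0) s0 st.
have := free_slope_ge0 b0 bpos [:: @bit R] (fun=> 0) s.
have := free_slope_nondecreasing b0 bpos [:: @bit R] (fun=> 0) t0 th.
rewrite -!/(K _) -!/(psi eps _).
move: (psi eps s) (psi eps t) (K s) (K t) (K h) => x y a b c D1 D0 /andP[h1 h2].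
rewrite distrC (distrC s) (@gtr0_norm _ (t - s)) ?subr_gt0//.
rewrite ger0_norm; last first.
  by apply: le_trans h1; apply: mulr_ge0; rewrite // subr_ge0 ltW.
by rewrite (le_trans h2)// mulrC; apply: ler_wpM2r; rewrite // subr_ge0 ltW.
Qed.

Definition rs_potential (lambda q : R) := psi eps (lambda * q) - lambda * q ^+ 2 / 4.

Lemma continuous_rs_potential lambda : 0 <= lambda ->
  {within `[0, 1], continuous (rs_potential lambda)}.
Proof.
(* The chord inequalities control [psi] at nonnegative arguments; |q| extends the function to the
   line without changing it on [0, 1]. *)
move=> l0; pose g (q : R) := psi eps (lambda * `|q|) - lambda * q ^+ 2 / 4.
suff : {within `[0, 1], continuous g}.
  move=> cg; apply: subspace_eq_continuous cg => q.
  rewrite inE/= in_itv/= => /andP[q0 _].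
  by rewrite /from_subspace /g /rs_potential ger0_norm.
apply: continuous_subspaceT => p; apply: cvgB; last first.
  by apply: cvgMl; apply: cvgMr; apply: exprn_continuous.
pose L := lambda * (`|p| + 1).
apply/cvgrPdist_le => e e0.
have KL : 0 <= K L by exact: free_slope_ge0.
have C0 : 0 < lambda * K L + 1 by rewrite ltr_pwDr// mulr_ge0.
near=> q.
have h1 : `|p - q| <= 1 by near: q; apply: cvgr_dist_le.
have h2 : `|p - q| <= e / (lambda * K L + 1).
  by near: q; apply: cvgr_dist_le => //; rewrite divr_gt0.
have qp : `|q| <= `|p| + 1.
  by rewrite (le_trans _ (lerD (lexx _) h1))// -lerBlDl distrC (le_trans (ler_norm _))// ler_dist_dist.
rewrite (le_trans (@psi_lipschitz L _ _ _ _ _ _)) ?mulr_ge0 ?ler_wpM2l// ?lerDl//.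
rewrite -mulrBr normrM (ger0_norm l0).
rewrite (@le_trans _ _ ((lambda * K L) * `|p - q|))//.
  rewrite mulrA [K L * _]mulrC; apply: ler_wpM2l; last exact: ler_dist_dist.
  exact: mulr_ge0.
rewrite ler_pdivlMr// mulrC in h2.
by rewrite (le_trans _ h2)// ler_wpM2r// lerDl.
Unshelve. all: by end_near.
Qed.

(** Magnetisations lie in [0, 1], and compactness provides a maximiser there. That larger q give
    nothing more is recovered later, in [rs_potential_le_fe_lim]. *)
Definition fe_lim lambda := sup [set rs_potential lambda q | q in `[0, 1]].

Lemma fe_lim_attained lambda : 0 <= lambda -> exists q, [/\ 0 <= q, q <= 1,
  rs_potential lambda q = fe_lim lambda & forall q', 0 <= q' <= 1 -> rs_potential lambda q' <= fe_lim lambda].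
Proof.
move=> l0; have [q] := EVT_max ler01 (continuous_rs_potential l0).
rewrite in_itv/= => /andP[q0 q1] Hq.
have M : ubound [set rs_potential lambda q | q in `[0, 1]] (rs_potential lambda q).
  by move=> _ [t + <-]; rewrite /= => t01; exact: Hq.
have E : rs_potential lambda q = fe_lim lambda.
  apply/eqP; rewrite eq_le; apply/andP; split.
    apply: ub_le_sup; first by exists (rs_potential lambda q).
    by exists q; rewrite //= in_itv/= q0.
  by apply: ge_sup => //; exists (rs_potential lambda q), q; rewrite //= in_itv/= q0.
by exists q; split=> // q' q'01; rewrite -E; apply: Hq; rewrite in_itv.
Qed.

Lemma F_n_le_fe_lim n lambda theta : (0 < n)%N -> 0 <= lambda -> 0 < theta <= 1 ->
  F_n eps n lambda <= n%:R * fe_lim lambda + lambda / 4 + (1 + theta^-1) * ln n.+1%:R +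
    n%:R * (theta * moment_bound lambda).
Proof.
move=> n0 l0 th; have [_ [_ _ _ H]] := fe_lim_attained l0.
by apply: F_n_upper => // q; exact: H.
Qed.

(** The tangent of ln at [a]; with [a] large it makes ln(n + 1) negligible against n. *)
Lemma ln_succ_le (a : R) n : 1 <= a -> ln n.+1%:R <= ln a + (n%:R + 1) / a.
Proof.
move=> a1; have a0 : 0 < a by rewrite (lt_le_trans ltr01).
rewrite -[X in ln X](@divfK _ a) ?gt_eqF// lnM ?posrE ?divr_gt0//.
have := @le_ln1Dx R (n.+1%:R / a - 1); rewrite subrKC => h.
have := h _; rewrite ltrDr divr_gt0 ?ltr0n// => /(_ isT).
rewrite -natr1; move: (ln a) (ln _) (_ / a) => x y z; lra.
Qed.

Lemma F_n_limsup lambda e : 0 <= lambda -> 0 < e ->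
  \forall n \near \oo, F_n eps n lambda / n%:R <= fe_lim lambda + e.
Proof.
move=> l0 e0; pose C := moment_bound lambda.
have C0 : 0 <= C by exact: moment_bound_ge0.
(* The error e is shared in three: theta controls the moments, then [a] the linear part of the
   logarithms, and large n the constants. *)
pose theta := Num.min 1 (e / (3 * (C + 1))).
have th : 0 < theta <= 1.
  rewrite lt_min ltr01/= ge_min lexx/= andbT divr_gt0//.
  by rewrite mulr_gt0// ltr_pwDr.
have tC : theta * C <= e / 3.
  apply: (@le_trans _ _ (e / (3 * (C + 1)) * C)).
    by rewrite ler_wpM2r// ge_min lexx orbT.
  rewrite mulrAC ler_pdivrMr ?mulr_gt0 ?ltr_pwDr//.
  have -> : e / 3 * (3 * (C + 1)) = e * C + e by field.
  by rewrite lerDl ltW.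
pose k := 1 + theta^-1.
have k0 : 0 < k by move: th => /andP[t0 _]; rewrite addr_gt0 ?invr_gt0.
pose a := Num.max 1 (3 * k / e).
have a1 : 1 <= a by rewrite le_max lexx.
have a0 : 0 < a by rewrite (lt_le_trans ltr01).
have ka : k / a <= e / 3.
  rewrite ler_pdivrMr// mulrC -ler_pdivrMr ?divr_gt0//.
  have -> : k / (e / 3) = 3 * k / e by field; rewrite gt_eqF.
  by rewrite le_max lexx orbT.
pose M := lambda / 4 + k * (ln a + a^-1).
near=> n.
have n0 : (0 < n)%N by near: n; exact: nbhs_infty_gt.
have Mn : 3 * M / e <= n%:R by near: n; exact: nbhs_infty_ger.
have nR : (0 : R) < n%:R by rewrite ltr0n.
rewrite ler_pdivrMr//.
rewrite (le_trans (F_n_le_fe_lim n0 l0 th))// -/k -/C.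
have h1 : k * ln n.+1%:R <= k * (ln a + (n%:R + 1) / a).
  by rewrite ler_wpM2l ?ln_succ_le// ltW.
have h2 : M <= n%:R * (e / 3).
  have -> : M = 3 * M / e * (e / 3) by field; rewrite gt_eqF.
  by rewrite ler_wpM2r// divr_ge0// ltW.
have h3 : n%:R * (theta * C) <= n%:R * (e / 3) by rewrite ler_wpM2l// ltW.
have h4 : n%:R * (k / a) <= n%:R * (e / 3) by rewrite ler_wpM2l// ltW.
have E : k * (ln a + (n%:R + 1) / a) = k * (ln a + a^-1) + n%:R * (k / a).
  by move: (ln a) => x; field; rewrite gt_eqF.
rewrite E in h1; rewrite /M in h2.
have -> : (fe_lim lambda + e) * n%:R = n%:R * fe_lim lambda + n%:R * (e / 3) + n%:R * (e / 3) + n%:R * (e / 3).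
  by field.
move: h1 h2 h3 h4; move: (k * ln _) (k * (ln a + a^-1)) (n%:R * (k / a)) (n%:R * (theta * C)) (n%:R * (e / 3)) (n%:R * fe_lim lambda).
by move=> *; lra.
Unshelve. all: by end_near.
Qed.

Lemma F_n_liminf lambda q e : 0 <= lambda -> 0 <= q -> 0 < e ->
  \forall n \near \oo, rs_potential lambda q - e <= F_n eps n lambda / n%:R.
Proof.
move=> l0 q0 e0; near=> n.
have n0 : (0 < n)%N by near: n; exact: nbhs_infty_gt.
have Mn : lambda / 4 / e <= n%:R by near: n; exact: nbhs_infty_ger.
have nR : (0 : R) < n%:R by rewrite ltr0n.
rewrite ler_pdivlMr//.
have := F_n_lower eps01 n0 l0 q0.
rewrite ler_pdivrMr// in Mn.
rewrite /rs_potential mulrBl mulrBl [psi _ _ * _]mulrC [lambda * _ / 4 * _]mulrC [e * _]mulrC; lra.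
Unshelve. all: by end_near.
Qed.

Lemma cvg_F_n lambda : 0 <= lambda ->
  F_n eps n lambda / n%:R @[n --> \oo] --> fe_lim lambda.
Proof.
move=> l0; apply/cvgrPdist_le => e e0.
have [q [q0 _ E _]] := fe_lim_attained l0.
have h1 := F_n_limsup l0 e0; have h2 := F_n_liminf l0 q0 e0; rewrite E in h2.
near=> n; rewrite distrC ler_norml.
have : F_n eps n lambda / n%:R <= fe_lim lambda + e by near: n.
have : fe_lim lambda - e <= F_n eps n lambda / n%:R by near: n.
by move: (_ / _) => x u v; apply/andP; split; lra.
Unshelve. all: by end_near.
Qed.

(** The lower bound on [F_n] holds for every q >= 0 and [F_n] / n tends to [fe_lim], so the limit
    also dominates the potential beyond [0, 1]. *)
Lemma rs_potential_le_fe_lim lambda q : 0 <= lambda -> 0 <= q -> rs_potential lambda q <= fe_lim lambda.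
Proof.
move=> l0 q0; apply/ler_addgt0Pr => e e0; rewrite -lerBlDr.
apply: (ler_cvg_to (cvg_cst _) (cvg_F_n l0)).
exact: F_n_liminf.
Qed.

(* By the envelope theorem a maximiser q yields the slope q^2/4 of [fe_lim]. *)
Lemma maximizer_subgradient lambda q : 0 < lambda -> 0 <= q ->
  rs_potential lambda q = fe_lim lambda ->
  forall t, 0 < t -> q ^+ 2 / 4 * (lambda * (t - lambda) / t) <= fe_lim t - fe_lim lambda.
Proof.
(* The trial value lambda q / t at t keeps the argument lambda q of [psi]; the two values of [psi]
   cancel and only quadratic terms are compared. *)
move=> l0 q0 E t t0; have := @rs_potential_le_fe_lim t (lambda * q / t) (ltW t0).
rewrite divr_ge0 ?mulr_ge0 ?(ltW l0) ?(ltW t0)// => /(_ isT).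
rewrite -E /rs_potential [t * (_ / t)]mulrC divfK ?gt_eqF//.
move: (psi _ _) (fe_lim t) => p x h.
have -> : q ^+ 2 / 4 * (lambda * (t - lambda) / t) =
   lambda * q ^+ 2 / 4 - t * (lambda * q / t) ^+ 2 / 4 by field; rewrite gt_eqF.
lra.
Qed.

Lemma D_n_chord n s t : 0 < s -> 0 < t ->
  F_n eps n s / n%:R + (t - s) * (D_n eps n s / n%:R) <= F_n eps n t / n%:R.
Proof.
move=> s0 t0; rewrite mulrA -mulrDl; apply: ler_wpM2r; first by rewrite invr_ge0.
have p0 := @prior_ge0 R eps n eps01; have pp := @sum_prior_gt0 R eps n.
case: (ltgtP s t) => [st|ts|->]; last by rewrite subrr mul0r addr0.
  have /andP[h _] := free_energy_chord p0 pp (@edge_dirs R n) (fun=> 0) (ltW s0) st.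
  by rewrite -lerBrDl.
have /andP[_ h] := free_energy_chord p0 pp (@edge_dirs R n) (fun=> 0) (ltW t0) ts.
rewrite -lerBrDl -opprB mulNr lerNl opprB; exact: h.
Qed.

Lemma cvg_derivative_ae : exists N : set R, countable N /\
  forall lambda, 0 < lambda -> ~ N lambda -> exists q, [/\ 0 <= q,
    rs_potential lambda q = fe_lim lambda,
    (forall q', 0 <= q' -> rs_potential lambda q' = fe_lim lambda -> q' = q) &
    D_n eps n lambda / n%:R @[n --> \oo] --> q ^+ 2 / 4].
Proof.
exists [set s | 0 < s /\ exists r r', [/\ r < r', subgradient fe_lim s r & subgradient fe_lim s r']].
split; first exact: countable_nonunique_subgradient.
move=> lambda l0 Nl.
have cF s : 0 < s -> F_n eps n s / n%:R @[n --> \oo] --> fe_lim s.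
  by move=> s0; apply: cvg_F_n; exact: ltW.
have sub q : 0 <= q -> rs_potential lambda q = fe_lim lambda -> subgradient fe_lim lambda (q ^+ 2 / 4).
  move=> q0 E; apply: (subgradient_harmonic D_n_chord cF l0).
  exact: maximizer_subgradient.
have uniq r r' : subgradient fe_lim lambda r -> subgradient fe_lim lambda r' -> r = r'.
  move=> sr sr'; case: (ltgtP r r') => // rr'; exfalso; apply: Nl; split=> //.
    by exists r, r'.
  by exists r', r.
have [q [q0 _ E _]] := fe_lim_attained (ltW l0).
exists q; split=> //.
- move=> q' q'0 E'; have := uniq _ _ (sub q' q'0 E') (sub q q0 E).
  move/(congr1 (fun x => x * 4)); rewrite !divfK//.
  by move/eqP; rewrite eqrXn2// => /eqP.
- apply: (cvg_derivative D_n_chord cF l0); first exact: sub.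
  by move=> r' sr'; apply: uniq => //; exact: sub.
Qed.

End limiting_free_energy.

(** * The law of the observation *)

Lemma good_norm {R : realType} {S : finType} (Psi : (S -> R) -> R) :
  good Psi -> good (fun v => `|Psi v|).
Proof.
move=> [mP [A [B [A0 B0 PAB]]]]; split.
  by move=> ? ? ? ?; apply: measurableT_comp => //; exact: mP.
by exists A, B; split => // w; rewrite normr_id.
Qed.

Section gauss_vec.
Context {R : realType}.
Local Open Scope ereal_scope.

Definition cons_pair K (p : R * K.-tuple R) : K.+1.-tuple R := [tuple of p.1 :: p.2].

Lemma measurable_cons_pair K : measurable_fun [set: R * K.-tuple R] (@cons_pair K).
Proof. exact: measurable_cons. Qed.

HB.instance Definition _ K :=
  isMeasurableFun.Build _ _ _ _ (@cons_pair K) (@measurable_cons_pair K).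

(** Built one coordinate at a time, so that one-variable Gaussian identities extend by induction on
    the dimension. *)
Fixpoint gauss_vec K : probability (K.-tuple R) R :=
  match K with
  | 0 => \d_([tuple] : 0.-tuple R)
  | K'.+1 => distribution (std_normal \x gauss_vec K') (@cons_pair K')
  end.

Lemma ge0_integral_gauss_vec0 (f : 0.-tuple R -> \bar R) :
  (forall t, 0 <= f t) -> measurable_fun [set: 0.-tuple R] f ->
  \int[gauss_vec 0]_t f t = f [tuple].
Proof. by move=> f0 mf; rewrite integral_dirac// diracT mul1e. Qed.

Lemma measurable_cons_slice K (f : K.+1.-tuple R -> \bar R) z :
  measurable_fun [set: K.+1.-tuple R] f ->
  measurable_fun [set: K.-tuple R] (fun t => f [tuple of z :: t]).
Proof. by move=> mf; apply: (measurableT_comp mf); exact: measurable_cons. Qed.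

Lemma ge0_integral_gauss_vecS K (f : K.+1.-tuple R -> \bar R) :
  (forall t, 0 <= f t) -> measurable_fun [set: K.+1.-tuple R] f ->
  \int[gauss_vec K.+1]_t f t =
  \int[std_normal]_z \int[gauss_vec K]_t f [tuple of z :: t].
Proof.
move=> f0 mf; rewrite /= ge0_integral_distribution//.
rewrite -(@fubini_tonelli1 _ _ _ _ _ std_normal (gauss_vec K) (f \o @cons_pair K)) => [//||p].
  by apply: (measurableT_comp mf); exact: measurable_cons_pair.
exact: f0.
Qed.

Lemma measurable_gauss_vec_slice K (f : K.+1.-tuple R -> \bar R) :
  (forall t, 0 <= f t) -> measurable_fun [set: K.+1.-tuple R] f ->
  measurable_fun [set: R] (fun z => \int[gauss_vec K]_t f [tuple of z :: t]).
Proof.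
move=> f0 mf.
apply: (measurable_fun_fubini_tonelli_F (m2 := gauss_vec K) (f \o @cons_pair K)) => [|p].
  by apply: (measurableT_comp mf); exact: measurable_cons_pair.
exact: f0.
Qed.

Lemma gauss_vec_box K (A : 'I_K -> set R) : (forall k, measurable (A k)) ->
  gauss_vec K [set t | forall k, A k (tnth t k)] = \prod_(k < K) std_normal (A k).
Proof.
elim: K A => [|K IH] A mA.
  by rewrite big_ord0/= diracE mem_set// => -[].
pose B := [set t : K.-tuple R | forall k, A (lift ord0 k) (tnth t k)].
have mB : measurable B.
  rewrite (_ : B = \bigcap_(k in [set: 'I_K]) ((tnth (T:=R))^~ k @^-1` A (lift ord0 k))).
    apply: fin_bigcap_measurable => // k _.
    by rewrite -[X in measurable X]setTI; apply: measurable_tnth.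
  by apply/seteqP; split => t /= H k; [move=> _|]; exact: H.
rewrite big_ord_recl -(IH (fun k => A (lift ord0 k)))// -/B.
transitivity ((std_normal \x gauss_vec K)%E (A ord0 `*` B)); last first.
  by rewrite product_measure1E.
transitivity ((std_normal \x gauss_vec K)%E
  (@cons_pair K @^-1` [set t | forall k, A k (tnth t k)])); first by [].
congr (_ _); apply/seteqP; split => -[z t]/=.
  move=> H; split; first by have := H ord0; rewrite tnth0.
  by move=> k; have := H (lift ord0 k); rewrite tnthS.
move=> [H0 H] k; case: (unliftP ord0 k) => [j ->|->]; first by rewrite tnthS; exact: H.
by rewrite tnth0.
Qed.

Definition dot K (a t : K.-tuple R) : R := (\sum_(k < K) tnth a k * tnth t k)%R.

Lemma dot_cons K x y (a t : K.-tuple R) :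
  dot [tuple of x :: a] [tuple of y :: t] = (x * y + dot a t)%R.
Proof.
rewrite /dot big_ord_recl !tnth0; congr (_ + _)%R.
by apply: eq_bigr => k _; rewrite !tnthS.
Qed.

Lemma measurable_dot K (a : K.-tuple R) : measurable_fun [set: K.-tuple R] (dot a).
Proof.
apply: measurable_sum => k; apply: measurable_funM => //; exact: measurable_tnth.
Qed.

Definition addT K (t a : K.-tuple R) : K.-tuple R :=
  [tuple (tnth t k + tnth a k)%R | k < K].

Lemma addT_cons K x y (a t : K.-tuple R) :
  addT [tuple of y :: t] [tuple of x :: a] = [tuple of (y + x)%R :: addT t a].
Proof.
apply: eq_from_tnth => k; rewrite tnth_mktuple.
by case: (unliftP ord0 k) => [j ->|->]; rewrite ?tnthS ?tnth0// tnth_mktuple.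
Qed.

Lemma measurable_addT K (a : K.-tuple R) : measurable_fun [set: K.-tuple R] (fun t => addT t a).
Proof.
apply/measurable_fun_tnthP => k.
rewrite (_ : _ \o _ = fun t => (tnth t k + tnth a k)%R).
  by apply: measurable_funD => //; exact: measurable_tnth.
by apply/funext => t /=; rewrite tnth_mktuple.
Qed.

(** Density of the Gaussian vector of mean [a] with respect to the centred one. *)
Definition gauss_tilt K (a t : K.-tuple R) : R := expR (dot a t - dot a a / 2).

Lemma measurable_gauss_tilt K (a : K.-tuple R) :
  measurable_fun [set: K.-tuple R] (gauss_tilt a).
Proof.
by apply: measurableT_comp => //; apply: measurable_funB => //; exact: measurable_dot.
Qed.

Lemma ge0_gauss_vec_shift K (a : K.-tuple R) (f : K.-tuple R -> \bar R) :
  (forall t, 0 <= f t) -> measurable_fun [set: K.-tuple R] f ->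
  \int[gauss_vec K]_t f (addT t a) = \int[gauss_vec K]_t (f t * (gauss_tilt a t)%:E).
Proof.
elim: K a f => [|K IH] a f f0 mf.
  have m1 : measurable_fun [set: 0.-tuple R] (fun t => f (addT t a)).
    by apply: (measurableT_comp mf); exact: measurable_addT.
  have m2 : measurable_fun [set: 0.-tuple R] (fun t => f t * (gauss_tilt a t)%:E).
    by apply: emeasurable_funM => //; apply/measurable_EFinP; exact: measurable_gauss_tilt.
  rewrite !ge0_integral_gauss_vec0//.
    rewrite /gauss_tilt /dot !big_ord0 mul0r subr0 expR0 mule1; congr f.
    by apply: eq_from_tnth => -[].
  by move=> t; rewrite mule_ge0// lee_fin expR_ge0.
case/tupleP: a => x a.
have m1 : measurable_fun [set: K.+1.-tuple R] (fun t => f (addT t [tuple of x :: a])).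
  by apply: (measurableT_comp mf); exact: measurable_addT.
have m2 : measurable_fun [set: K.+1.-tuple R]
    (fun t => f t * (gauss_tilt [tuple of x :: a] t)%:E).
  by apply: emeasurable_funM => //; apply/measurable_EFinP; exact: measurable_gauss_tilt.
have f20 t : 0 <= f t * (gauss_tilt [tuple of x :: a] t)%:E.
  by rewrite mule_ge0// lee_fin expR_ge0.
rewrite (ge0_integral_gauss_vecS (fun t => f0 _) m1) (ge0_integral_gauss_vecS f20 m2).
pose g z := \int[gauss_vec K]_t (f [tuple of z :: t] * (gauss_tilt a t)%:E).
have mslice z : measurable_fun [set: K.-tuple R]
    (fun t => f [tuple of z :: t] * (gauss_tilt a t)%:E).
  apply: emeasurable_funM; first exact: measurable_cons_slice.
  by apply/measurable_EFinP; exact: measurable_gauss_tilt.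
have sl0 z (t : K.-tuple R) : 0 <= f [tuple of z :: t] * (gauss_tilt a t)%:E.
  by rewrite mule_ge0// lee_fin expR_ge0.
transitivity (\int[std_normal]_z g (z + x)%R).
  apply: eq_integral => z _; rewrite /g.
  rewrite -(IH a (fun t => f [tuple of (z + x)%R :: t]))//; last exact: measurable_cons_slice.
  by apply: eq_integral => t _; rewrite addT_cons.
have g0 z : 0 <= g z by exact: integral_ge0.
have mg : measurable_fun [set: R] g.
  (* A tilt with zero first coordinate exhibits [g] as a partial integral of a function of K + 1
     coordinates, so Tonelli gives measurability. *)
  pose h (t : K.+1.-tuple R) := f t * (gauss_tilt [tuple of 0%R :: a] t)%:E.
  have mh : measurable_fun [set: K.+1.-tuple R] h.
    by apply: emeasurable_funM => //; apply/measurable_EFinP; exact: measurable_gauss_tilt.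
  have h0 t : 0 <= h t by rewrite mule_ge0// lee_fin expR_ge0.
  have -> : g = fun z => \int[gauss_vec K]_t h [tuple of z :: t].
    apply/funext => z; apply: eq_integral => t _.
    by rewrite /h /gauss_tilt !dot_cons mulr0 mul0r !add0r.
  exact: measurable_gauss_vec_slice.
apply: (eq_trans (ge0_std_normal_shift x g0 mg)); apply: eq_integral => z _.
have e0 : 0 <= (expR (x * z - x ^+ 2 / 2))%:E by rewrite lee_fin expR_ge0.
rewrite -[LHS](ge0_integralZr _ measurableT (mslice z) (fun t _ => sl0 z t) e0).
apply: eq_integral => t _; rewrite -muleA -EFinM -expRD /gauss_tilt !dot_cons.
by congr (_ * (expR _)%:E); move: (dot a t) (dot a a) => u v; field.
Qed.

Local Close Scope ereal_scope.

Definition linform {S : finType} K (L : K.-tuple (S -> R)) (t : K.-tuple R) (x : S) : R :=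
  \sum_(k < K) tnth t k * tnth L k x.

Lemma linform_cons {S : finType} K a (L : K.-tuple (S -> R)) z (t : K.-tuple R) x :
  linform [tuple of a :: L] [tuple of z :: t] x = z * a x + linform L t x.
Proof.
rewrite /linform big_ord_recl !tnth0; congr (_ + _)%R.
by apply: eq_bigr => k _; rewrite !tnthS.
Qed.

Lemma measurable_linform {S : finType} K (L : K.-tuple (S -> R)) x :
  measurable_fun [set: K.-tuple R] (fun t => linform L t x).
Proof.
apply: measurable_sum => k; apply: measurable_funM => //; exact: measurable_tnth.
Qed.

(** Identifies the iterated operators with one integral: the field is realised as a linear form in a
    Gaussian tuple. *)
Lemma ge0_integral_GG {S : finType} K (L : K.-tuple (S -> R)) Psi u :
  good Psi -> (forall v, 0 <= Psi v) ->
  (\int[gauss_vec K]_t (Psi (fun x => u x + linform L t x)%R)%:E = (GG L Psi u)%:E)%E.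
Proof.
move=> gP P0; elim: K L u => [|K IH] L u.
  rewrite ge0_integral_gauss_vec0.
  - rewrite (tuple0 L)/=; congr (Psi _)%:E; apply/funext => x.
    by rewrite /linform big_ord0 addr0.
  - by move=> t; rewrite lee_fin.
  - apply/measurable_EFinP; apply: gP.1 => x.
    by apply: measurable_funD => //; exact: measurable_linform.
case/tupleP: L => a L.
rewrite ge0_integral_gauss_vecS.
- rewrite /= G_EFin; last exact: good_GG.
  apply: eq_integral => z _; rewrite -IH; apply: eq_integral => t _.
  by congr (Psi _)%:E; apply/funext => x; rewrite linform_cons addrA.
- by move=> t; rewrite lee_fin.
- apply/measurable_EFinP; apply: gP.1 => x.
  by apply: measurable_funD => //; exact: measurable_linform.
Qed.

Lemma integrable_GG {S : finType} K (L : K.-tuple (S -> R)) Psi u : good Psi ->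
  (gauss_vec K).-integrable [set: K.-tuple R]
    (fun t => (Psi (fun x => u x + linform L t x))%:E).
Proof.
move=> gP; apply/integrableP; split.
  apply/measurable_EFinP; apply: gP.1 => x.
  by apply: measurable_funD => //; exact: measurable_linform.
have := ge0_integral_GG L u (good_norm gP) (fun v => normr_ge0 _).
by move=> /= ->; exact: ltry.
Qed.

Lemma integral_GG {S : finType} K (L : K.-tuple (S -> R)) Psi u : good Psi ->
  (\int[gauss_vec K]_t (Psi (fun x => u x + linform L t x)%R)%:E = (GG L Psi u)%:E)%E.
Proof.
move=> gP; have gN := good_norm gP.
have gPN : good (fun v => Psi v + `|Psi v|) by exact: goodD.
transitivity (\int[gauss_vec K]_t ((Psi (fun x => u x + linform L t x)%R
    + `|Psi (fun x => u x + linform L t x)%R|)%:E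
    - (`|Psi (fun x => u x + linform L t x)%R|)%:E))%E.
  by apply: eq_integral => t _; rewrite -EFinB addrK.
rewrite integralB//; first last.
- exact: (integrable_GG L u gN).
- exact: (integrable_GG L u gPN).
rewrite (ge0_integral_GG L u gPN) ?(ge0_integral_GG L u gN) => [|v|v].
- by rewrite GGD// -EFinB addrK.
- exact: normr_ge0.
- by rewrite -lerBlDl sub0r -normrN ler_norm.
Qed.

End gauss_vec.

Lemma integral_split {R : realType} d (U : measurableType d) (Q : {measure set U -> \bar R})
    (g : U -> R) : Q.-integrable [set: U] (EFin \o g) ->
  (\int[Q]_y (g y)%:E = \int[Q]_y (g y + `|g y|)%:E - \int[Q]_y (`|g y|)%:E)%E /\
  (\int[Q]_y (g y + `|g y|)%:E \is a fin_num /\ \int[Q]_y (`|g y|)%:E \is a fin_num)%E.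
Proof.
move=> ig; have ia : Q.-integrable [set: U] (EFin \o (fun y => `|g y|)).
  exact: (integrable_abse ig).
have iD : Q.-integrable [set: U] (EFin \o (fun y => g y + `|g y|)).
  exact: (integrableD measurableT ig ia).
split; last by split; exact: integrable_fin_num.
rewrite -(integralB measurableT iD ia); apply: eq_integral => y _.
by rewrite -EFinB addrK.
Qed.

Lemma add_norm_ge0 {R : realDomainType} (x : R) : 0 <= x + `|x|.
Proof. by rewrite -lerBlDl sub0r -normrN ler_norm. Qed.

Section mixture.
Context {R : realType} {d d'} {T : measurableType d} {T' : measurableType d'}.
Context {I : finType}.
Variables (P : probability T R) (N : probability T' R).
Variables (S : I -> set T) (p : I -> R) (V : T -> T').
Hypothesis mS : forall i, measurable (S i).
Hypothesis tS : trivIset [set: I] S.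
Hypothesis mV : measurable_fun [set: T] V.
Hypothesis p0 : forall i, 0 <= p i.
Hypothesis p1 : \sum_i p i = 1.
Hypothesis PS : forall i B, measurable B -> P (S i `&` V @^-1` B) = ((p i)%:E * N B)%E.
Local Open Scope ereal_scope.

Let ge0_integral_restr i (g : T -> \bar R) :
  measurable_fun [set: T] g -> (forall w, 0 <= g w) ->
  \int[mrestr P (mS i)]_w g w = \int[P]_(w in S i) g w.
Proof.
move=> mg g0; rewrite (@ge0_integral_density _ _ _ (mrestr P (mS i)) P (\1_(S i)))//.
- rewrite [RHS]integral_mkcond; apply: eq_integral => w _; rewrite /patch indicE.
  by case: (w \in S i); rewrite ?mule1 ?mule0.
- by move=> A mA; rewrite integral_indic// setIC.
Qed.

Let ge0_cond i (g : T' -> \bar R) :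
  measurable_fun [set: T'] g -> (forall y, 0 <= g y) ->
  \int[P]_(w in S i) g (V w) = (p i)%:E * \int[N]_y g y.
Proof.
move=> mg g0; rewrite -ge0_integral_restr//; last exact: measurableT_comp.
pose c : {nonneg R} := NngNum (p0 i).
rewrite (_ : (p i)%:E = c%:num%:E)// -(ge0_integral_mscale N measurableT c mg)//.
rewrite -(ge0_integral_pushforward mV (mrestr P (mS i)) measurableT mg (fun y _ => g0 y)).
apply: eq_measure_integral => A mA _.
by transitivity (P (S i `&` V @^-1` A)); [rewrite setIC|exact: PS].
Qed.

Let D := \big[setU/set0]_(i : I) S i.

Let mD : measurable D. Proof. exact: bigsetU_measurable. Qed.

Let PD : P (~` D) = 0.
Proof.
rewrite probability_setC// /D.
have -> : P (\big[setU/set0]_(i : I) S i) = 1; last by rewrite subee.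
rewrite -[LHS]mul1e -(integral_cst P mD) ge0_integral_bigsetU//; first last.
- exact: (sub_trivIset _ tS).
- exact: index_enum_uniq.
transitivity (\sum_(i : I) (p i)%:E); last by rewrite sumEFin p1.
apply: eq_bigr => i _; have := PS i measurableT.
by rewrite preimage_setT setIT probability_setT mule1 integral_cst// mul1e.
Qed.

(** The disjoint events [S i] have total probability 1, so the integral splits over them up to a
    null set; on each, the image of [P] under [V] is p i times [N]. *)
Lemma ge0_integral_mixture (F : T -> \bar R) (f : I -> T' -> \bar R) :
  measurable_fun [set: T] F -> (forall w, 0 <= F w) ->
  (forall i, measurable_fun [set: T'] (f i)) -> (forall i y, 0 <= f i y) ->
  (forall i w, S i w -> F w = f i (V w)) ->
  \int[P]_w F w = \sum_i (p i)%:E * \int[N]_y f i y.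
Proof.
move=> mF F0 mf f0 Ff.
rewrite (ge0_negligible_integral _ measurableT mF _ PD)//; last exact: measurableC.
rewrite setTD setCK ge0_integral_bigsetU//.
- apply: eq_bigr => i _; rewrite -ge0_cond//; apply: eq_integral => w.
  by rewrite inE; exact: Ff.
- exact: index_enum_uniq.
- exact: (sub_trivIset _ tS).
- exact: measurable_funTS.
Qed.

Lemma integrable_mixture (F : T -> R) (f : I -> T' -> R) :
  measurable_fun [set: T] F ->
  (forall i, N.-integrable [set: T'] (EFin \o f i)) ->
  (forall i w, S i w -> F w = f i (V w)) ->
  P.-integrable [set: T] (EFin \o F).
Proof.
move=> mF intf Ff; apply/integrableP; split; first exact/measurable_EFinP.
rewrite (@ge0_integral_mixture _ (fun i y => `|(f i y)%:E|))//.
- apply: lte_sum_pinfty => i _; rewrite lte_mul_pinfty ?lee_fin//.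
  by have /integrableP[] := intf i.
- by apply: measurableT_comp => //; exact/measurable_EFinP.
- move=> i; apply: measurableT_comp => //.
  exact: (measurable_int N (intf i)).
- by move=> i w Siw /=; rewrite (Ff i).
Qed.

Lemma integral_mixture (F : T -> R) (f : I -> T' -> R) :
  measurable_fun [set: T] F ->
  (forall i, N.-integrable [set: T'] (EFin \o f i)) ->
  (forall i w, S i w -> F w = f i (V w)) ->
  \int[P]_w (F w)%:E = \sum_i (p i)%:E * \int[N]_y (f i y)%:E.
Proof.
move=> mF intf Ff; have mf i : measurable_fun [set: T'] (f i).
  by apply/measurable_EFinP; exact: (measurable_int N (intf i)).
have intF := integrable_mixture mF intf Ff.
have [-> _] := integral_split intF.
have pos := @add_norm_ge0 R.
rewrite (@ge0_integral_mixture _ (fun i y => (f i y + `|f i y|)%:E)); first last.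
- by move=> i w Siw /=; rewrite (Ff i).
- by move=> i y; rewrite lee_fin.
- by move=> i; apply/measurable_EFinP; apply: measurable_funD => //; exact: measurableT_comp.
- by move=> w; rewrite lee_fin.
- by apply/measurable_EFinP; apply: measurable_funD => //; exact: measurableT_comp.
rewrite (@ge0_integral_mixture _ (fun i y => (`|f i y|)%:E)); first last.
- by move=> i w Siw /=; rewrite (Ff i).
- by move=> i y; rewrite lee_fin.
- by move=> i; apply/measurable_EFinP; exact: measurableT_comp.
- by move=> w; rewrite lee_fin.
- by apply/measurable_EFinP; exact: measurableT_comp.
rewrite [RHS](eq_bigr (fun i => ((p i) * (fine (\int[N]_y (f i y + `|f i y|)%:E)
    - fine (\int[N]_y (`|f i y|)%:E)))%:E)); last first.
  move=> i _; have [-> [h1 h2]] := integral_split (intf i).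
  by rewrite EFinM EFinB !fineK.
rewrite [X in X - _ = _](eq_bigr (fun i => ((p i) * fine (\int[N]_y (f i y + `|f i y|)%:E))%:E)); last first.
  by move=> i _; have [_ [h1 h2]] := integral_split (intf i); rewrite EFinM fineK.
rewrite [X in _ - X = _](eq_bigr (fun i => ((p i) * fine (\int[N]_y (`|f i y|)%:E))%:E)); last first.
  by move=> i _; have [_ [h1 h2]] := integral_split (intf i); rewrite EFinM fineK.
rewrite !sumEFin -EFinB -sumrB; congr (_%:E); apply: eq_bigr => i _.
by rewrite mulrBr.
Qed.

End mixture.

Section tuple_measure.
Context {R : realType} {d} {T : measurableType d} {K : nat}.
Local Open Scope ereal_scope.

Definition box (A : 'I_K -> set T) : set (K.-tuple T) := [set t | forall k, A k (tnth t k)].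

Lemma measurable_box A : (forall k, measurable (A k)) -> measurable (box A).
Proof.
move=> mA; rewrite (_ : box A = \bigcap_(k in [set: 'I_K]) ((tnth (T:=T))^~ k @^-1` A k)).
  apply: fin_bigcap_measurable => // k _.
  by rewrite -[X in measurable X]setTI; apply: measurable_tnth.
by apply/seteqP; split => t /= H k; [move=> _|]; exact: H.
Qed.

Lemma tuple_measure_unique (m1 m2 : {measure set (K.-tuple T) -> \bar R}) :
  (forall A, (forall k, measurable (A k)) -> m1 (box A) = m2 (box A)) ->
  m1 [set: K.-tuple T] < +oo ->
  forall B, measurable B -> m1 B = m2 B.
Proof.
move=> m12 m1fin B mB.
pose G : set (set (K.-tuple T)) := [set box A | A in [set A | forall k, measurable (A k)]].
apply: (measure_unique G (fun=> setT)) => //.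
- apply/seteqP; split.
    apply: smallest_sub; first exact: smallest_sigma_algebra.
    apply: subset_trans (@sub_sigma_algebra _ _ _).
    move=> C /=; rewrite -bigcup_seq/= => -[k _ [A mA <-]].
    exists (fun j => if j == k then A else setT) => /=.
      by move=> j; case: (j == k).
    apply/seteqP; split => t /=.
      by move=> H; have := H k; rewrite eqxx.
    by move=> [_ At] j; case: ifPn => // /eqP ->.
  apply: smallest_sub; first exact: sigma_algebra_measurable.
  by move=> _ [A mA <-]; exact: measurable_box.
- move=> _ _ [A mA <-] [A' mA' <-]; exists (fun k => A k `&` A' k).
    by move=> k; exact: measurableI.
  by apply/seteqP; split => t /=; [move=> H; split => k; have [] := H k|move=> [H H'] k; split].
- by move=> _; exists (fun=> setT) => //; apply/seteqP; split.
- by apply/seteqP; split => t // _; exists 0%N.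
- by move=> _ [A mA <-]; exact: m12.
Qed.

End tuple_measure.

Lemma bernoulli_law1 {R : realType} (p : R) (b : bool) : 0 < p <= 1 ->
  bernoulli_law p [set b%:R] = (bern p b)%:E.
Proof.
move=> /andP[p0 p1]; rewrite /bernoulli_law /pushforward.
rewrite (_ : _ @^-1` _ = [set b]); last first.
  apply/seteqP; split => c /=; last by move=> ->.
  by case: b; case: c => //= /eqP; rewrite ?oner_eq0// eq_sym oner_eq0.
by rewrite /bernoulli_prob (ltW p0) p1/= fsbig_set1.
Qed.

Section density_transfer.
Context {R : realType} {d d'} {U : measurableType d} {U' : measurableType d'}.
Variables (Q : {measure set U -> \bar R}) (Q' : {measure set U' -> \bar R}).
Variables (phi : U -> U') (r : U' -> R).
Hypothesis mphi : measurable_fun [set: U] phi.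
Hypothesis r0 : forall y, 0 <= r y.
Local Open Scope ereal_scope.
Hypothesis H : forall f : U' -> \bar R, (forall y, 0 <= f y) ->
  measurable_fun [set: U'] f -> \int[Q]_u f (phi u) = \int[Q']_y (f y * (r y)%:E).

Lemma integral_transfer (g : U' -> R) : measurable_fun [set: U'] g ->
  Q'.-integrable [set: U'] (fun y => (g y * r y)%:E) ->
  Q.-integrable [set: U] (fun u => (g (phi u))%:E) /\
  \int[Q]_u (g (phi u))%:E = \int[Q']_y (g y * r y)%:E.
Proof.
move=> mg ig.
have mN : measurable_fun [set: U'] (fun y => `|g y|%:E).
  by apply/measurable_EFinP; exact: measurableT_comp.
have mD : measurable_fun [set: U'] (fun y => (g y + `|g y|)%:E).
  by apply/measurable_EFinP; apply: measurable_funD => //; exact: measurableT_comp.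
have N0 y : 0 <= `|g y|%:E by rewrite lee_fin.
have D0 y : 0 <= (g y + `|g y|)%:E by rewrite lee_fin add_norm_ge0.
have E1 : \int[Q]_u `|g (phi u)|%:E = \int[Q']_y `|g y * r y|%:E.
  rewrite (H N0 mN); apply: eq_integral => y _.
  by rewrite normrM EFinM (ger0_norm (r0 y)).
have E2 : \int[Q]_u (g (phi u) + `|g (phi u)|)%:E = \int[Q']_y (g y * r y + `|g y * r y|)%:E.
  rewrite (H D0 mD); apply: eq_integral => y _.
  by rewrite -EFinM normrM mulrDl (ger0_norm (r0 y)).
have igphi : Q.-integrable [set: U] (fun u => (g (phi u))%:E).
  apply/integrableP; split; first by apply/measurable_EFinP; exact: measurableT_comp.
  by have /integrableP[_] := ig; rewrite /= -E1.
split=> //; have [-> _] := integral_split igphi; have [-> _] := integral_split ig.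
by rewrite E1 E2.
Qed.

End density_transfer.

Lemma gauss_vec_shift {R : realType} K (a : K.-tuple R) (g : K.-tuple R -> R) :
  measurable_fun [set: K.-tuple R] g ->
  (gauss_vec K).-integrable [set: K.-tuple R] (fun y => (g y * gauss_tilt a y)%:E) ->
  (gauss_vec K).-integrable [set: K.-tuple R] (fun t => (g (addT t a))%:E) /\
  (\int[gauss_vec K]_t (g (addT t a))%:E =
   \int[gauss_vec K]_y (g y * gauss_tilt a y)%:E)%E.
Proof.
apply: (integral_transfer (measurable_addT a) (fun y => expR_ge0 _)) => f f0 mf.
exact: ge0_gauss_vec_shift.
Qed.

Lemma enum_map_enum_val (I : finType) : enum I = [seq enum_val k | k <- enum 'I_#|I|].
Proof.
case: (pickP I) => [x0 _|none]; last first.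
  have I0 : #|I| = 0%N by exact: eq_card0.
  by rewrite [LHS]size0nil -?cardE// [RHS]size0nil// size_map size_enum_ord.
apply: (@eq_from_nth _ x0); first by rewrite size_map size_enum_ord cardE.
move=> i; rewrite -cardE => iK.
rewrite (nth_map (Ordinal iK)) ?size_enum_ord// (enum_val_nth x0).
by rewrite nth_enum_ord.
Qed.

Section kl_density.
Context {R : realType} {d} {T : measurableType d}.
Variables (mu nu : probability T R) (f : T -> R).
Hypothesis mf : measurable_fun [set: T] f.
Local Open Scope ereal_scope.
Local Open Scope charge_scope.
Hypothesis muE : forall A, measurable A -> mu A = \int[nu]_(x in A) (expR (f x))%:E.

(** The abstract derivative equals exp f almost everywhere for [nu], hence for [mu] by domination,
    and its logarithm is f. *)
Lemma kl_divergence_density : kl_divergence mu nu = \int[mu]_x (f x)%:E.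
Proof.
have me : measurable_fun [set: T] (fun x => (expR (f x))%:E).
  by apply/measurable_EFinP; exact: measurableT_comp.
have numu : mu `<< nu.
  apply/null_content_dominatesP => A mA nuA0.
  by rewrite muE//; apply: null_set_integral => //; exact: measurable_funTS.
rewrite /kl_divergence; case: pselect => // numu'.
set r := 'd _ '/d _.
have numuc : charge_of_finite_measure mu `<< nu by exact: numu.
have rfin x : r x \is a fin_num by exact: Radon_Nikodym_fin_num.
have mr : measurable_fun [set: T] r.
  exact: (measurable_int nu (Radon_Nikodym_integrable numuc)).
have rE : ae_eq nu setT r (fun x => (expR (f x))%:E).
  apply: integral_ae_eq => //; first exact: Radon_Nikodym_integrable.
  by move=> E _ mE; rewrite -Radon_Nikodym_integral// -muE.
apply: ae_eq_integral => //.
- rewrite (_ : (fun x => lne (r x)) =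
      (fun x => if (fine (r x) <= 0)%R then -oo else (ln (fine (r x)))%:E)).
    apply: measurable_fun_ifT => //.
      apply: measurable_fun_ler => //; exact: (measurableT_comp (@fine_measurable R setT measurableT)).
    apply/measurable_EFinP; apply: measurableT_comp => //.
    exact: (measurableT_comp (@fine_measurable R setT measurableT)).
  by apply/funext => x; rewrite -[in LHS](fineK (rfin x)).
- exact/measurable_EFinP.
- have : ae_eq mu setT r (fun x => (expR (f x))%:E).
    case: rE => N [mN N0 sub]; exists N; split => //.
    by move/null_content_dominatesP : numu; exact.
  by apply: filterS => x /[apply] ->; rewrite lne_EFin ?expR_gt0// expRK.
Qed.

End kl_density.

Section condexp_unique.
Context {R : realType} {d d'} {T : measurableType d} {T' : measurableType d'}.
Context {P : probability T R}.
Variables (V : T -> R) (Y : {RV P >-> T'}).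
Local Open Scope ereal_scope.

(** The event W1 < W2 is the union over rationals q of W1 < q < W2, hence lies in the sigma-algebra
    of [Y]. Both versions have the same integral over it, so their positive difference there
    vanishes almost surely. *)
Let condexp_le (W1 W2 : T -> R) : is_condexp V Y W1 -> is_condexp V Y W2 ->
  {ae P, forall w, (W2 w <= W1 w)%R}.
Proof.
move=> [i1 s1 e1] [i2 s2 e2].
pose A := [set w | (W1 w < W2 w)%R].
have below (q : rat) : exists C, measurable C /\ Y @^-1` C = W1 @^-1` [set x | (x < ratr q)%R].
  have mB : measurable [set x : R | (x < ratr q)%R].
    by rewrite (_ : [set x | _] = `]-oo, ratr q[%classic)//; apply/seteqP; split => x; rewrite /= in_itv.
  by have [C mC] := s1 _ mB; rewrite setTI => ?; exists C.
have above (q : rat) : exists C, measurable C /\ Y @^-1` C = W2 @^-1` [set x | (ratr q < x)%R].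
  have mB : measurable [set x : R | (ratr q < x)%R].
    by rewrite (_ : [set x | _] = `]ratr q, +oo[%classic)//; apply/seteqP; split => x; rewrite /= in_itv/= andbT.
  by have [C mC] := s2 _ mB; rewrite setTI => ?; exists C.
have [C1 C1E] := choice below; have [C2 C2E] := choice above.
pose C := \bigcup_q (C1 q `&` C2 q).
have mC : measurable C.
  apply: bigcupT_measurable_rat => q; apply: measurableI.
    by have [] := C1E q.
  by have [] := C2E q.
have AE : Y @^-1` C = A.
  apply/seteqP; split => w.
    move=> [q _ [h1 h2]]; have [_ E1] := C1E q; have [_ E2] := C2E q.
    have : (Y @^-1` C1 q) w by []; have : (Y @^-1` C2 q) w by [].
    rewrite E1 E2 /A/= => h3 h4; exact: lt_trans h3.
  move=> /rat_in_itvoo[q]; rewrite in_itv/= => /andP[h1 h2].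
  exists q => //; have [_ E1] := C1E q; have [_ E2] := C2E q.
  by split; [have : (Y @^-1` C1 q) w by rewrite E1|have : (Y @^-1` C2 q) w by rewrite E2].
have mA : measurable A.
  by rewrite -AE -[X in measurable X]setTI; exact: measurable_funPT.
have sA : preimage_set_system [set: T] Y measurable A.
  by exists C => //; rewrite setTI.
have i1A := integrableS measurableT mA (@subsetT _ A) i1.
have i2A := integrableS measurableT mA (@subsetT _ A) i2.
have E0 : \int[P]_(w in A) `|(W2 w - W1 w)%:E| = 0.
  transitivity (\int[P]_(w in A) ((W2 w)%:E - (W1 w)%:E)).
    apply: eq_integral => w; rewrite inE /A/= => h.
    by rewrite ger0_norm ?EFinB// subr_ge0 ltW.
  rewrite integralB// e2// e1// subee//.
  by rewrite -e1//; exact: (integrable_fin_num mA i1A).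
have mD : measurable_fun A (fun w => (W2 w - W1 w)%:E).
  apply/measurable_EFinP; apply: measurable_funB; apply/measurable_EFinP.
    exact: (measurable_int P i2A).
  exact: (measurable_int P i1A).
have := (ae_eq_integral_abs P mA mD).1 E0.
apply: filterS => w H; rewrite leNgt; apply/negP => h.
have := H h => /eqP; rewrite eqe subr_eq0 => /eqP h'.
by move: h; rewrite h' ltxx.
Qed.

Lemma is_condexp_unique (W1 W2 : T -> R) : is_condexp V Y W1 -> is_condexp V Y W2 ->
  {ae P, forall w, W1 w = W2 w}.
Proof.
move=> c1 c2; have h1 := condexp_le c1 c2; have h2 := condexp_le c2 c1.
by apply: filterS2 h1 h2 => w h1 h2; apply/eqP; rewrite eq_le h1 h2.
Qed.

(** [condexp] is a choice; exhibiting one version shows that the choice succeeds, and uniqueness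
    identifies it. *)
Lemma condexp_ae_eq (W : T -> R) : is_condexp V Y W ->
  is_condexp V Y (condexp V Y) /\ {ae P, forall w, condexp V Y w = W w}.
Proof.
move=> cW; have c : is_condexp V Y (condexp V Y) by exact: (@xgetPex _ _ [set W | is_condexp V Y W] (ex_intro _ W cW)).
by split=> //; exact: is_condexp_unique.
Qed.

End condexp_unique.

Lemma GG_eval {R : realType} {S : finType} (m : seq (S -> R)) (x : S) v : GG m (fun v => v x) v = v x.
Proof.
elim: m v => //= a m IH v; rewrite /G.
rewrite (_ : (fun z => _) = fun z => v x + a x * z); last first.
  by apply/funext => z; rewrite IH mulrC.
rewrite (gED (tame_cst (v x)) (tameZ (a x) tame_id)).
by rewrite gE_cst gEZ ?gE_id ?mulr0 ?addr0//; exact: tame_id.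
Qed.

(** * The spiked model: likelihood, mutual information and error *)

Section wigner_model.
Context {R : realType} {eps : R} {d} {T : measurableType d} {P : probability T R}.
Context {n : nat} {lambda : R}.
Variables (X : 'I_n -> {RV P >-> R}) (Z : edge n -> {RV P >-> R}).
Hypothesis eps01 : 0 < eps <= 1.
Hypothesis l0 : 0 <= lambda.
Hypothesis lawX : forall i, has_law (X i) (bernoulli_law eps).
Hypothesis lawZ : forall e, has_law (Z e) (normal_prob 0 1).
Hypothesis indepXZ : mutually_independent (signal_and_noise X Z).
Local Notation spin := {ffun 'I_n -> bool}.
Local Notation K := #|{: edge n}|.
Local Notation obs := (observation lambda X Z).
Local Notation pX := (@prior R eps n).
Local Notation dirs := (@edge_dirs R n).
Local Notation l := (scale (Num.sqrt lambda) dirs).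

Let p0 := @prior_ge0 R eps n eps01.
Let prior_pos := @sum_prior_gt0 R eps n.

Let noise : T -> K.-tuple R := tuple_RV (fun k => Z (enum_val k)).

Definition spin_tuple (x : spin) : n.-tuple R := [tuple (x i)%:R | i < n].

(** The entries are bits only almost surely; these disjoint events carry the whole mass and index
    the planted configurations. *)
Definition spin_event (x : spin) : set T := [set w | signal X w = spin_tuple x].

Lemma spin_eventE x :
  spin_event x = \bigcap_(i in [set: 'I_n]) (X i @^-1` [set (x i)%:R]).
Proof.
apply/seteqP; split => w /=.
  by move=> E i _; have := congr1 (@tnth _ _ ^~ i) E; rewrite !tnth_mktuple.
by move=> H; apply: eq_from_tnth => i; rewrite !tnth_mktuple; exact: H.
Qed.

Lemma measurable_spin_event x : measurable (spin_event x).
Proof.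
by rewrite spin_eventE; apply: fin_bigcap_measurable.
Qed.

Lemma spin_tuple_inj : injective spin_tuple.
Proof.
move=> x y E; apply/ffunP => i; have := congr1 (@tnth _ _ ^~ i) E.
rewrite !tnth_mktuple; case: (x i); case: (y i) => //= /eqP.
  by rewrite oner_eq0.
by rewrite eq_sym oner_eq0.
Qed.

Lemma trivIset_spin_event : trivIset [set: spin] spin_event.
Proof.
move=> x y _ _ [w [/= Ex Ey]]; apply: spin_tuple_inj.
by rewrite -Ex -Ey.
Qed.

(** Both sides are finite measures in [B], so boxes suffice, where independence of entries and
    noises gives the product. *)
Lemma spin_noise_law x B : measurable B ->
  P (spin_event x `&` noise @^-1` B) = ((prior eps x)%:E * gauss_vec K B)%E.
Proof.
move=> mB.
have mS := measurable_spin_event x.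
pose c : {nonneg R} := NngNum (@prior_ge0 R eps n eps01 x).
have mN : measurable_fun [set: T] noise by exact: measurable_tuple_RV.
pose m1 : {measure set (K.-tuple R) -> \bar R} := pushforward (mrestr P mS) noise.
pose m2 : {measure set (K.-tuple R) -> \bar R} := mscale c (gauss_vec K).
transitivity (m1 mN B).
  by rewrite /m1/= /pushforward /mrestr setIC.
transitivity (m2 B); last by [].
apply: (@tuple_measure_unique _ _ _ _ (m1 mN) m2) => //; last first.
  have -> : m1 mN setT = P (spin_event x) by rewrite /m1/= /pushforward preimage_setT /mrestr setTI.
  by rewrite (le_lt_trans (probability_le1 P mS))// ltry.
move=> A mA.
pose W (k : 'I_n + edge n) : set R :=
  match k with inl i => [set (x i)%:R] | inr e => A (enum_rank e) end.
have mW k : measurable (W k) by case: k => [i|e]; [exact: measurable_set1|exact: mA].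
transitivity (P (\bigcap_(k in [set` [set: 'I_n + edge n]%SET]) (signal_and_noise X Z k @^-1` W k))).
  rewrite /m1/= /pushforward /mrestr spin_eventE; congr (P _).
  apply/seteqP; split => w /=.
    move=> [H1 H2] [i|e] _ /=; first exact: H2.
    by have := H1 (enum_rank e); rewrite tnth_mktuple enum_rankK.
  move=> H; split.
    move=> k; have := H (inr (enum_val k)); rewrite /= tnth_mktuple enum_valK; apply.
    by rewrite inE.
  by move=> i _; have := H (inl i); rewrite /=; apply; rewrite inE.
rewrite indepXZ// big_sumType/=; congr (_ * _)%E.
  rewrite (eq_bigl xpredT); last by move=> i; rewrite inE.
  transitivity (\prod_(i < n) (bern eps (x i))%:E)%E; last by rewrite prodEFin.
  apply: eq_bigr => i _.
  by have := lawX i (measurable_set1 (x i)%:R); rewrite bernoulli_law1.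
rewrite (eq_bigl xpredT); last by move=> e; rewrite inE.
apply: (eq_trans _ (esym (gauss_vec_box mA))).
rewrite (reindex (@enum_rank (edge n))); last exact/onW_bij/enum_rank_bij.
by apply: eq_bigr => e _; rewrite std_normalE; exact: lawZ.
Qed.

Definition edge_vec (x : spin) : K.-tuple R :=
  [tuple Num.sqrt (lambda / n%:R) *
    ((x (val (enum_val k)).1)%:R * (x (val (enum_val k)).2)%:R) | k < K].

Let mnoise : measurable_fun [set: T] noise. Proof. exact: measurable_tuple_RV. Qed.

Let obsE x w : spin_event x w -> obs w = addT (noise w) (edge_vec x).
Proof.
rewrite spin_eventE => Xw; apply: eq_from_tnth => k.
rewrite !tnth_mktuple /Yedge /XX addrC.
by rewrite -(Xw (val (enum_val k)).1 Logic.I) -(Xw (val (enum_val k)).2 Logic.I).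
Qed.

Let mpair : measurable_fun [set: T] (fun w => (signal X w, obs w)).
Proof. by apply: measurable_fun_pair; exact: measurable_funPT. Qed.

Let mslice {d'} {V : measurableType d'} (f : n.-tuple R * K.-tuple R -> V) s :
  measurable_fun setT f -> measurable_fun [set: K.-tuple R] (fun y => f (s, y)).
Proof. by move=> mf; apply: (measurableT_comp mf); exact: measurable_pair1. Qed.

(** On [spin_event x] the observation is the noise translated by [edge_vec x]. Cameron-Martin trades
    the translation for a weight, and every expectation is taken under pure noise. *)
Lemma ge0_integral_wigner (f : n.-tuple R * K.-tuple R -> \bar R) :
  (forall p, (0 <= f p)%E) -> measurable_fun setT f ->
  (\int[P]_w f (signal X w, obs w) =
   \sum_(x : spin) (pX x)%:E *
     \int[gauss_vec K]_y (f (spin_tuple x, y) * (gauss_tilt (edge_vec x) y)%:E))%E.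
Proof.
move=> f0 mf.
rewrite (ge0_integral_mixture measurable_spin_event trivIset_spin_event mnoise
  p0 (sum_prior eps n) spin_noise_law
  (f := fun x z => f (spin_tuple x, addT z (edge_vec x)))) => //.
- apply: eq_bigr => x _; congr (_ * _)%E.
  by rewrite -(ge0_gauss_vec_shift (edge_vec x)
    (fun y => f0 (spin_tuple x, y)) (mslice (spin_tuple x) mf)).
- exact: (measurableT_comp mf mpair).
- move=> x; apply: (measurableT_comp (mslice (spin_tuple x) mf)).
  exact: measurable_addT.
- by move=> x w Sw; rewrite -(obsE Sw) -Sw.
Qed.

Lemma integral_wigner (g : n.-tuple R * K.-tuple R -> R) :
  measurable_fun setT g ->
  (forall x, (gauss_vec K).-integrable setT
     (fun y => (g (spin_tuple x, y) * gauss_tilt (edge_vec x) y)%:E)) ->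
  P.-integrable setT (fun w => (g (signal X w, obs w))%:E) /\
  (\int[P]_w (g (signal X w, obs w))%:E =
   \sum_(x : spin) (pX x)%:E *
     \int[gauss_vec K]_y (g (spin_tuple x, y) * gauss_tilt (edge_vec x) y)%:E)%E.
Proof.
move=> mg ig.
have H x := gauss_vec_shift (mslice (spin_tuple x) mg) (ig x).
have mF : measurable_fun [set: T] (fun w => g (signal X w, obs w)).
  exact: (measurableT_comp mg mpair).
have Ff x w : spin_event x w ->
    g (signal X w, obs w) = g (spin_tuple x, addT (noise w) (edge_vec x)).
  by move=> Sw; rewrite -(obsE Sw) -Sw.
split.
  apply: (integrable_mixture measurable_spin_event trivIset_spin_event mnoise
    p0 (sum_prior eps n) spin_noise_law mF
    (f := fun x z => g (spin_tuple x, addT z (edge_vec x)))) => // x.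
  by have [] := H x.
rewrite (integral_mixture measurable_spin_event trivIset_spin_event mnoise
    p0 (sum_prior eps n) spin_noise_law mF
    (f := fun x z => g (spin_tuple x, addT z (edge_vec x)))) => // [|x].
  by apply: eq_bigr => x _; have [_ ->] := H x.
by have [] := H x.
Qed.

Let dirs_tuple : K.-tuple (spin -> R) :=
  [tuple (fun x => Num.sqrt lambda * edge_dir (enum_val k) x) | k < K].

Let dirs_tupleE : tval dirs_tuple = l.
Proof.
rewrite /scale /edge_dirs -map_comp.
rewrite (enum_map_enum_val (edge n)) -map_comp.
by rewrite /= -!map_comp.
Qed.

(* Log-likelihood ratio of y under the planted configuration x against pure noise. *)
Definition log_lik (y : K.-tuple R) : spin -> R :=
  fun x => nrm l (fun=> 0) x + linform dirs_tuple y x.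

Lemma log_likE x y : gauss_tilt (edge_vec x) y = expR (log_lik y x).
Proof.
have E k : tnth (edge_vec x) k = tnth dirs_tuple k x.
  rewrite !tnth_mktuple /edge_dir sqrtrM// sqrtrV; last by [].
  by move: (Num.sqrt _) (_^-1) => s t; ring.
congr expR; rewrite addrC; congr (_ + _); last first.
  by rewrite /linform /dot; apply: eq_bigr => k _; rewrite E mulrC.
rewrite /nrm add0r; congr (- (_ / _)).
rewrite -dirs_tupleE /cov big_tuple /dot; apply: eq_bigr => k _.
by rewrite E.
Qed.

(** Under pure noise [log_lik] is the normalised Gaussian field with directions [l]; here the
    probability space meets the operator [TT]. *)
Lemma integral_log_lik Psi : good Psi ->
  (gauss_vec K).-integrable setT (fun y => (Psi (log_lik y))%:E) /\
  (\int[gauss_vec K]_y (Psi (log_lik y))%:E = (TT l Psi (fun=> 0))%:E)%E.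
Proof.
move=> gP; split; first exact: integrable_GG.
by rewrite /TT -[X in GG X]dirs_tupleE -integral_GG.
Qed.

Lemma wigner_expectation (g : n.-tuple R * K.-tuple R -> R) (Psi : spin -> (spin -> R) -> R) :
  measurable_fun setT g -> (forall x, good (Psi x)) ->
  (forall x y, g (spin_tuple x, y) = Psi x (log_lik y)) ->
  P.-integrable setT (fun w => (g (signal X w, obs w))%:E) /\
  (\int[P]_w (g (signal X w, obs w))%:E =
   (\sum_(x : spin) pX x * TT l (fun v => expR (v x) * Psi x v) (fun=> 0))%:E)%E.
Proof.
move=> mg gP gE.
have gX x : good (fun v : spin -> R => expR (v x) * Psi x v) by apply: goodM => //; exact: good_expR.
have E x : (fun y => (g (spin_tuple x, y) * gauss_tilt (edge_vec x) y)%:E) =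
    (fun y => (expR (log_lik y x) * Psi x (log_lik y))%:E).
  by apply/funext => y; rewrite gE log_likE mulrC.
have [|ig ->] := integral_wigner mg.
  by move=> x; rewrite E; exact: (integral_log_lik (gX x)).1.
split=> //; rewrite -sumEFin; apply: eq_bigr => x _.
by rewrite E (integral_log_lik (gX x)).2 EFinM.
Qed.

(** Density of the observation with respect to pure noise. *)
Definition evidence (y : K.-tuple R) : R := Zf pX (log_lik y).

Lemma evidence_gt0 y : 0 < evidence y.
Proof. by apply: Zf_gt0 => //; exact: prior_ge0. Qed.

Lemma measurable_log_lik x : measurable_fun [set: K.-tuple R] (fun y => log_lik y x).
Proof. by apply: measurable_funD => //; exact: measurable_linform. Qed.

Lemma measurable_good (Psi : (spin -> R) -> R) : good Psi ->
  measurable_fun [set: K.-tuple R] (fun y => Psi (log_lik y)).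
Proof. by move=> [mP _]; apply: mP => x; exact: measurable_log_lik. Qed.

Lemma ge0_integral_signal (F : n.-tuple R -> \bar R) :
  (forall s, 0 <= F s)%E -> measurable_fun setT F ->
  (\int[P]_w F (signal X w) = \sum_(x : spin) (pX x)%:E * F (spin_tuple x))%E.
Proof.
move=> F0 mF.
rewrite (ge0_integral_wigner
  (fun p => F0 p.1) (measurableT_comp mF measurable_fst)).
apply: eq_bigr => x _; congr (_ * _)%E.
rewrite /= ge0_integralZl//; last 2 first.
- by apply/measurable_EFinP; exact: measurable_gauss_tilt.
- by move=> y _; rewrite lee_fin expR_ge0.
have -> : (\int[gauss_vec K]_y (gauss_tilt (edge_vec x) y)%:E = 1)%E; last by rewrite mule1.
transitivity (\int[gauss_vec K]_y (expR (log_lik y x))%:E)%E.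
  by apply: eq_integral => y _; rewrite log_likE.
rewrite (integral_log_lik (good_expR x)).2; congr (_%:E).
have := TT_tilt l x (fun=> 0) (good_cst 1); rewrite TT_cst mulr1 expR0 => <-.
by congr TT; apply/funext => v; rewrite mulr1.
Qed.

Lemma ge0_integral_obs (F : K.-tuple R -> \bar R) :
  (forall s, 0 <= F s)%E -> measurable_fun setT F ->
  (\int[P]_w F (obs w) = \int[gauss_vec K]_y (F y * (evidence y)%:E))%E.
Proof.
move=> F0 mF.
rewrite (ge0_integral_wigner
  (fun p => F0 p.2) (measurableT_comp mF measurable_snd))/=.
have mt x : measurable_fun setT (fun y => F y * (gauss_tilt (edge_vec x) y)%:E)%E.
  by apply: emeasurable_funM => //; apply/measurable_EFinP; exact: measurable_gauss_tilt.
have t0 x y : (0 <= F y * (gauss_tilt (edge_vec x) y)%:E)%E.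
  by rewrite mule_ge0// lee_fin expR_ge0.
transitivity (\sum_(x : spin) \int[gauss_vec K]_y ((pX x)%:E * (F y * (gauss_tilt (edge_vec x) y)%:E)))%E.
  by apply: eq_bigr => x _; rewrite ge0_integralZl// lee_fin prior_ge0.
rewrite -ge0_integral_sum//.
- apply: eq_integral => y _.
  rewrite /evidence /Zf -sumEFin ge0_sume_distrr; last first.
    by move=> x _; rewrite lee_fin mulr_ge0 ?prior_ge0// expR_ge0.
  by apply: eq_bigr => x _; rewrite log_likE EFinM muleCA.
- by move=> x; apply: emeasurable_funM.
- by move=> x y _; rewrite mule_ge0// lee_fin prior_ge0.
Qed.

(** Extends [edge_vec] from bits to real tuples, as the density has to be a measurable function on
    the whole product space. *)
Let svec (s : n.-tuple R) : K.-tuple R :=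
  [tuple Num.sqrt (lambda / n%:R) *
    (tnth s (val (enum_val k)).1 * tnth s (val (enum_val k)).2) | k < K].

Let svecE x : svec (spin_tuple x) = edge_vec x.
Proof. by apply: eq_from_tnth => k; rewrite !tnth_mktuple. Qed.

Let msvec k : measurable_fun [set: n.-tuple R] (fun s => tnth (svec s) k).
Proof.
rewrite (_ : (fun s => _) = (fun s => Num.sqrt (lambda / n%:R) *
    (tnth s (val (enum_val k)).1 * tnth s (val (enum_val k)).2))).
  by apply: measurable_funM => //; apply: measurable_funM; exact: measurable_tnth.
by apply/funext => s; rewrite tnth_mktuple.
Qed.

Definition log_density (p : n.-tuple R * K.-tuple R) : R :=
  dot (svec p.1) p.2 - dot (svec p.1) (svec p.1) / 2 - ln (evidence p.2).

Lemma measurable_log_density : measurable_fun setT log_density.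
Proof.
have m1 k : measurable_fun setT (fun p : n.-tuple R * K.-tuple R => tnth (svec p.1) k).
  exact: (measurableT_comp (msvec k)).
apply: measurable_funB.
  apply: measurable_funB.
    apply: measurable_sum => k; apply: measurable_funM => //.
    exact: (measurableT_comp (measurable_tnth k)).
  by apply: measurable_funM => //; apply: measurable_sum => k; exact: measurable_funM.
have gl : good (fun v : spin -> R => ln (Zf pX v)).
  by apply: good_lnZf => //; exact: prior_ge0.
exact: (measurableT_comp (measurable_good gl) measurable_snd).
Qed.

Lemma log_densityE x y :
  log_density (spin_tuple x, y) = log_lik y x - ln (evidence y).
Proof.
rewrite /log_density/= svecE; congr (_ - _).
by apply: expR_inj; rewrite -log_likE.
Qed.

(** The tilt is the conditional density of the observation given the signal, and it equals exp
    [log_density] times the evidence, the density of the observation. *)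
Lemma joint_density A : measurable A ->
  distribution P (pair_RV (signal X) obs) A =
  (\int[distribution P (signal X) \x distribution P obs]_(p in A) (expR (log_density p))%:E)%E.
Proof.
move=> mA.
have mE : measurable_fun setT (fun p => (expR (log_density p))%:E).
  by apply/measurable_EFinP; apply: measurableT_comp => //; exact: measurable_log_density.
have mI : measurable_fun setT (fun p : n.-tuple R * K.-tuple R => (\1_A p)%:E : \bar R).
  by apply/measurable_EFinP.
have I0 p : (0 <= (\1_A p)%:E :> \bar R)%E by rewrite lee_fin.
transitivity (\int[P]_w (\1_A (signal X w, obs w))%:E)%E.
  rewrite -(ge0_integral_distribution (pair_RV (signal X) obs) mI I0).
  by rewrite integral_indic// setIT.
rewrite (ge0_integral_wigner I0 mI).
pose f p := ((\1_A p)%:E * (expR (log_density p))%:E : \bar R)%E.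
have mf : measurable_fun setT f by exact: emeasurable_funM.
have f0 p : (0 <= f p)%E by rewrite mule_ge0// lee_fin expR_ge0.
transitivity (\int[distribution P (signal X) \x distribution P obs]_p f p)%E; last first.
  rewrite [RHS]integral_mkcond; apply: eq_integral => p _; rewrite /f /patch indicE.
  by case: (p \in A); rewrite ?mul1e ?mul0e.
rewrite (@fubini_tonelli1 _ _ _ _ _ (distribution P (signal X)) (distribution P obs) f mf f0).
have mF := measurable_fun_fubini_tonelli_F (m2 := distribution P obs) f mf f0.
have F0 s : (0 <= fubini_F (distribution P obs) f s)%E by apply: integral_ge0.
rewrite (ge0_integral_distribution (signal X) mF F0).
rewrite (ge0_integral_signal F0 mF); apply: eq_bigr => x _; congr (_ * _)%E.
have ms : measurable_fun setT (fun y => f (spin_tuple x, y)).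
  by apply: (measurableT_comp mf); exact: measurable_pair1.
rewrite /fubini_F (ge0_integral_distribution obs ms (fun y => f0 _)).
rewrite (ge0_integral_obs (fun y => f0 _) ms); apply: eq_integral => y _.
have key : expR (log_density (spin_tuple x, y)) * evidence y = gauss_tilt (edge_vec x) y.
  rewrite log_densityE expRD expRN lnK ?posrE ?evidence_gt0//.
  by rewrite divfK ?gt_eqF ?evidence_gt0// log_likE.
by rewrite -key /f EFinM muleA.
Qed.

(** The tilt raises the mean at [x] by the variance, half of which the normalisation removes. *)
Lemma TT_tilted_eval (m : seq (spin -> R)) x :
  TT m (fun v => expR (v x) * v x) (fun=> 0) = cov m x x / 2.
Proof.
rewrite TT_tilt; last exact: (good_coord x tame_id).
rewrite expR0 mul1r /TT GG_eval /nrm add0r; lra.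
Qed.

Lemma prior_edge (e : edge n) :
  \sum_(x : spin) pX x * ((x (val e).1)%:R * (x (val e).2)%:R) = eps ^+ 2.
Proof.
case: e => -[i j] /= ij.
have ij' : i != j by rewrite -val_eqE neq_ltn ij.
pose f (k : 'I_n) (b : bool) : R := bern eps b * (if (k == i) || (k == j) then b%:R else 1).
transitivity (\sum_(x : spin) \prod_k f k (x k)).
  apply: eq_bigr => x _; rewrite big_split/=; congr (_ * _).
  rewrite (bigD1 i)//= eqxx/= (bigD1 j) 1?eq_sym//= eqxx orbT mulrA big1 ?mulr1//.
  by move=> k /andP[/negbTE -> /negbTE ->].
rewrite (sum_prod_spin f) (bigD1 i)//= (bigD1 j) 1?eq_sym//=.
rewrite [X in _ * (_ * X)]big1; last first.
  move=> k /andP[/negbTE ki /negbTE kj].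
  by rewrite big_bool/= /f ki kj/= !mulr1 subrKC.
by rewrite !big_bool/= /f !eqxx orbT /bern/= !mulr1 !mulr0 !addr0 expr2.
Qed.

Lemma card_edge : K%:R = n%:R * (n%:R - 1) / 2 :> R.
Proof.
have -> : K%:R = \sum_(e : edge n) (1 * 1 : R) by rewrite sumr_const mulr1.
rewrite (@sum_edge R n (fun=> 1)).
by rewrite !expr1n !sumr_const !card_ord; field.
Qed.

Lemma mean_cov : (0 < n)%N ->
  \sum_(x : spin) pX x * (cov l x x / 2) = lambda * (n%:R - 1) / 4 * eps ^+ 2.
Proof.
move=> n0; have nR : (0 : R) < n%:R by rewrite ltr0n.
transitivity (\sum_(e : edge n) lambda / (2 * n%:R) * eps ^+ 2).
  under [RHS]eq_bigr => e _ do rewrite -(prior_edge e) mulr_sumr.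
  rewrite exchange_big/=; apply: eq_bigr => x _.
  rewrite cov_scale sqr_sqrtr// /cov /edge_dirs big_map big_enum/=.
  rewrite -[X in pX x * X]mulrA mulr_suml 2!mulr_sumr; apply: eq_bigr => e _.
  have sn : Num.sqrt n%:R ^+ 2 = n%:R :> R by rewrite sqr_sqrtr// ltW.
  have sn0 : Num.sqrt n%:R != 0 :> R by rewrite gt_eqF// sqrtr_gt0.
  rewrite /edge_dir; move: (Num.sqrt n%:R) sn sn0 => r <- r0.
  have := @bit_sqr R (x (val e).1); have := @bit_sqr R (x (val e).2).
  move: (pX x) (x _)%:R (x _)%:R => p u v uE vE; rewrite -[in RHS]uE -[in RHS]vE.
  by field.
rewrite sumr_const -[LHS]mulr_natl card_edge; field; rewrite gt_eqF//.
Qed.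

(** The log-likelihood of the planted configuration has mean half its variance, averaged over the
    prior in [mean_cov]; the mean of ln of the evidence is [F_n]. *)
Lemma mutual_information_wigner : (0 < n)%N ->
  mutual_information (signal X) obs =
    (lambda * (n%:R - 1) / 4 * eps ^+ 2 - F_n eps n lambda)%:E.
Proof.
move=> n0.
rewrite /mutual_information.
rewrite (kl_divergence_density measurable_log_density joint_density).
have gl : good (fun v : spin -> R => ln (Zf pX v)) by exact: good_lnZf.
have gx x : good (fun v : spin -> R => v x) by exact: (good_coord x tame_id).
have gP x : good (fun v : spin -> R => v x - ln (Zf pX v)) by exact: goodB.
have [iP EP] := wigner_expectation
  measurable_log_density gP log_densityE.
rewrite (@integral_distribution _ _ _ _ _ P (pair_RV (signal X) obs) (EFin \o log_density)) => [| |//]; last first.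
  by apply/measurable_EFinP; exact: measurable_log_density.
rewrite EP; congr (_%:E).
transitivity (\sum_(x : spin) pX x * (cov l x x / 2) -
  TT l (fun v => \sum_x pX x * (expR (v x) * ln (Zf pX v))) (fun=> 0)).
  have ge x : good (fun v : spin -> R => expR (v x)) by exact: good_expR.
  rewrite TT_sum; last by move=> x; apply: goodZ; exact: goodM.
  rewrite -sumrB; apply: eq_bigr => x _.
  rewrite -TT_tilted_eval TTZ; last exact: goodM.
  rewrite -mulrBr -TTB; [|exact: goodM|exact: goodM].
  by congr (_ * TT _ _ _); apply/funext => v; rewrite mulrBr.
rewrite mean_cov//; congr (_ - _); rewrite /F_n /free_energy; congr TT.
by apply/funext => v; rewrite mulr_suml; apply: eq_bigr => x _; rewrite mulrA.
Qed.

Let pair_at (e : edge n) (x : spin) : R := (x (val e).1)%:R * (x (val e).2)%:R.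

(** The posterior law is the Gibbs measure of the log-likelihood field. *)
Definition post_mean (e : edge n) (v : spin -> R) : R := \sum_x gibbs pX v x * pair_at e x.

Lemma good_post_mean e : good (post_mean e).
Proof.
by apply: good_sum => x; apply: goodM; [exact: good_gibbs|exact: good_cst].
Qed.

Lemma Zf_post_mean e v :
  Zf pX v * post_mean e v = \sum_x pX x * expR (v x) * pair_at e x.
Proof.
rewrite mulr_sumr; apply: eq_bigr => x _.
by rewrite /gibbs mulrA mulrC [Zf _ _ * _]mulrC divfK 1?mulrC// gt_eqF// Zf_gt0.
Qed.

Let mpair_fun (e : edge n) : measurable_fun setT
  (fun p : n.-tuple R * K.-tuple R => tnth p.1 (val e).1 * tnth p.1 (val e).2).
Proof.
by apply: measurable_funM; apply: (measurableT_comp (measurable_tnth _)).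
Qed.

Let mpost e : measurable_fun setT
  (fun p : n.-tuple R * K.-tuple R => post_mean e (log_lik p.2)).
Proof.
exact: (measurableT_comp (measurable_good (good_post_mean e)) measurable_snd).
Qed.

Let XXE (e : edge n) w : XX X e w = tnth (signal X w) (val e).1 * tnth (signal X w) (val e).2.
Proof. by rewrite !tnth_mktuple. Qed.

Let int_indic (C : set (K.-tuple R)) (Psi : (spin -> R) -> R) : measurable C -> good Psi ->
  (gauss_vec K).-integrable setT (fun y => (\1_C y * Psi (log_lik y))%:E).
Proof.
move=> mC gP; have iP := (integral_log_lik gP).1.
apply: le_integrable iP => //.
  apply/measurable_EFinP; apply: measurable_funM => //; exact: measurable_good.
move=> y _; rewrite lee_fin normrM indicE.
by case: (y \in C); rewrite ?normr1 ?mul1r// normr0 mul0r.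
Qed.

(** Bayes' formula: tested on an event of the observation, both sides become sums over
    configurations under pure noise, equal by [Zf_post_mean]. *)
Lemma is_condexp_post_mean e : is_condexp (XX X e) obs (fun w => post_mean e (log_lik (obs w))).
Proof.
have gM := good_post_mean e.
have ge x : good (fun v : spin -> R => expR (v x)) by exact: good_expR.
have [iM _] := wigner_expectation (mpost e)
  (fun _ : spin => gM) (fun x y => erefl).
split=> //.
  move=> B mB; exists ((fun y => post_mean e (log_lik y)) @^-1` B); last by rewrite setTI.
  by rewrite -[X in measurable X]setTI; exact: measurable_good.
move=> _ [C mC <-]; rewrite setTI.
have mI : measurable_fun setT (fun p : n.-tuple R * K.-tuple R => \1_C p.2 : R).
  by apply: (measurableT_comp _ measurable_snd).
pose g1 (p : n.-tuple R * K.-tuple R) := \1_C p.2 * post_mean e (log_lik p.2).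
pose g2 (p : n.-tuple R * K.-tuple R) := \1_C p.2 * (tnth p.1 (val e).1 * tnth p.1 (val e).2).
have mg1 : measurable_fun setT g1 by exact: measurable_funM.
have mg2 : measurable_fun setT g2 by exact: measurable_funM.
have g1E x y : g1 (spin_tuple x, y) * gauss_tilt (edge_vec x) y =
    \1_C y * (post_mean e (log_lik y) * expR (log_lik y x)).
  by rewrite /g1/= log_likE// mulrA.
have g2E x y : g2 (spin_tuple x, y) * gauss_tilt (edge_vec x) y =
    \1_C y * (pair_at e x * expR (log_lik y x)).
  by rewrite /g2/= log_likE// !tnth_mktuple -mulrA.
have i1 x : (gauss_vec K).-integrable setT (fun y => (g1 (spin_tuple x, y) * gauss_tilt (edge_vec x) y)%:E).
  have -> : (fun y => (g1 (spin_tuple x, y) * gauss_tilt (edge_vec x) y)%:E) =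
      (fun y => (\1_C y * (post_mean e (log_lik y) * expR (log_lik y x)))%:E).
    by apply/funext => y; rewrite g1E.
  exact: (int_indic mC (goodM gM (ge x))).
have i2 x : (gauss_vec K).-integrable setT (fun y => (g2 (spin_tuple x, y) * gauss_tilt (edge_vec x) y)%:E).
  have -> : (fun y => (g2 (spin_tuple x, y) * gauss_tilt (edge_vec x) y)%:E) =
      (fun y => (\1_C y * (pair_at e x * expR (log_lik y x)))%:E).
    by apply/funext => y; rewrite g2E.
  exact: (int_indic mC (goodZ (pair_at e x) (ge x))).
transitivity (\int[P]_w (g1 (signal X w, obs w))%:E)%E.
  rewrite integral_mkcond; apply: eq_integral => w _; rewrite /patch /g1/= indicE.
  by rewrite (_ : (w \in _) = (obs w \in C)); [case: (_ \in C); rewrite ?mul1r ?mul0r|by []].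
transitivity (\int[P]_w (g2 (signal X w, obs w))%:E)%E; last first.
  rewrite [RHS]integral_mkcond; apply: eq_integral => w _; rewrite /patch /g2/= indicE -XXE.
  by rewrite (_ : (w \in _) = (obs w \in C)); [case: (_ \in C); rewrite ?mul1r ?mul0r|by []].
rewrite (integral_wigner mg1 i1).2.
rewrite (integral_wigner mg2 i2).2.
have push (g : n.-tuple R * K.-tuple R -> R) :
    (forall x, (gauss_vec K).-integrable setT (fun y => (g (spin_tuple x, y) * gauss_tilt (edge_vec x) y)%:E)) ->
    (\sum_(x : spin) (pX x)%:E * \int[gauss_vec K]_y (g (spin_tuple x, y) * gauss_tilt (edge_vec x) y)%:E =
     \int[gauss_vec K]_y (\sum_(x : spin) pX x * (g (spin_tuple x, y) * gauss_tilt (edge_vec x) y))%:E)%E.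
  move=> ig; 
  transitivity (\int[gauss_vec K]_y \sum_(x : spin) (pX x)%:E *
      (g (spin_tuple x, y) * gauss_tilt (edge_vec x) y)%:E)%E; last first.
    by apply: eq_integral => y _; rewrite -sumEFin.
  rewrite integral_sum//; last by move=> x; exact: integrableZl.
  by apply: eq_bigr => x _; rewrite integralZl.
rewrite (push g1 i1) (push g2 i2); apply: eq_integral => y _; congr (_%:E).
rewrite (eq_bigr _ (fun x _ => congr1 (fun t => pX x * t) (g1E x y))).
rewrite [RHS](eq_bigr _ (fun x _ => congr1 (fun t => pX x * t) (g2E x y))).
transitivity (\1_C y * (Zf pX (log_lik y) * post_mean e (log_lik y))).
  rewrite mulr_suml mulr_sumr; apply: eq_bigr => x _; ring.
rewrite Zf_post_mean mulr_sumr; apply: eq_bigr => x _; ring.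
Qed.

Let TT_expR1 x : TT l (fun v : spin -> R => expR (v x)) (fun=> 0) = 1.
Proof.
have := TT_tilt l x (fun=> 0) (good_cst 1); rewrite TT_cst mulr1 expR0 => <-.
by congr TT; apply/funext => v; rewrite mulr1.
Qed.

Let pair_at_sqr e x : pair_at e x ^+ 2 = pair_at e x.
Proof. by rewrite exprMn !bit_sqr. Qed.

(** In the expanded square the cross term is twice the planted mean of the squared posterior mean,
    which leaves a Pythagorean difference. The first term is eps^2 because a product of bits is its
    own square. *)
Lemma edge_error e :
  'E_P[fun w => ((XX X e w - condexp (XX X e) obs w) ^+ 2)%R]%E =
  (eps ^+ 2 - TT l (fun v => Zf pX v * post_mean e v ^+ 2) (fun=> 0))%:E.
Proof.
have gM := good_post_mean e.
have ge x : good (fun v : spin -> R => expR (v x)) by exact: good_expR.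
have gZ : good (Zf pX) by exact: good_Zf.
have [[ic _ _] cM] := condexp_ae_eq (is_condexp_post_mean e).
pose g (p : n.-tuple R * K.-tuple R) :=
  (tnth p.1 (val e).1 * tnth p.1 (val e).2 - post_mean e (log_lik p.2)) ^+ 2.
have mg : measurable_fun setT g.
  by apply: measurable_funX; exact: measurable_funB.
rewrite unlock; transitivity (\int[P]_w (g (signal X w, obs w))%:E)%E.
  apply: ae_eq_integral => //.
  - apply/measurable_EFinP; apply: measurable_funX; apply: measurable_funB.
      exact: measurable_XX.
    by apply/measurable_EFinP; exact: (measurable_int P ic).
  - apply/measurable_EFinP; apply: (measurableT_comp mg).
    by apply: measurable_fun_pair; exact: measurable_funPT.
  - by apply: filterS cM => w E _; rewrite /g /= -XXE E.
have gP x : good (fun v : spin -> R => (pair_at e x - post_mean e v) ^+ 2).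
  by apply: goodX; apply: goodB => //; exact: good_cst.
have gE x y : g (spin_tuple x, y) = (pair_at e x - post_mean e (log_lik y)) ^+ 2.
  by rewrite /g/= !tnth_mktuple.
rewrite (wigner_expectation mg gP gE).2; congr (_%:E).
have gep x : good (fun v : spin -> R => pX x * (expR (v x) * (pair_at e x - post_mean e v) ^+ 2)).
  by apply: goodZ; exact: goodM.
have gZM : good (fun v => Zf pX v * post_mean e v ^+ 2) by apply: goodM => //; exact: goodX.
have gpe x : good (fun v : spin -> R => (pX x * pair_at e x) * expR (v x)) by exact: goodZ.
transitivity (TT l (fun v => \sum_x (pX x * pair_at e x) * expR (v x)) (fun=> 0) -
    TT l (fun v => Zf pX v * post_mean e v ^+ 2) (fun=> 0)); last first.
  congr (_ - _); rewrite TT_sum// -(prior_edge e); apply: eq_bigr => x _.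
  by rewrite TTZ// TT_expR1 mulr1.
rewrite -TTB//; last exact: good_sum.
transitivity (TT l (fun v => \sum_x pX x * (expR (v x) * (pair_at e x - post_mean e v) ^+ 2)) (fun=> 0)).
  by rewrite TT_sum//; apply: eq_bigr => x _; rewrite TTZ//; exact: goodM.
congr TT; apply/funext => v.
transitivity (\sum_x (pX x * pair_at e x * expR (v x)) -
   2 * post_mean e v * (\sum_x pX x * expR (v x) * pair_at e x) +
   post_mean e v ^+ 2 * Zf pX v); last first.
  rewrite -Zf_post_mean; move: (post_mean e v) (Zf pX v) (\sum_x _) => u z s; ring.
move: (post_mean e v) => u.
rewrite /Zf !mulr_sumr -sumrB -big_split/=; apply: eq_bigr => x _.
by rewrite sqrrB pair_at_sqr; move: (pair_at e x) (expR _) => w z; ring.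
Qed.

(** Edge directions carry n^(-1/2), so the squares in [overlap_energyE] are squared posterior means
    divided by n; the 2 undoes the half in [free_slope]. *)
Lemma sum_edge_overlap : (0 < n)%N ->
  \sum_(e : edge n) TT l (fun v => Zf pX v * post_mean e v ^+ 2) (fun=> 0) =
  2 * n%:R * D_n eps n lambda.
Proof.
move=> n0; have nR : (0 : R) < n%:R by rewrite ltr0n.
have gZ : good (Zf pX) by exact: good_Zf.
have gZM e : good (fun v => Zf pX v * post_mean e v ^+ 2).
  by apply: goodM => //; apply: goodX; exact: good_post_mean.
rewrite -TT_sum//.
rewrite /D_n /free_slope.
have -> : overlap_energy pX dirs = (fun v => n%:R^-1 * \sum_e Zf pX v * post_mean e v ^+ 2).
  apply/funext => v; rewrite overlap_energyE// /edge_dirs big_map big_enum/= mulr_sumr.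
  apply: eq_bigr => e _.
  have -> : \sum_x pX x * expR (v x) * edge_dir e x = Zf pX v * post_mean e v / Num.sqrt n%:R.
    by rewrite Zf_post_mean mulr_suml; apply: eq_bigr => x _; rewrite /edge_dir /pair_at !mulrA.
  have zn : Zf pX v != 0 by rewrite gt_eqF// Zf_gt0.
  rewrite expr_div_n sqr_sqrtr ?(ltW nR)//.
  by move: (Zf pX v) zn (post_mean e v) => z zn u; field; rewrite zn gt_eqF.
rewrite TTZ; last exact: good_sum.
by move: (TT _ _ _) => t; field; rewrite gt_eqF.
Qed.

Lemma MMSE_wigner : (1 < n)%N ->
  MMSE lambda X Z = (eps ^+ 2 - 4 * (D_n eps n lambda / (n%:R - 1)))%:E.
Proof.
move=> n1; have n0 : (0 < n)%N by exact: ltn_trans n1.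
have nR : (0 : R) < n%:R by rewrite ltr0n.
have n1R : (0 : R) < n%:R - 1 by rewrite subr_gt0 ltr1n.
rewrite /MMSE; under eq_bigr do rewrite edge_error.
rewrite sumEFin -EFinM sumrB sum_edge_overlap//.
have -> : \sum_(e : edge n) eps ^+ 2 = n%:R * (n%:R - 1) / 2 * eps ^+ 2.
  by rewrite sumr_const -[LHS]mulr_natl card_edge.
by congr (_%:E); move: (D_n _ _ _) => t; field; rewrite !gt_eqF.
Qed.

End wigner_model.

Section scalar_potential.
Context {R : realType} {eps : R} {d} {T : measurableType d} {P : probability T R}.
Variables (X0 Z0 : {RV P >-> R}).
Hypothesis eps01 : 0 < eps <= 1.
Hypothesis lawX0 : has_law X0 (bernoulli_law eps).
Hypothesis lawZ0 : has_law Z0 (normal_prob 0 1).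
Hypothesis indep : mutually_independent (fun b : bool => if b then X0 else Z0).

Let S (b : bool) := X0 @^-1` [set b%:R].

Let PS b B : measurable B -> P (S b `&` Z0 @^-1` B) = ((bern eps b)%:E * std_normal B)%E.
Proof.
move=> mB; have m1 : measurable [set b%:R : R] by exact: measurable_set1.
pose A (c : bool) : set R := if c then [set b%:R] else B.
have mA c : measurable (A c) by case: c.
have := @indep [set: bool]%SET A mA.
rewrite (_ : \bigcap_(i in _) _ = S b `&` Z0 @^-1` B); last first.
  apply/seteqP; split => w.
    by move=> H; split; [apply: (H true)|apply: (H false)]; rewrite /= inE.
  by move=> [h1 h2] [] _.
move=> ->.
rewrite (eq_bigl xpredT); last by move=> c; rewrite inE.
rewrite big_bool/=; congr (_ * _)%E.
  by rewrite -bernoulli_law1//; exact: lawX0.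
exact: (eq_trans (lawZ0 mB) (esym (std_normalE B))).
Qed.

(** Given X0 = b, the signal term lambda q b amounts to shifting the noise by sqrt(lambda q) b; the
    expectation is the planted form of [psi]. *)
Lemma potentialE lambda q : 0 <= lambda -> 0 <= q ->
  potential eps X0 Z0 lambda q = (rs_potential eps lambda q)%:E.
Proof.
move=> l0 q0; have h0 : 0 <= lambda * q by exact: mulr_ge0.
transitivity ((- (lambda * q ^+ 2 / 4))%:E + (psi eps (lambda * q))%:E)%E; last first.
  by rewrite -EFinD /rs_potential addrC.
rewrite /potential; congr (_ + _)%E; rewrite unlock.
pose F (w : T) := ln (1 - eps + eps * expR (Num.sqrt (lambda * q) * Z0 w +
  lambda * q * X0 w - lambda * q / 2)).
have mF : measurable_fun setT F.
  apply: measurableT_comp => //; apply: measurable_funD => //.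
  apply: measurable_funM => //; apply: measurableT_comp => //.
  apply: measurable_funB => //; apply: measurable_funD; apply: measurable_funM => //.
have tl b : tame (fun t => ln (zeta_at eps b (lambda * q) t)) by exact: tame_ln_zeta_at.
have mS b : measurable (S b).
  by rewrite -[X in measurable X]setTI; apply: measurable_funPT => //; exact: measurable_set1.
have tS : trivIset [set: bool] S.
  by move=> b c _ _ [w []]; rewrite /S/= => -> /eqP; case: b; case: c => //=;
    rewrite ?oner_eq0// eq_sym oner_eq0.
transitivity (\int[P]_w (F w)%:E)%E; first by [].
rewrite (integral_mixture mS tS (measurable_funPT Z0) (bern_ge0 eps01) (sum_bern eps) (fun b B mB => @PS b B mB) mF
  (f := fun b t => ln (zeta_at eps b (lambda * q) t))).
- rewrite psi_planted// -sumEFin; apply: eq_bigr => b _.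
  by rewrite EFinM gE_EFin.
- by move=> b; exact: tame_integrable.
- move=> b w Sw; have {}Sw : X0 w = b%:R := Sw.
  have e : Num.sqrt (lambda * q) * (Z0 w + Num.sqrt (lambda * q) * b%:R) =
      Num.sqrt (lambda * q) * Z0 w + lambda * q * b%:R.
    by rewrite mulrDr mulrA -expr2 sqr_sqrtr.
  by rewrite /F Sw /zeta_at /zeta e.
Qed.

End scalar_potential.

Lemma cvg_inv_nat {R : realType} : (n%:R^-1 : R) @[n --> \oo] --> (0 : R).
Proof.
apply/cvgrPdist_le => e e0; near=> n.
have n0 : (0 < n)%N by near: n; exact: nbhs_infty_gt.
have en : e^-1 <= n%:R by near: n; exact: nbhs_infty_ger.
by rewrite sub0r normrN ger0_norm ?invr_ge0// invf_ple ?posrE ?ltr0n.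
Unshelve. all: by end_near.
Qed.

Theorem proposition3 (R : realType) (eps : R) (heps : 0 < eps <= 1)
    (d : nat -> measure_display) (T : forall n, measurableType (d n))
    (P : forall n, probability (T n) R)
    (X : forall n, 'I_n -> {RV (P n) >-> R})
    (Z : forall n, edge n -> {RV (P n) >-> R})
    (lawX : forall n (i : 'I_n), has_law (X n i) (bernoulli_law eps))
    (lawZ : forall n (e : edge n), has_law (Z n e) (normal_prob 0 1))
    (indepXZ : forall n, mutually_independent (signal_and_noise (X n) (Z n)))
    (d0 : measure_display) (T0 : measurableType d0) (P0 : probability T0 R)
    (X0 Z0 : {RV P0 >-> R})
    (lawX0 : has_law X0 (bernoulli_law eps))
    (lawZ0 : has_law Z0 (normal_prob 0 1))
    (indepX0Z0 : mutually_independent (fun b : bool => if b then X0 else Z0)) :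
  (forall lambda : R, 0 < lambda ->
     ((n%:R^-1)%:E *
        mutual_information (signal (X n)) (observation lambda (X n) (Z n)))%E
       @[n --> \oo] -->
     ((lambda * eps ^+ 2 / 4)%:E -
        ereal_sup [set potential eps X0 Z0 lambda q | q in [set q : R | (0 <= q)%R]])%E)
  /\
  {ae @lebesgue_measure R, forall lambda : R, 0 < lambda ->
     exists q : R,
       unique (nonneg_maximizer (potential eps X0 Z0 lambda)) q /\
       MMSE lambda (X n) (Z n) @[n --> \oo] --> (eps ^+ 2 - q ^+ 2)%:E}.
Proof.
have potE := potentialE heps lawX0 lawZ0 indepX0Z0.
split=> [lambda l0|].
  have lw := ltW l0.
  have -> : ereal_sup [set potential eps X0 Z0 lambda q | q in [set q : R | (0 <= q)%R]] =
      (fe_lim eps lambda)%:E.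
    have [q [q0 _ E _]] := fe_lim_attained heps lw.
    apply/eqP; rewrite eq_le; apply/andP; split.
      by apply: ge_ereal_sup => _ [q' /= q'0 <-]; rewrite potE// lee_fin rs_potential_le_fe_lim.
    by apply: ereal_sup_ubound; exists q => //=; rewrite potE// E.
  rewrite -EFinB; apply: cvg_EFin.
    near=> n; have n0 : (0 < n)%N by near: n; exact: nbhs_infty_gt.
    by rewrite (mutual_information_wigner heps lw (lawX n) (lawZ n) (indepXZ n) n0).
  have C : lambda * eps ^+ 2 / 4 * (1 - n%:R^-1) - F_n eps n lambda / n%:R @[n --> \oo] -->
      lambda * eps ^+ 2 / 4 - fe_lim eps lambda.
    apply: cvgB; last exact: cvg_F_n.
    rewrite -[X in _ --> X]mulr1; apply: cvgMr; rewrite -[X in _ --> X]subr0.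
    by apply: cvgB; [exact: cvg_cst|exact: cvg_inv_nat].
  apply: cvg_trans C; apply: near_eq_cvg; near=> n.
  have n0 : (0 < n)%N by near: n; exact: nbhs_infty_gt.
  rewrite /= (mutual_information_wigner heps lw (lawX n) (lawZ n) (indepXZ n) n0) -EFinM/=.
  by move: (F_n _ _ _) => t; field; rewrite pnatr_eq0 -lt0n.
have [N [cN HN]] := cvg_derivative_ae heps.
exists N; split.
- exact: countable_measurable.
- exact: countable_lebesgue_measure0.
- move=> lambda /= /not_implyP[l0 noq]; apply: contrapT => Nl; apply: noq.
  have lw := ltW l0.
  have [q [q0 qE quniq Dcvg]] := HN lambda l0 Nl.
  exists q; split.
    split.
      by split=> // q' q'0; rewrite !potE// lee_fin qE rs_potential_le_fe_lim.
    move=> q' [q'0 Hq']; apply/esym; apply: quniq => //.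
    apply/eqP; rewrite eq_le rs_potential_le_fe_lim//= -qE.
    by have := Hq' q q0; rewrite !potE// lee_fin.
  apply: cvg_EFin.
    near=> n; have n1 : (1 < n)%N by near: n; exact: nbhs_infty_gt.
    by rewrite (MMSE_wigner heps lw (lawX n) (lawZ n) (indepXZ n) n1).
  (* The error is normalised by n - 1 and the derivative by n; their ratio tends to 1. *)
  have C : eps ^+ 2 - 4 * (D_n eps n lambda / n%:R * (1 - n%:R^-1)^-1) @[n --> \oo] -->
      eps ^+ 2 - 4 * (q ^+ 2 / 4 * (1 - 0)^-1).
    apply: cvgB; first exact: cvg_cst.
    apply: cvgMr; apply: cvgM; first exact: Dcvg.
    apply: cvgV; first by rewrite subr0.
    by apply: cvgB; [exact: cvg_cst|exact: cvg_inv_nat].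
  rewrite (_ : eps ^+ 2 - q ^+ 2 = eps ^+ 2 - 4 * (q ^+ 2 / 4 * (1 - 0)^-1)); last by field.
  apply: cvg_trans C; apply: near_eq_cvg; near=> n.
  have n1 : (1 < n)%N by near: n; exact: nbhs_infty_gt.
  rewrite /= (MMSE_wigner heps lw (lawX n) (lawZ n) (indepXZ n) n1)/=.
  have nn0 : n%:R != 0 :> R by rewrite pnatr_eq0 -lt0n; exact: ltn_trans n1.
  have n10 : n%:R - 1 != 0 :> R by rewrite subr_eq0 pnatr_eq1 gtn_eqF.
  by move: (D_n _ _ _) => t; field; rewrite ?nn0 ?n10.
Unshelve. all: by end_near.
Qed.
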